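(* Fix any $\lambda<1$. Under the $n$-Multicolored Clique assumption (stated in the context), there exists a constant $\varepsilon_\lambda>0$ such that no randomized algorithm running in time $f(n)\,m^{o(n)}$, for any computable function $f$, can solve the following task in general: given a succinct classical description of a nonzero $n$-fermion vector $|\Phi\rangle$ on $m$ modes, output a Slater determinant $|S\rangle$ satisfying $$\frac{|\langle S|\Phi\rangle|^2}{\|\Phi\|^2}\ \ge\ \mathsf{OPT}-\varepsilon_\lambda,\qquad \mathsf{OPT}=\max_{|S\rangle\in\mathcal S}\frac{|\langle S|\Phi\rangle|^2}{\|\Phi\|^2},$$ with success probability at least $0.99$, even under the promise that $\mathsf{OPT}\ge\lambda$.
   Context: Fermions: $\mathcal H_1$ is an $m$-dimensional complex Hilbert space with orthonormal basis created by $c_1^\dagger,\dots,c_m^\dagger$, $n\le m$, and $\mathcal H_n=\wedge^n\mathcal H_1$ is the $n$-fermion space on $m$ modes. $\mathcal S=\{|\varphi_1\rangle\wedge\cdots\wedge|\varphi_n\rangle:\langle\varphi_i|\varphi_j\rangle=\delta_{ij}\}$ is the set of (unit-norm) Slater determinants. For $I=\{i_1<\dots<i_n\}\subset[m]$, $|I\rangle=c_{i_1}^\dagger\cdots c_{i_n}^\dagger|0\rangle$. A succinct classical description of $|\Phi\rangle$ is a polynomial-size circuit which, on input a set $I\subset[m]$ with $|I|=n$, returns the (possibly unnormalized) amplitude $\langle I|\Phi\rangle$ (the norm $\|\Phi\|$ need not be given). $n$-Multicolored Clique assumption: Let $G$ be a graph whose vertex set is partitioned into $n$ color classes $V_1,\dots,V_n$,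 each of size $p$. An $n$-multicolored clique is a choice of one vertex from each color class such that the $n$ chosen vertices are pairwise adjacent. The assumption is: given $G$, there is no randomized algorithm running in time $f(n)p^{o(n)}$, for any computable function $f$, which distinguishes (with success probability bounded above $1/2$ by a constant) the following two cases under the promise that one of them holds: (1) $G$ has no $n$-multicolored clique; (2) $G$ has exactly one $n$-multicolored clique. *)

(* Defs.v *)
From mathcomp Require Import all_boot all_order all_algebra.
From mathcomp Require Import all_classical all_reals all_analysis.
From mathcomp Require Import complex.

Set Implicit Arguments.
Unset Strict Implicit.
Unset Printing Implicit Defensive.

Import Order.TTheory GRing.Theory Num.Theory.
Import numFieldNormedType.Exports.

Local Open Scope ring_scope.
Local Open Scope complex_scope.

(* Randomized algorithms: structured programs over finitely many stacks of bits.
   Every elementary step inspects or changes only the top of one stack, so this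
   is a probabilistic multi-tape Turing machine (two stacks per tape) with
   structured control, up to constant factors in the running time. *)

Inductive prog : Type :=
| Skip
| Push of bool & nat
| Pop of nat
| Flip of nat
| Seq of prog & prog
| Case of nat & prog & prog & prog (* top of the stack: none, false, true *)
| While of nat & prog.             (* as long as the stack is nonempty *)

Definition store := nat -> seq bool.

Definition upd (s : store) (x : nat) (w : seq bool) : store :=
  fun y => if y == x then w else s y.

(* The second component is the list of programs that remain to be executed. *)
Definition config := (store * seq prog)%type.

(* Each step is supplied with a fresh coin, which only Flip looks at. *)
Definition step (cf : config) (coin : bool) : config :=
  let: (s, k) := cf in
  match k with
  | [::] => cf
  | Skip :: k' => (s, k')
  | Push b x :: k' => (upd s x (b :: s x), k')
  | Pop x :: k' => (upd s x (behead (s x)), k')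
  | Flip x :: k' => (upd s x (coin :: s x), k')
  | Seq c1 c2 :: k' => (s, c1 :: c2 :: k')
  | Case x c0 cF cT :: k' =>
      (s, (if s x is b :: _ then (if b then cT else cF) else c0) :: k')
  | While x c :: k' => (s, if s x is [::] then k' else c :: k)
  end.

(* Stack 0 holds the input at the start and the output at the end. *)
Definition run (A : prog) (w coins : seq bool) : config :=
  foldl step (upd (fun=> [::]) 0%N w, [:: A]) coins.

Definition halted (cf : config) : bool := if cf.2 is [::] then true else false.

Definition output (cf : config) : seq bool := cf.1 0%N.

Definition halts_within (A : prog) (w : seq bool) (T : nat) : Prop :=
  forall r : T.-tuple bool, halted (run A w r).

(* If A halts within T steps on w, the value does not change when T is replaced
   by a larger number. *)
Definition prob (R : realType) (A : prog) (w : seq bool) (T : nat)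
    (P : seq bool -> Prop) : R :=
  #|[pred r : T.-tuple bool | `[< P (output (run A w r)) >]]|%:R / (2 ^ T)%:R.

Definition unary (k : nat) : seq bool := nseq k true.

Definition computable (f : nat -> nat) : Prop :=
  exists A : prog, forall n : nat, exists T : nat, forall r : T.-tuple bool,
    halted (run A (unary n) r) /\ output (run A (unary n) r) = unary (f n).

Definition little_o_id (R : realType) (g : nat -> R) : Prop :=
  ((fun n : nat => g n / n%:R) @ \oo --> (0 : R))%classic.

(* Self-delimiting encoding of lists of words. *)
Definition encode (ws : seq (seq bool)) : seq bool :=
  flatten [seq rcons (flatten [seq [:: true; b] | b <- w]) false | w <- ws].

(* A sign bit followed by the binary digits, least significant first. *)
Definition int_of_bits (w : seq bool) : int :=
  (-1) ^+ head false w *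
  (foldr (fun (b : bool) k => (b + k.*2)%N) 0%N (behead w))%:Z.

Definition gaussian (R : realType) (re im : seq bool) : R[i] :=
  (int_of_bits re)%:~R +i* (int_of_bits im)%:~R.

(* The colour classes are {i} * 'I_p for i : 'I_n. *)
Definition vertex (n p : nat) := ('I_n * 'I_p)%type.

Definition encode_graph (n p : nat) (e : rel (vertex n p)) : seq bool :=
  encode [:: unary n; unary p;
    [seq e u v | u <- enum {: vertex n p}, v <- enum {: vertex n p}]].

Definition multicolored_cliques (n p : nat) (e : rel (vertex n p)) :
    {set {ffun 'I_n -> 'I_p}} :=
  [set s : {ffun 'I_n -> 'I_p} |
    [forall i, forall j, (i != j) ==> e (i, s i) (j, s j)]].

Definition distinguishes_cliques (R : realType) (A : prog) : Prop :=
  exists (f : nat -> nat) (g : nat -> R) (delta : R),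
    [/\ computable f, little_o_id g, 0 < delta &
      forall (n p : nat) (e : rel (vertex n p)),
        (0 < n)%N -> (0 < p)%N -> symmetric e -> irreflexive e ->
        exists T : nat,
          [/\ T%:R <= (f n)%:R * p%:R `^ g n,
              halts_within A (encode_graph e) T,
              #|multicolored_cliques e| = 0%N ->
                2^-1 + delta <=
                  prob R A (encode_graph e) T (fun out => out = [:: false]) &
              #|multicolored_cliques e| = 1%N ->
                2^-1 + delta <=
                  prob R A (encode_graph e) T (fun out => out = [:: true])]].

Definition multicolored_clique_assumption (R : realType) : Prop :=
  forall A : prog, ~ distinguishes_cliques R A.

(* Fock space on m modes in its occupation basis: psi I is the amplitude
   <I|psi>, where |I> = c_{i_1}^dagger ... c_{i_n}^dagger |0> for
   I = {i_1 < ... < i_n}. *)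
Definition fock (R : realType) (m : nat) := {ffun {set 'I_m} -> R[i]}.

Definition vacuum (R : realType) (m : nat) : fock R m :=
  [ffun I : {set 'I_m} => (I == finset.set0)%:R].

Definition cdag (R : realType) (m : nat) (j : 'I_m) (psi : fock R m) :
    fock R m :=
  [ffun I : {set 'I_m} =>
    if j \in I then (-1) ^+ #|[set i in I | (i < j)%N]| * psi (I :\ j) else 0].

Definition create (R : realType) (m : nat) (v : 'rV[R[i]]_m) (psi : fock R m) :
    fock R m :=
  [ffun I => \sum_j v 0 j * cdag j psi I].

(* The rows phi_1, ..., phi_n of M give phi_1 /\ ... /\ phi_n. *)
Definition wedge (R : realType) (n m : nat) (M : 'M[R[i]]_(n, m)) : fock R m :=
  foldr (fun i => create (row i M)) (vacuum R m) (enum 'I_n).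

(* The rows of a (rectangular) unitarymx are orthonormal. *)
Definition slater (R : realType) (n m : nat) : set (fock R m) :=
  [set S | exists2 M : 'M[R[i]]_(n, m), M \is unitarymx & S = wedge M]%classic.

Definition inner (R : realType) (m : nat) (psi phi : fock R m) : R[i] :=
  \sum_I (psi I)^* * phi I.

Definition sqmod (R : realType) (z : R[i]) : R := complex.Re `|z| ^+ 2.

Definition sqnorm (R : realType) (m : nat) (phi : fock R m) : R :=
  \sum_I sqmod (phi I).

Definition overlap (R : realType) (m : nat) (psi phi : fock R m) : R :=
  sqmod (inner psi phi) / sqnorm phi.

(* The supremum is attained, the set of Slater determinants being compact. *)
Definition OPT (R : realType) (n m : nat) (phi : fock R m) : R :=
  sup [set overlap S phi | S in @slater R n m]%classic.

(* Boolean circuits over the NAND basis. With m inputs, wires 0, ..., m - 1 are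
   the inputs and wire m + k is the output of the k-th gate. *)
Record circuit : Type := Circuit {
  gates : seq (nat * nat);
  re_wires : seq nat;
  im_wires : seq nat }.

Definition circuit_wf (m : nat) (K : circuit) : bool :=
  [&& all (fun k => let: (a, b) := nth (0%N, 0%N) (gates K) k in
                    (a < m + k)%N && (b < m + k)%N) (iota 0 (size (gates K))),
      all (fun a => a < m + size (gates K))%N (re_wires K) &
      all (fun a => a < m + size (gates K))%N (im_wires K)].

Definition circuit_size (K : circuit) : nat :=
  (size (gates K) + size (re_wires K) + size (im_wires K))%N.

Definition wire_values (K : circuit) (x : seq bool) : seq bool :=
  foldl (fun vs g => rcons vs (~~ (nth false vs g.1 && nth false vs g.2)))
    x (gates K).

Definition circuit_amplitude (R : realType) (K : circuit) (x : seq bool) :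
    R[i] :=
  let vs := wire_values K x in
  gaussian R [seq nth false vs a | a <- re_wires K]
             [seq nth false vs a | a <- im_wires K].

(* The n-fermion vector whose unnormalized amplitude <I|Phi> is the value of the
   circuit on the indicator string of I. *)
Definition described_vector (R : realType) (n m : nat) (K : circuit) :
    fock R m :=
  [ffun I : {set 'I_m} =>
    if #|I| == n then circuit_amplitude R K [seq i \in I | i <- enum 'I_m]
    else 0].

Definition encode_instance (n m : nat) (K : circuit) : seq bool :=
  encode ([:: unary n; unary m; unary (size (gates K))]
    ++ flatten [seq [:: unary g.1; unary g.2] | g <- gates K]
    ++ unary (size (re_wires K)) :: [seq unary a | a <- re_wires K]
    ++ unary (size (im_wires K)) :: [seq unary a | a <- im_wires K]).

(* A Slater determinant is output (up to its phase) as an n x m matrix of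
   Gaussian integers whose rows span the same space as its orbitals; the rows
   themselves need not be orthonormal. Clearing denominators, this covers all
   matrices with Gaussian rational entries. *)
Definition outputs_slater (R : realType) (n m : nat) (out : seq bool)
    (S : fock R m) : Prop :=
  exists (re im : 'I_n -> 'I_m -> seq bool) (M : 'M[R[i]]_(n, m)),
    [/\ out = encode (flatten
          [seq [:: re i j; im i j] | i <- enum 'I_n, j <- enum 'I_m]),
        M \is unitarymx,
        (M :=: \matrix_(i, j) gaussian R (re i j) (im i j))%MS &
        S = wedge M].

(* For every polynomial bound m ^ d + d on the circuit size, the running time is
   f(n) m ^ o(n); f and the o(n) may depend on d, since reading the description
   already takes time polynomial in its size. *)
Definition solves_slater_task (R : realType) (lambda eps : R) (A : prog) :
    Prop :=
  forall d : nat, exists (f : nat -> nat) (g : nat -> R),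
    [/\ computable f, little_o_id g &
      forall (n m : nat) (K : circuit),
        (0 < n <= m)%N -> circuit_wf m K -> (circuit_size K <= m ^ d + d)%N ->
        let Phi := described_vector R n m K in
        Phi <> 0 ->
        exists T : nat,
          [/\ T%:R <= (f n)%:R * m%:R `^ g n,
              halts_within A (encode_instance n m K) T &
              lambda <= OPT n Phi ->
              99 / 100 <= prob R A (encode_instance n m K) T (fun out =>
                exists S : fock R m,
                  outputs_slater n out S /\ OPT n Phi - eps <= overlap S Phi)]].

(* Main.v *)
Require Import Defs.
From mathcomp Require Import all_boot all_order all_algebra.
From mathcomp Require Import all_classical all_reals all_analysis.
From mathcomp Require Import complex.
From mathcomp Require Import zify ring lra.

Set Implicit Arguments.
Unset Strict Implicit.
Unset Printing Implicit Defensive.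

(* Given a multicoloured graph with n classes of size p, take n + n p modes, the
   last n p of which are the vertices, and the vector
     |Phi> = |E> + k sum_C |C>,
   where E is the set of the first n modes, C runs over the n-multicoloured
   cliques and k = 2 ^ t.+1 - 1 is large; the amplitudes of Phi are computed by a
   circuit of polynomial size. Without a clique OPT = 1, and with exactly one
   OPT >= k^2 / (k^2 + 1) >= lambda. A determinant S that is 1/8-optimal is close
   to |E> in the first case and to |C> in the second. Mode 0 belongs to E and not
   to C, so the cases are told apart by the weight of S on the sets that avoid
   mode 0. This weight is |c_0^dagger S|^2, which by the anticommutation relations
   is the squared distance of e_0 to the span of the orbitals of S; it is at most
   1/8 in the first case and greater than 1/2 in the second. The distance comes out
   of a Gram-Schmidt process without divisions over the Gaussian integers: n rounds,
   each of which multiplies the number of digits by a constant, hence time f(n)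
   times a polynomial.

   To get an actual program, a calculus of functions on binary trees is compiled
   to stack programs: a tree is kept as its prefix code on stack 0, and functions
   are closed under pairing, conditionals and folds with bounded accumulators. The
   given algorithm runs between two such programs. *)

(** * Stack programs on binary trees *)

(** The term |E> keeps Phi nonzero and OPT large when there is no clique, so that the promise holds
    in both cases. The test cannot compare S with |C>, because C is unknown; the occupation of mode
    0 separates E from every clique set without naming one. The loss 1/8 is the same for all lambda:
    lambda enters only through [t], hence through the size of the circuit, and [t] is fixed before n
    and p.

    The reduction may spend any computable function of n times a constant power of p, and it may
    raise the running time of the given algorithm to a constant power k, since k (1 + |g n|) is
    still o(n); the absolute value is there because g may be negative. This slack is what permits
    elimination without divisions, whose entries may get about 10 ^ n times as many digits. The
    price is on the formal side: the new time bound must again be computable, so a program for it is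
    built from the given program for f, by the same driver that embeds the given algorithm. *)

Definition exec (c : prog) (s : store) (t : nat) (s' : store) : Prop :=
  forall (k : seq prog) (r : seq bool),
    size r = t -> foldl step (s, c :: k) r = (s', k).

(** The step count is chosen before the continuation and the coins: such a program is deterministic
    and can be spliced into any run. *)
Definition exec_le (c : prog) (s : store) (t : nat) (s' : store) : Prop :=
  exists2 t', t' <= t & exec c s t' s'.

Lemma exec_weak c s t1 t2 s' : t1 <= t2 -> exec_le c s t1 s' -> exec_le c s t2 s'.
Proof. by move=> le12 [t' le' ?]; exists t' => //; exact: leq_trans le12. Qed.

Lemma exec_step c s s' : (forall k b, step (s, c :: k) b = (s', k)) ->
  exec_le c s 1 s'.
Proof. by move=> h; exists 1 => // k [|b []] // _; exact: h. Qed.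

Lemma exec_skip s : exec_le Skip s 1 s.
Proof. exact: exec_step. Qed.

Lemma exec_push b x s : exec_le (Push b x) s 1 (upd s x (b :: s x)).
Proof. exact: exec_step. Qed.

Lemma exec_pop x s : exec_le (Pop x) s 1 (upd s x (behead (s x))).
Proof. exact: exec_step. Qed.

Lemma exec_prefix c c1 s0 s1 t1 s2 :
  (forall k b, step (s0, c :: k) b = (s1, c1 :: k)) -> exec_le c1 s1 t1 s2 ->
  exec_le c s0 t1.+1 s2.
Proof.
move=> h [t' le' e]; exists t'.+1 => // k [|b r] // [sz].
by rewrite -[LHS]/(foldl step (step (s0, c :: k) b) r) h e.
Qed.

Lemma exec_seq c1 c2 s t1 s1 t2 s2 :
  exec_le c1 s t1 s1 -> exec_le c2 s1 t2 s2 ->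
  exec_le (Seq c1 c2) s (t1 + t2).+1 s2.
Proof.
move=> [t1' le1 e1] [t2' le2 e2]; exists (t1' + t2').+1; first by rewrite ltnS leq_add.
move=> k [|b r] //= [sz].
rewrite -[r](cat_take_drop t1') foldl_cat e1 ?e2 //.
  by rewrite size_drop sz addKn.
by rewrite size_take sz; case: ltnP => //; lia.
Qed.

Lemma exec_case x c0 cF cT s t s' :
  exec_le (if s x is b :: _ then (if b then cT else cF) else c0) s t s' ->
  exec_le (Case x c0 cF cT) s t.+1 s'.
Proof. exact: exec_prefix. Qed.

Lemma exec_while_stop x c s : s x = [::] -> exec_le (While x c) s 1 s.
Proof. by move=> h; apply: exec_step => k b /=; rewrite h. Qed.

Lemma exec_while_go x c s t1 s1 t2 s2 : s x != [::] ->
  exec_le c s t1 s1 -> exec_le (While x c) s1 t2 s2 ->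
  exec_le (While x c) s (t1 + t2).+1 s2.
Proof.
move=> nx [t1' le1 e1] [t2' le2 e2]; exists (t1' + t2').+1; first by rewrite ltnS leq_add.
move=> k [|b r] //= [sz]; case: (s x) nx => // _ _ _.
rewrite -[r](cat_take_drop t1') foldl_cat e1 ?e2 //.
  by rewrite size_drop sz addKn.
by rewrite size_take sz; case: ltnP => //; lia.
Qed.

(** Normal form in which the four working stacks are explicit, so that updates are computed by
    rewriting; all other stacks form an opaque frame. *)
Definition st (w0 w1 w2 w3 : seq bool) (s : store) : store := fun y =>
  match y with 0 => w0 | 1 => w1 | 2 => w2 | 3 => w3 | _ => s y end.

Lemma upd_st0 w0 w1 w2 w3 s w : upd (st w0 w1 w2 w3 s) 0 w = st w w1 w2 w3 s.
Proof. by apply/funext => -[|[|[|[|y]]]]. Qed.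
Lemma upd_st1 w0 w1 w2 w3 s w : upd (st w0 w1 w2 w3 s) 1 w = st w0 w w2 w3 s.
Proof. by apply/funext => -[|[|[|[|y]]]]. Qed.
Lemma upd_st2 w0 w1 w2 w3 s w : upd (st w0 w1 w2 w3 s) 2 w = st w0 w1 w w3 s.
Proof. by apply/funext => -[|[|[|[|y]]]]. Qed.
Lemma upd_st3 w0 w1 w2 w3 s w : upd (st w0 w1 w2 w3 s) 3 w = st w0 w1 w2 w s.
Proof. by apply/funext => -[|[|[|[|y]]]]. Qed.
Definition upd_st := (upd_st0, upd_st1, upd_st2, upd_st3).

Ltac exec1 :=
  lazymatch goal with
  | |- exec_le Skip _ _ _ => eapply exec_skip
  | |- exec_le (Push _ _) _ _ _ => eapply exec_push
  | |- exec_le (Pop _) _ _ _ => eapply exec_pop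
  | |- exec_le (Seq _ _) _ _ _ => eapply exec_seq; [exec1 | rewrite ?upd_st /=; exec1]
  | |- exec_le (Case _ _ _ _) _ _ _ => eapply exec_case; rewrite /=; exec1
  | _ => idtac
  end.

Lemma exec_eq c s t s1 s2 : s1 = s2 -> exec_le c s t s1 -> exec_le c s t s2.
Proof. by move->. Qed.

Definition mv (x y : nat) : prog :=
  While x (Case x Skip (Seq (Pop x) (Push false y)) (Seq (Pop x) (Push true y))).

Lemma exec_mv x y s w : x != y -> s x = w ->
  exec_le (mv x y) s (5 * size w + 1) (upd (upd s y (rev w ++ s y)) x [::]).
Proof.
move=> nxy; elim: w s => [|b w IH] s sx.
  apply: exec_eq (exec_while_stop _ sx); apply/funext => z; rewrite /upd.
  by case: (eqVneq z x) => [->|_] //; case: (eqVneq z y) => [->|].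
have := IH (upd (upd s x w) y (b :: s y)).
have -> : upd (upd s x w) y (b :: s y) x = w.
  by rewrite /upd (negPf nxy) eqxx.
move=> /(_ erefl) IHs.
apply: (@exec_weak _ _ (4 + (5 * size w + 1)).+1); first by rewrite /=; lia.
apply: (@exec_eq _ _ _ _ _ _ (exec_while_go _ _ IHs)); first 1 last.
- by rewrite sx.
- apply: (@exec_weak _ _ 4) => //; apply: exec_case; rewrite sx.
  have h : forall c, exec_le (Seq (Pop x) (Push c y)) s 3
      (upd (upd s x w) y (c :: s y)).
    move=> c; apply: (@exec_weak _ _ (1 + 1).+1) => //.
    apply: exec_seq; first exact: exec_pop.
    rewrite sx /=; apply: exec_eq (exec_push _ _ _).
    by rewrite {3}/upd eq_sym (negPf nxy).
  by case: b sx {IHs} => sx; exact: h.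
- apply/funext => z; rewrite /upd.
  case: (eqVneq z x) => // zx; case: (eqVneq z y) => // zy.
  by rewrite !eqxx rev_cons cat_rcons.
Qed.

Ltac exec_block :=
  eapply exec_weak; [| eapply exec_eq; [| exec1]]; rewrite ?upd_st //=.

(** * Prefix codes of trees on a stack *)

Inductive tree := Leaf | Node of tree & tree.

Fixpoint code (x : tree) : seq bool :=
  if x is Node a b then true :: code a ++ code b else [:: false].

(* Moves one prefix code from stack 0 to stack 1; stack 2 counts the subtrees
   that remain to be read. *)
Definition take_loop : prog :=
  While 2 (Case 0 Skip
    (Seq (Pop 0) (Seq (Push false 1) (Pop 2)))
    (Seq (Pop 0) (Seq (Push true 1) (Push true 2)))).

(** The rest of the loop is a premise, in continuation style: after one subtree the loop is still
    running, so the two halves of a node are chained by feeding one induction hypothesis to the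
    other. *)
Lemma exec_take_loop x v w1 w2 w3 s t s' :
  exec_le take_loop (st v (rev (code x) ++ w1) w2 w3 s) t s' ->
  exec_le take_loop (st (code x ++ v) w1 (true :: w2) w3 s)
    (7 * size (code x) + t) s'.
Proof.
elim: x v w1 w2 t s' => [|a IHa b IHb] v w1 w2 t s' h.
  apply: (@exec_weak _ _ (6 + t).+1); first by rewrite /=; lia.
  apply: (@exec_while_go _ _ _ 6 _ _ _ _ _ h); first by [].
  by exec_block.
apply: (@exec_weak _ _ (6 + (7 * size (code a) + (7 * size (code b) + t))).+1).
  by rewrite /= size_cat; lia.
apply: (@exec_while_go _ _ _ 6 (st (code a ++ code b ++ v) (true :: w1) (true :: true :: w2) w3 s)) => //.
  by exec_block; rewrite ?catA.
apply: IHa; apply: IHb; rewrite catA -rev_cat -cat_rcons -rev_cons; exact: h.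
Qed.

Lemma exec_take x v w1 w3 s :
  exec_le (Seq (Push true 2) take_loop) (st (code x ++ v) w1 [::] w3 s)
    (7 * size (code x) + 3) (st v (rev (code x) ++ w1) [::] w3 s).
Proof.
apply: (@exec_weak _ _ (1 + (7 * size (code x) + 1)).+1); first by lia.
apply: exec_seq; first exact: exec_push.
rewrite upd_st /=; apply: exec_take_loop; exact: exec_while_stop.
Qed.

Definition taket := Seq (Push true 2) take_loop.

Lemma exec_clear x s w : s x = w ->
  exec_le (While x (Pop x)) s (2 * size w + 1) (upd s x [::]).
Proof.
elim: w s => [|b w IH] s sx.
  apply: exec_eq (exec_while_stop _ sx); apply/funext => z; rewrite /upd.
  by case: eqP => [->|].
apply: (@exec_weak _ _ (1 + (2 * size w + 1)).+1); first by rewrite /=; lia.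
apply: exec_while_go; [by rewrite sx|exact: exec_pop|rewrite sx /=].
have := IH (upd s x w); rewrite {1}/upd eqxx => /(_ erefl); apply: exec_eq.
by apply/funext => z; rewrite /upd; case: eqP.
Qed.

Definition dropt := Seq taket (While 1 (Pop 1)).

Lemma exec_drop x v s :
  exec_le dropt (st (code x ++ v) [::] [::] [::] s) (9 * size (code x) + 5)
    (st v [::] [::] [::] s).
Proof.
apply: (@exec_weak _ _ (7 * size (code x) + 3 + (2 * size (rev (code x) ++ [::]) + 1)).+1).
  by rewrite cats0 size_rev; lia.
apply: exec_seq; first exact: exec_take.
by apply: exec_eq (exec_clear _); last by []; rewrite upd_st.
Qed.

Definition copy_loop : prog :=
  While 1 (Case 1 Skip
    (Seq (Push false 0) (Seq (Push false 3) (Pop 1)))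
    (Seq (Push true 0) (Seq (Push true 3) (Pop 1)))).

Lemma exec_copy_loop w v w3 s :
  exec_le copy_loop (st v w [::] w3 s) (7 * size w + 1)
    (st (rev w ++ v) [::] [::] (rev w ++ w3) s).
Proof.
elim: w v w3 => [|b w IH] v w3; first exact: exec_while_stop.
apply: (@exec_weak _ _ (6 + (7 * size w + 1)).+1); first by rewrite /=; lia.
rewrite !rev_cons !cat_rcons; apply: exec_while_go (IH _ _) => //.
by case: b; exec_block.
Qed.

Lemma exec_mv31 v w s :
  exec_le (mv 3 1) (st v [::] [::] w s) (5 * size w + 1) (st v (rev w) [::] [::] s).
Proof. by apply: exec_eq (exec_mv _ _); last by []; rewrite //= !upd_st /= cats0. Qed.

Lemma exec_mv10 v w w2 w3 s :
  exec_le (mv 1 0) (st v w w2 w3 s) (5 * size w + 1) (st (rev w ++ v) [::] w2 w3 s).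
Proof. by apply: exec_eq (exec_mv _ _); last by []; rewrite //= !upd_st. Qed.

Lemma exec_mv01 v w s :
  exec_le (mv 0 1) (st v w [::] [::] s) (5 * size v + 1) (st [::] (rev v ++ w) [::] [::] s).
Proof. by apply: exec_eq (exec_mv _ _); last by []; rewrite //= !upd_st. Qed.

Lemma exec_mv13 v w s :
  exec_le (mv 1 3) (st v w [::] [::] s) (5 * size w + 1) (st v [::] [::] (rev w) s).
Proof. by apply: exec_eq (exec_mv _ _); last by []; rewrite //= !upd_st /= cats0. Qed.

Lemma exec_mv32 v w1 w s :
  exec_le (mv 3 2) (st v w1 [::] w s) (5 * size w + 1) (st v w1 (rev w) [::] s).
Proof. by apply: exec_eq (exec_mv _ _); last by []; rewrite //= !upd_st /= cats0. Qed.

Lemma exec_mv20 v w1 w s :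
  exec_le (mv 2 0) (st v w1 w [::] s) (5 * size w + 1) (st (rev w ++ v) w1 [::] [::] s).
Proof. by apply: exec_eq (exec_mv _ _); last by []; rewrite //= !upd_st. Qed.

(** Every transfer between stacks reverses the word, so both copies make an even number of
    transfers: 0, 1, 0 and 0, 1, 3, 1, 0. *)
Definition dupt := Seq taket (Seq copy_loop (Seq (mv 3 1) (mv 1 0))).

Lemma exec_dup x v s :
  exec_le dupt (st (code x ++ v) [::] [::] [::] s) (24 * size (code x) + 9)
    (st (code x ++ code x ++ v) [::] [::] [::] s).
Proof.
eapply exec_weak; first last.
  eapply exec_seq; first exact: exec_take.
  eapply exec_seq; first exact: exec_copy_loop.
  rewrite cats0 revK; eapply exec_seq; first by rewrite cats0; exact: exec_mv31.
  by apply: exec_eq (exec_mv10 _ _ _ _ _); rewrite revK.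
by rewrite !cats0 !size_rev; lia.
Qed.

(** The first tree waits on stack 3 while the second is read, because [taket] counts on stack 2; it
    returns through stack 2 to get the right orientation. *)
Definition swapt := Seq taket (Seq (mv 1 3) (Seq taket
  (Seq (mv 3 2) (Seq (mv 2 0) (mv 1 0))))).

Lemma exec_swap x y v s :
  exec_le swapt (st (code x ++ code y ++ v) [::] [::] [::] s)
    (22 * size (code x) + 12 * size (code y) + 15)
    (st (code y ++ code x ++ v) [::] [::] [::] s).
Proof.
eapply exec_weak; first last.
  eapply exec_seq; first exact: exec_take.
  rewrite cats0; eapply exec_seq; first exact: exec_mv13.
  rewrite revK; eapply exec_seq; first exact: exec_take.
  rewrite cats0; eapply exec_seq; first exact: exec_mv32.
  eapply exec_seq; first exact: exec_mv20.
  rewrite revK; apply: exec_eq (exec_mv10 _ _ _ _ _).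
  by rewrite revK.
by rewrite !size_rev; lia.
Qed.

(** The quantification over [v] and [s] is a frame property: whatever lies below the argument on
    stack 0 survives, which is where [pair_prog] and [if_prog] keep their second copy. *)
Definition computes (c : prog) (x y : tree) (t : nat) : Prop :=
  forall v s, exec_le c (st (code x ++ v) [::] [::] [::] s) t
    (st (code y ++ v) [::] [::] [::] s).

Lemma computes_weak c x y t1 t2 : t1 <= t2 -> computes c x y t1 -> computes c x y t2.
Proof. by move=> le12 h v s; exact: exec_weak le12 _. Qed.

Lemma computes_skip x : computes Skip x x 1.
Proof. by move=> v s; exact: exec_skip. Qed.

Lemma computes_seq c1 c2 x y z t1 t2 :
  computes c1 x y t1 -> computes c2 y z t2 -> computes (Seq c1 c2) x z (t1 + t2).+1.
Proof. by move=> h1 h2 v s; exact: exec_seq (h1 _ _) (h2 _ _). Qed.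

Fixpoint push_word (w : seq bool) : prog :=
  if w is b :: w' then Seq (push_word w') (Push b 0) else Skip.

Lemma exec_push_word w v s :
  exec_le (push_word w) (st v [::] [::] [::] s) (2 * size w + 1)
    (st (w ++ v) [::] [::] [::] s).
Proof.
elim: w => [|b w IH] /=; first exact: exec_skip.
apply: (@exec_weak _ _ (2 * size w + 1 + 1).+1); first by lia.
by apply: exec_seq; [exact: IH|apply: exec_eq (exec_push _ _ _); rewrite upd_st].
Qed.

Lemma computes_const x y :
  computes (Seq dropt (push_word (code y))) x y
    (9 * size (code x) + 2 * size (code y) + 7).
Proof.
move=> v s; eapply exec_weak; first last.
  by apply: exec_seq; [exact: exec_drop|exact: exec_push_word].
by lia.
Qed.

Definition thd (x : tree) := if x is Node a _ then a else Leaf.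
Definition ttl (x : tree) := if x is Node _ b then b else Leaf.
Definition tnode (x : tree) : bool := if x is Node _ _ then true else false.

Definition thd_prog := Case 0 Skip Skip (Seq (Pop 0) (Seq swapt dropt)).
Definition ttl_prog := Case 0 Skip Skip (Seq (Pop 0) dropt).

Lemma computes_thd x : computes thd_prog x (thd x) (22 * size (code x) + 25).
Proof.
case: x => [|a b] v s; (eapply exec_weak; first last).
- by apply: exec_case => /=; exact: exec_skip.
- by [].
- apply: exec_case => /=; apply: exec_seq; first exact: exec_pop.
  rewrite upd_st /= -catA; apply: exec_seq; first exact: exec_swap.
  exact: exec_drop.
- by rewrite /= size_cat; lia.
Qed.

Lemma computes_ttl x : computes ttl_prog x (ttl x) (9 * size (code x) + 10).
Proof.
case: x => [|a b] v s; (eapply exec_weak; first last).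
- by apply: exec_case => /=; exact: exec_skip.
- by [].
- apply: exec_case => /=; apply: exec_seq; first exact: exec_pop.
  rewrite upd_st /= -catA; exact: exec_drop.
- by rewrite /= size_cat; lia.
Qed.

Definition pair_prog cF cG := Seq dupt (Seq cF (Seq swapt (Seq cG (Seq swapt (Push true 0))))).

Lemma computes_pair cF cG x y z tF tG :
  computes cF x y tF -> computes cG x z tG ->
  computes (pair_prog cF cG) x (Node y z)
    (tF + tG + 36 * size (code x) + 34 * size (code y) + 22 * size (code z) + 50).
Proof.
move=> hF hG v s; eapply exec_weak; first last.
  eapply exec_seq; first exact: exec_dup.
  eapply exec_seq; first exact: hF.
  eapply exec_seq; first exact: exec_swap.
  eapply exec_seq; first exact: hG.
  eapply exec_seq; first exact: exec_swap.
  by apply: exec_eq (exec_push _ _ _); rewrite upd_st /= -!catA.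
by lia.
Qed.

(** The tested value has to be removed before branching: a leaf is a single bit, so [Pop] suffices
    for it, while a node takes [dropt]. *)
Definition if_prog cC cF cG :=
  Seq dupt (Seq cC (Case 0 Skip (Seq (Pop 0) cG) (Seq dropt cF))).

Lemma computes_if cC cF cG x b y z tC tF tG :
  computes cC x b tC ->
  (tnode b -> computes cF x y tF) -> (~~ tnode b -> computes cG x z tG) ->
  computes (if_prog cC cF cG) x (if tnode b then y else z)
    (tC + tF + tG + 24 * size (code x) + 9 * size (code b) + 25).
Proof.
move=> hC hF hG v s; eapply exec_weak; first last.
  eapply exec_seq; first exact: exec_dup.
  eapply exec_seq; first exact: hC.
  apply: (@exec_weak _ _ (9 * size (code b) + 7 + tF + tG).+1); first exact: leqnn.
  case: b hF hG {hC} => [|b1 b2] /= hF hG; apply: exec_case => /=.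
    apply: (@exec_weak _ _ (1 + tG).+1); first by lia.
    apply: exec_seq; first exact: exec_pop.
    by rewrite upd_st /=; exact: hG.
  eapply exec_weak; first last.
    eapply exec_seq; first exact: (exec_drop (Node b1 b2)).
    exact: hF.
  by rewrite /= size_cat; lia.
by lia.
Qed.

(* The test leaves a mark on stack 1 exactly if the head of the tree on stack 0
   is a node. The mark is removed before the body runs, so loops can be nested. *)
Definition loop_test := Seq (Pop 0) (Seq (Case 0 Skip Skip (Push true 1)) (Push true 0)).
Definition loop_prog c := Seq loop_test (While 1 (Seq (Pop 1) (Seq c loop_test))).

Lemma exec_loop_test x v s : tnode x ->
  exec_le loop_test (st (code x ++ v) [::] [::] [::] s) 6
    (st (code x ++ v) (if tnode (thd x) then [:: true] else [::]) [::] [::] s).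
Proof. by case: x => [|[|a b] d] //= _; rewrite /loop_test; exec_block. Qed.

(** [F i] is the state after i rounds. Its head plays the role of the list of items still to be
    processed, which becomes empty exactly at round n. *)
Lemma computes_loop c (F : nat -> tree) n t :
  (forall i, i < n -> computes c (F i) (F i.+1) t) ->
  (forall i, i <= n -> tnode (F i)) ->
  (forall i, i <= n -> tnode (thd (F i)) = (i < n)) ->
  computes (loop_prog c) (F 0) (F n) (n * (t + 10) + 8).
Proof.
move=> hc hF hh v s.
apply: (@exec_weak _ _ (6 + (n * (t + 10) + 1)).+1); first by lia.
apply: exec_seq; first by apply: exec_loop_test; exact: hF.
rewrite hh //.
suff gen j i : i + j = n ->
    exec_le (While 1 (Seq (Pop 1) (Seq c loop_test)))
      (st (code (F i) ++ v) (if i < n then [:: true] else [::]) [::] [::] s)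
      (j * (t + 10) + 1) (st (code (F n) ++ v) [::] [::] [::] s).
  exact: gen.
elim: j i => [|j IH] i eij.
  have -> : i = n by lia.
  by rewrite ltnn; apply: exec_while_stop.
have ltin : i < n by lia.
rewrite ltin; apply: (@exec_weak _ _ ((1 + (t + 6).+1).+1 + (j * (t + 10) + 1)).+1).
  by lia.
apply: (@exec_while_go _ _ _ _ (st (code (F i.+1) ++ v) (if i.+1 < n then [:: true] else [::]) [::] [::] s)) => //.
  apply: exec_seq; first exact: exec_pop.
  rewrite upd_st /=; apply: exec_seq; first exact: hc.
  by rewrite -hh //; apply: exec_loop_test; exact: hF.
by apply: IH => //; lia.
Qed.

(** One step lengthens a stack by at most one bit. Hence a time bound is also a bound on the output
    size, and sizes of computed values need no separate estimates. *)
Lemma exec_size c s t s' : exec_le c s t s' -> size (s' 0) <= size (s 0) + t.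
Proof.
move=> [t' le' /(_ [::] (nseq t' false) (size_nseq _ _)) e].
apply: leq_trans (_ : size (s 0) + t' <= _); last by rewrite leq_add2l.
rewrite -[s']/((s', [::] : seq prog).1) -e; move: [:: c] => k.
rewrite -{2}(size_nseq t' false); move: (nseq t' false) => r {e le'}.
elim: r s k => [|b r IH] s k; first by rewrite addn0.
rewrite -[foldl _ _ _]/(foldl step (step (s, k) b) r).
have h : size ((step (s, k) b).1 0) <= (size (s 0)).+1.
  case: k => [|[|b' x|x|x|c1 c2|x c1 c2 c3|x c1] k] //=; rewrite ?leqnSn /upd //.
  - by case: eqVneq => [->|].
  - by case: eqVneq => [<-|] //; rewrite size_behead; lia.
  - by case: eqVneq => [->|].
case: (step (s, k) b) h => s1 k1 /= h.
by apply: leq_trans (IH _ _) _ => /=; lia.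
Qed.

Lemma computes_size c x y t : computes c x y t -> size (code y) <= size (code x) + t.
Proof. by move=> h; have /exec_size := h [::] (fun=> [::]); rewrite /= !cats0. Qed.

(** * Functions of bounded complexity *)

Section PolynomialBounds.
Variables (A : Type) (B : A -> nat).
Hypothesis B_ge2 : forall a, 1 < B a.

(** Polynomial bounds in normal form: as the base is at least 2, constants and sums are absorbed by
    a larger exponent. *)
Definition pb (T : A -> nat) : Prop := exists k, forall a, T a <= B a ^ k.

Lemma pb_le T U : (forall a, T a <= U a) -> pb U -> pb T.
Proof. by move=> h [k hk]; exists k => a; exact: leq_trans (hk a). Qed.

Lemma pb_const c : pb (fun=> c).
Proof.
exists c => a; apply: leq_trans (ltnW (ltn_expl c (ltnSn 1))) _.
by case: c => // c; rewrite leq_exp2r // B_ge2.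
Qed.

Lemma pb_mul T U : pb T -> pb U -> pb (fun a => T a * U a).
Proof. by move=> [i hi] [j hj]; exists (i + j) => a; rewrite expnD leq_mul. Qed.

Lemma pb_add T U : pb T -> pb U -> pb (fun a => T a + U a).
Proof.
move=> [i hi] [j hj]; exists (i + j).+1 => a.
have pos k : 0 < B a ^ k by rewrite expn_gt0 ltnW // B_ge2.
apply: leq_trans (leq_add (hi a) (hj a)) _; rewrite expnS expnD.
apply: leq_trans (leq_mul (B_ge2 a) (leqnn _)).
by move: (pos i) (pos j); move: (B a ^ i) (B a ^ j) => x y; nia.
Qed.

Lemma pb_exp T k : pb T -> pb (fun a => T a ^ k).
Proof.
move=> [i hi]; exists (i * k) => a; rewrite expnM.
by case: k => // k; rewrite leq_exp2r.
Qed.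

End PolynomialBounds.

Structure encType := EncType { esort :> Type; enc : esort -> tree }.
Arguments enc {e} _ : rename.
Canonical tree_encType := EncType (fun x : tree => x).
Canonical bool_encType := EncType (fun b : bool => if b then Node Leaf Leaf else Leaf).
Canonical nat_encType := EncType (fun n : nat => iter n (Node Leaf) Leaf).
Canonical prod_encType (A B : encType) :=
  EncType (fun p : A * B => Node (enc p.1) (enc p.2)).
Canonical seq_encType (A : encType) :=
  EncType (foldr (fun (x : A) t => Node (enc x) t) Leaf).

Definition sz {A : encType} (a : A) : nat := size (code (enc a)).

Lemma sz_pair (A B : encType) (a : A) (b : B) :
  sz (a, b) = (sz a + sz b).+1.
Proof. by rewrite /sz /= size_cat. Qed.

Lemma sz_nil (A : encType) : sz ([::] : seq A) = 1.
Proof. by []. Qed.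

Lemma sz_cons (A : encType) (a : A) l : sz (a :: l) = (sz a + sz l).+1.
Proof. by rewrite /sz /= size_cat. Qed.

Lemma sz_nat (n : nat) : sz n = (2 * n).+1.
Proof. by rewrite /sz /=; elim: n => //= n ->; lia. Qed.

Lemma sz_bool_le (b : bool) : sz b <= 3.
Proof. by case: b. Qed.

Lemma sz_gt0 (A : encType) (a : A) : 0 < sz a.
Proof. by rewrite /sz; case: (enc a). Qed.

Lemma size_le_sz (A : encType) (l : seq A) : size l <= sz l.
Proof. by elim: l => // a l IH; rewrite sz_cons /=; lia. Qed.

Lemma sz_drop (A : encType) (l : seq A) i : sz (drop i l) <= sz l.
Proof.
elim: l i => // a l IH [|i] //=; rewrite sz_cons.
by apply: leq_trans (IH i) _; lia.
Qed.

Lemma sz_take (A : encType) (l : seq A) i : sz (take i l) <= sz l.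
Proof.
elim: l i => // a l IH [|i] //=; rewrite !sz_cons.
by apply: leq_trans (_ : (sz a + sz l).+1 <= _); rewrite // ltnS leq_add2l.
Qed.

Definition bd {A : encType} (beta : A -> nat) (a : A) : nat := beta a + sz a + 2.

Lemma bd_ge2 (A : encType) (beta : A -> nat) a : 1 < bd beta a.
Proof. by rewrite /bd; lia. Qed.
#[local] Hint Resolve bd_ge2 : core.

(* The parameter [beta] makes room for a cost that is exponential in n: the
   final test is [Cmp] for [beta = 10 ^ n]. *)
Definition Cmp {A B : encType} (beta : A -> nat) (f : A -> B) : Prop :=
  exists c T, pb (bd beta) T /\ forall a, computes c (enc a) (enc (f a)) (T a).

Notation FP := (Cmp (fun=> 0)).

Ltac pb := repeat first
  [ assumption | apply: pb_add => // | apply: pb_mul => // | apply: pb_exp => //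
  | apply: pb_const => //].

Section Closure.
Variables (A : encType) (beta : A -> nat).

Lemma pb_sz : pb (bd beta) (fun a => sz a).
Proof. by exists 1 => a; rewrite expn1 /bd; lia. Qed.

Lemma pb_beta : pb (bd beta) beta.
Proof. by exists 1 => a; rewrite expn1 /bd; lia. Qed.

Lemma Cmp_sz (B : encType) (f : A -> B) : Cmp beta f -> pb (bd beta) (fun a => sz (f a)).
Proof.
move=> [c [T [hT h]]]; apply: (pb_le (fun a => computes_size (h a))).
by apply: pb_add => //; exact: pb_sz.
Qed.

(** Programs see only the tree. Values of different types with the same encoding, such as a pair and
    a cons, are exchanged at no cost. *)
Lemma Cmp_enc (B B' : encType) (f : A -> B) (g : A -> B') :
  (forall a, enc (f a) = enc (g a)) -> Cmp beta f -> Cmp beta g.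
Proof. by move=> e [c [T [hT h]]]; exists c, T; split=> // a; rewrite -e. Qed.

Lemma Cmp_ext (B : encType) (f g : A -> B) : f =1 g -> Cmp beta f -> Cmp beta g.
Proof. by move=> e; apply: Cmp_enc => a; rewrite e. Qed.

Lemma Cmp_id : Cmp beta (fun a => a).
Proof.
by exists Skip, (fun=> 1); split=> [|a]; [exact: pb_const|exact: computes_skip].
Qed.

Lemma Cmp_const (B : encType) (b : B) : Cmp beta (fun=> b).
Proof.
exists (Seq dropt (push_word (code (enc b)))); eexists; split; last first.
  by move=> a; exact: computes_const.
by rewrite -/(sz b); pb; exact: pb_sz.
Qed.

Lemma Cmp_comp_gen (B C : encType) (f : A -> B) gamma (g : B -> C) :
  Cmp beta f -> pb (bd beta) (fun a => gamma (f a)) -> Cmp gamma g ->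
  Cmp beta (fun a => g (f a)).
Proof.
move=> hf hgamma [c' [T' [[k hT'] h']]].
have hs := Cmp_sz hf; case: hf => c [T [hT h]].
exists (Seq c c'), (fun a => T a + (gamma (f a) + sz (f a) + 2) ^ k + 1); split.
  by pb.
move=> a; apply: computes_weak (computes_seq (h a) (h' (f a))).
by have := hT' (f a); rewrite /bd; lia.
Qed.

Lemma Cmp_comp (B C : encType) (f : A -> B) (g : B -> C) :
  FP g -> Cmp beta f -> Cmp beta (fun a => g (f a)).
Proof. by move=> hg hf; apply: Cmp_comp_gen hg => //; exact: pb_const. Qed.

Lemma Cmp_pair (B C : encType) (f : A -> B) (g : A -> C) :
  Cmp beta f -> Cmp beta g -> Cmp beta (fun a => (f a, g a)).
Proof.
move=> hf hg; have sf := Cmp_sz hf; have sg := Cmp_sz hg.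
case: hf hg => c [T [hT h]] [c' [T' [hT' h']]].
exists (pair_prog c c'); eexists; split; last first.
  by move=> a; exact: (computes_pair (h a) (h' a)).
rewrite /sz in sf sg; pb; exact: pb_sz.
Qed.

Lemma Cmp_if (B : encType) (b : A -> bool) (f g : A -> B) :
  Cmp beta b -> Cmp beta f -> Cmp beta g ->
  Cmp beta (fun a => if b a then f a else g a).
Proof.
move=> hb hf hg; have sb := Cmp_sz hb.
case: hb hf hg => c0 [T0 [hT0 h0]] [c [T [hT h]]] [c' [T' [hT' h']]].
exists (if_prog c0 c c'); eexists; split; last first.
  move=> a; have -> : enc (if b a then f a else g a) =
      if tnode (enc (b a)) then enc (f a) else enc (g a) by case: (b a).
  exact: (computes_if (h0 a) (fun=> h a) (fun=> h' a)).
by rewrite /sz in sb; pb; exact: pb_sz.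
Qed.

End Closure.
Arguments Cmp_const {A} beta {B} b.
Arguments Cmp_id {A} beta.

Lemma FP_thd : FP thd.
Proof.
exists thd_prog; eexists; split; last exact: computes_thd.
by pb; exact: pb_sz.
Qed.

Lemma FP_ttl : FP ttl.
Proof.
exists ttl_prog; eexists; split; last exact: computes_ttl.
by pb; exact: pb_sz.
Qed.

Section Closure2.
Variables (A : encType) (beta : A -> nat).

Lemma Cmp_toenc (B : encType) (f : A -> B) : Cmp beta f -> Cmp beta (fun a => enc (f a)).
Proof. exact: Cmp_enc. Qed.

Lemma Cmp_thd (B : encType) (f : A -> B) : Cmp beta f ->
  Cmp beta (fun a => thd (enc (f a))).
Proof. by move/Cmp_toenc; apply: Cmp_comp FP_thd. Qed.

Lemma Cmp_ttl (B : encType) (f : A -> B) : Cmp beta f ->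
  Cmp beta (fun a => ttl (enc (f a))).
Proof. by move/Cmp_toenc; apply: Cmp_comp FP_ttl. Qed.

Lemma Cmp_fst (B C : encType) (f : A -> B * C) :
  Cmp beta f -> Cmp beta (fun a => (f a).1).
Proof. by move/Cmp_thd; exact: Cmp_enc. Qed.

Lemma Cmp_snd (B C : encType) (f : A -> B * C) :
  Cmp beta f -> Cmp beta (fun a => (f a).2).
Proof. by move/Cmp_ttl; exact: Cmp_enc. Qed.

Lemma Cmp_cons (B : encType) (f : A -> B) (g : A -> seq B) :
  Cmp beta f -> Cmp beta g -> Cmp beta (fun a => f a :: g a).
Proof. by move=> hf hg; apply: Cmp_enc (Cmp_pair hf hg). Qed.

Lemma Cmp_behead (B : encType) (f : A -> seq B) :
  Cmp beta f -> Cmp beta (fun a => behead (f a)).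
Proof. by move/Cmp_ttl; apply: Cmp_enc => a; case: (f a). Qed.

Definition full {B} (l : seq B) : bool := if l is [::] then false else true.

(* A boolean is encoded as a node exactly if it is true. *)
Lemma Cmp_full (B : encType) (f : A -> seq B) :
  Cmp beta f -> Cmp beta (fun a => full (f a)).
Proof.
move=> [c [T [hT h]]].
have hb := Cmp_const beta true; have hc := Cmp_const beta false.
have [c1 [T1 [hT1 h1]]] := hb; have [c2 [T2 [hT2 h2]]] := hc.
have sf := Cmp_sz (ex_intro _ c (ex_intro _ T (conj hT h)) : Cmp beta f).
exists (if_prog c c1 c2); eexists; split; last first.
  move=> a; have -> : enc (full (f a)) =
      if tnode (enc (f a)) then enc true else enc false by case: (f a).
  exact: (computes_if (h a) (fun=> h1 a) (fun=> h2 a)).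
by rewrite /sz in sf; pb; exact: pb_sz.
Qed.

Lemma Cmp_head (B : encType) (d : B) (f : A -> seq B) :
  Cmp beta f -> Cmp beta (fun a => head d (f a)).
Proof.
move=> hf; have := Cmp_if (Cmp_full hf) (Cmp_thd hf) (Cmp_const beta (enc d)).
by apply: Cmp_enc => a; case: (f a).
Qed.

Lemma Cmp_S (f : A -> nat) : Cmp beta f -> Cmp beta (fun a => (f a).+1).
Proof.
move=> hf; have h : Cmp beta (fun a => (Leaf, f a)).
  exact: (Cmp_pair (Cmp_const beta Leaf) hf).
exact: Cmp_enc h.
Qed.

Lemma Cmp_pred (f : A -> nat) : Cmp beta f -> Cmp beta (fun a => (f a).-1).
Proof. by move/Cmp_ttl; apply: Cmp_enc => a; case: (f a). Qed.

Definition units (n : nat) : seq tree := nseq n Leaf.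

Lemma Cmp_units (f : A -> nat) : Cmp beta f -> Cmp beta (fun a => units (f a)).
Proof. by apply: Cmp_enc => a; rewrite /units; elim: (f a) => //= n IH; congr Node. Qed.

Lemma Cmp_pos (f : A -> nat) : Cmp beta f -> Cmp beta (fun a => 0 < f a).
Proof.
by move/Cmp_units/Cmp_full; apply: Cmp_ext => a; case: (f a).
Qed.

Lemma Cmp_not (f : A -> bool) : Cmp beta f -> Cmp beta (fun a => ~~ f a).
Proof.
move=> hf; have h : Cmp beta (fun a => if f a then false else true).
  exact: (Cmp_if hf (Cmp_const beta false) (Cmp_const beta true)).
by apply: Cmp_ext h => a; case: (f a).
Qed.

Lemma Cmp_and (f g : A -> bool) : Cmp beta f -> Cmp beta g -> Cmp beta (fun a => f a && g a).
Proof. by move=> hf hg; exact: (Cmp_if hf hg (Cmp_const beta false)). Qed.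

Lemma Cmp_or (f g : A -> bool) : Cmp beta f -> Cmp beta g -> Cmp beta (fun a => f a || g a).
Proof. by move=> hf hg; exact: (Cmp_if hf (Cmp_const beta true) hg). Qed.

End Closure2.

Section Fold.
Variables A B C : encType.
Variable (step : A * B * C -> C).
Hypothesis hstep : FP step.

(** The remaining list stands at the head of the state, where [computes_loop] tests it. A nonempty
    list has the same tree as the pair of its head and tail, so the projections take it apart. *)
Let body (s : (B * seq B) * (A * C)) : seq B * (A * C) :=
  (s.1.2, (s.2.1, step (s.2.1, s.1.1, s.2.2))).

Let FP_body : FP body.
Proof.
rewrite /body.
have h1 : FP (fun s : (B * seq B) * (A * C) => s.1) by apply: Cmp_fst; exact: (Cmp_id _).
have h2 : FP (fun s : (B * seq B) * (A * C) => s.2) by apply: Cmp_snd; exact: (Cmp_id _).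
apply: Cmp_pair; first exact: Cmp_snd.
apply: Cmp_pair; first exact: Cmp_fst.
apply: (Cmp_comp hstep); apply: Cmp_pair; last exact: Cmp_snd.
by apply: Cmp_pair; exact: Cmp_fst.
Qed.

(** The bound [M] on all partial results is essential for iteration: a polynomial step could
    otherwise square the size of the accumulator in every round. *)
Lemma Cmp_foldl beta (M : A -> nat) (l : A -> seq B) (init : A -> C) :
  Cmp beta l -> Cmp beta init -> pb (bd beta) M ->
  (forall a i, i <= size (l a) ->
     sz (foldl (fun c b => step (a, b, c)) (init a) (take i (l a))) <= M a) ->
  Cmp beta (fun a => foldl (fun c b => step (a, b, c)) (init a) (l a)).
Proof.
move=> hl hinit hM bound.
pose acc a i := foldl (fun c b => step (a, b, c)) (init a) (take i (l a)).
pose S a i := (drop i (l a), (a, acc a i)).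
have hS0 : Cmp beta (fun a => S a 0).
  have h : Cmp beta (fun a => (l a, (a, init a))).
    by apply: Cmp_pair => //; apply: Cmp_pair => //; exact: (Cmp_id _).
  by apply: Cmp_ext h => a; rewrite /S /acc drop0 take0.
have sl := Cmp_sz hl.
case: FP_body => cb [Tb [[k hTb] hb]].
case: hS0 => c0 [T0 [hT0 h0]].
have hS : Cmp beta (fun a => S a (size (l a))); last first.
  have h := Cmp_snd (Cmp_snd hS); apply: Cmp_ext h => a.
  by rewrite /S /acc /= take_size.
pose t a := (sz (l a) + sz a + M a + 5) ^ k.
exists (Seq c0 (loop_prog cb)), (fun a => (T0 a + (sz (l a) * (t a + 10) + 8)).+1).
have pbsz := @pb_sz _ beta.
split; first by rewrite /t; under [X in pb _ X]eq_fun do rewrite -addn1; pb.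
move=> a; apply: computes_seq (h0 a) _.
apply: (@computes_weak _ _ _ (size (l a) * (t a + 10) + 8)).
  by rewrite leq_add2r leq_mul // size_le_sz.
apply: (@computes_loop cb (fun i => enc (S a i)) (size (l a)) (t a)).
- move=> i ilt.
  have [b [l' edrop]] : exists b l', drop i (l a) = b :: l'.
    by case e: (drop i (l a)) => [|b l']; [have := size_drop i (l a); rewrite e /=; lia|exists b, l'].
  have -> : enc (S a i) = enc ((b, l'), (a, acc a i)) by rewrite /S edrop.
  have -> : enc (S a i.+1) = enc (body ((b, l'), (a, acc a i))).
    rewrite /S /body /=; congr (enc (_, (_, _))).
      by rewrite -[i.+1]add1n -drop_drop edrop /= drop0.
    rewrite /acc (take_nth b) // -cats1 foldl_cat /=.
    by rewrite -[X in nth _ _ X]addn0 -nth_drop edrop.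
  apply: computes_weak (hb _); apply: leq_trans (hTb _) _.
  rewrite /t; case: k {hTb t} => // k; rewrite leq_exp2r // /bd add0n.
  have e : sz (b, l') = sz (drop i (l a)) by rewrite edrop.
  rewrite sz_pair (sz_pair a).
  by have := bound a i (ltnW ilt); have := sz_drop (l a) i; rewrite /acc; lia.
- by [].
- move=> i ile; rewrite /S /= ltnNge -subn_eq0 -size_drop.
  by case: (drop i (l a)).
Qed.

End Fold.

Lemma Cmp_comp2 (A B C D : encType) (beta : A -> nat) (h : B -> C -> D) f g :
  FP (fun p : B * C => h p.1 p.2) -> Cmp beta f -> Cmp beta g ->
  Cmp beta (fun a => h (f a) (g a)).
Proof. by move=> hh hf hg; exact: (Cmp_comp hh (Cmp_pair hf hg)). Qed.

Lemma Cmp_comp3 (A B C D E : encType) (beta : A -> nat) (h : B -> C -> D -> E) f g k :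
  FP (fun p : B * C * D => h p.1.1 p.1.2 p.2) ->
  Cmp beta f -> Cmp beta g -> Cmp beta k ->
  Cmp beta (fun a => h (f a) (g a) (k a)).
Proof.
by move=> hh hf hg hk; exact: (Cmp_comp hh (Cmp_pair (Cmp_pair hf hg) hk)).
Qed.

(* The rules are selected by the head symbol: unification would unfold the
   functions for which a rule exists. *)
Ltac fp_list := fail.
Ltac fp_user := fail.
Ltac fp_basic := lazymatch goal with
  | |- Cmp _ (fun a => (_, _)) => apply: Cmp_pair
  | |- Cmp _ (fun a => fst _) => apply: Cmp_fst
  | |- Cmp _ (fun a => snd _) => apply: Cmp_snd
  | |- Cmp _ (fun a => _ :: _) => apply: Cmp_cons
  | |- Cmp _ (fun a => behead _) => apply: Cmp_behead
  | |- Cmp _ (fun a => full _) => apply: Cmp_full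
  | |- Cmp _ (fun a => head _ _) => apply: Cmp_head
  | |- Cmp _ (fun a => S _) => apply: Cmp_S
  | |- Cmp _ (fun a => predn _) => apply: Cmp_pred
  | |- Cmp _ (fun a => units _) => apply: Cmp_units
  | |- Cmp _ (fun a => 0 < _) => apply: Cmp_pos
  | |- Cmp _ (fun a => negb _) => apply: Cmp_not
  | |- Cmp _ (fun a => andb _ _) => apply: Cmp_and
  | |- Cmp _ (fun a => orb _ _) => apply: Cmp_or
  | |- Cmp _ (fun a => if _ then _ else _) => apply: Cmp_if
  end.
Ltac fp_eta := lazymatch goal with
  | |- Cmp _ (fun _ => _) => fail
  | |- @Cmp ?A ?B ?b ?f => change (@Cmp A B b (fun a => f a))
  end.
Ltac fp_step := first
  [ assumption | fp_eta | apply: Cmp_id | apply: Cmp_const | fp_basic | fp_list | fp_user ].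
Ltac fp := repeat fp_step.

(** * Folds with additive growth, list functions and unary arithmetic *)

Lemma sz_in (A : encType) (l : seq A) i (x : A) : i < size l -> sz (nth x l i) <= sz l.
Proof.
elim: l i => // y l IH [|i] /=; rewrite sz_cons; first by lia.
by rewrite ltnS => /IH; lia.
Qed.

Lemma leq_exp_base k m n : m <= n -> m ^ k <= n ^ k.
Proof. by case: k => // k; rewrite leq_exp2r. Qed.

(** If the growth per step depends on the item but not on the accumulator, the total growth is at
    most the length of the list times a polynomial. *)
Lemma Cmp_foldl_add (A B C : encType) (beta : A -> nat) (stp : A -> B -> C -> C)
    (l : A -> seq B) (init : A -> C) k :
  FP (fun v : A * B * C => stp v.1.1 v.1.2 v.2) ->
  (forall a b c, sz (stp a b c) <= sz c + bd (fun=> 0) (a, b) ^ k) ->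
  Cmp beta l -> Cmp beta init ->
  Cmp beta (fun a => foldl (fun c b => stp a b c) (init a) (l a)).
Proof.
move=> hs hk hl hi; have sl := Cmp_sz hl; have si := Cmp_sz hi.
have ps := pb_sz beta.
apply: (Cmp_foldl hs (M := fun a => sz (init a) + sz (l a) * (sz a + sz (l a) + 3) ^ k)) => //=.
  by pb.
move=> a i ile; apply: (@leq_trans (sz (init a) + i * (sz a + sz (l a) + 3) ^ k)).
  elim: i ile => [|i IH] ile; first by rewrite take0 /=; lia.
  case e : (l a) (ile) => [|x0 l'] // _; rewrite -e.
  rewrite (take_nth x0) // -cats1 foldl_cat /=.
  apply: leq_trans (hk _ _ _) _; rewrite mulSnr addnA; apply: leq_add.
    by apply: IH; exact: ltnW.
  apply: leq_exp_base; rewrite /bd sz_pair.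
  by have := sz_in x0 ile; rewrite add0n; lia.
by rewrite leq_add2l leq_mul // (leq_trans ile) // size_le_sz.
Qed.

Lemma foldl_rev_cons T (l s : seq T) : foldl (fun c b => b :: c) s l = catrev l s.
Proof. by elim: l s => //= x l IH s; rewrite IH. Qed.

Lemma foldl_map_cons T U (h : T -> U) l s :
  foldl (fun c b => h b :: c) s l = catrev [seq h b | b <- l] s.
Proof. by elim: l s => //= x l IH s; rewrite IH. Qed.

Lemma foldl_filter_cons T (h : pred T) l s :
  foldl (fun c b => if h b then b :: c else c) s l = catrev [seq b <- l | h b] s.
Proof. by elim: l s => //= x l IH s; rewrite IH; case: (h x). Qed.

Section ListFunctions.
Variables (A : encType) (beta : A -> nat).

Lemma Cmp_catrev (B : encType) (f g : A -> seq B) :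
  Cmp beta f -> Cmp beta g -> Cmp beta (fun a => catrev (f a) (g a)).
Proof.
apply: (Cmp_comp2 (h := catrev)).
apply: (Cmp_ext (f := fun p : seq B * seq B =>
    foldl (fun c b => (fun (a : seq B * seq B) b c => b :: c) p b c) p.2 p.1)).
  by move=> p; rewrite foldl_rev_cons.
apply: (Cmp_foldl_add (k := 1)); [by fp| |by fp|by fp].
by move=> p b c; rewrite sz_cons expn1 /bd !sz_pair; lia.
Qed.

Lemma Cmp_rev (B : encType) (f : A -> seq B) : Cmp beta f -> Cmp beta (fun a => rev (f a)).
Proof. by move=> hf; apply: Cmp_catrev => //; fp. Qed.

Lemma Cmp_cat (B : encType) (f g : A -> seq B) :
  Cmp beta f -> Cmp beta g -> Cmp beta (fun a => f a ++ g a).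
Proof.
move=> hf hg; apply: (Cmp_ext _ (Cmp_catrev (Cmp_rev hf) hg)) => a.
by rewrite catrevE revK.
Qed.

Lemma Cmp_map (B C : encType) (h : A -> B -> C) (l : A -> seq B) :
  FP (fun v : A * B => h v.1 v.2) -> Cmp beta l ->
  Cmp beta (fun a => [seq h a b | b <- l a]).
Proof.
move=> hh hl; have [k hk] := Cmp_sz hh.
apply: (Cmp_ext (f := fun a => rev (foldl (fun c b =>
    (fun a b c => h a b :: c) a b c) [::] (l a)))).
  by move=> a /=; rewrite foldl_map_cons -/(rev _) revK.
apply: Cmp_rev; apply: (Cmp_foldl_add (k := k.+1)); [| |by fp|by fp].
  apply: Cmp_cons; last by fp.
  by apply: (Cmp_comp hh (f := fun v : A * B * seq C => v.1)); fp.
move=> a b c; rewrite sz_cons -addSn addnC leq_add2l expnS.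
apply: leq_trans (leq_mul (bd_ge2 (fun=> 0) (a, b)) (hk (a, b))) => /=.
by have := sz_gt0 (h a b); lia.
Qed.

Lemma Cmp_filter (B : encType) (h : A -> B -> bool) (l : A -> seq B) :
  FP (fun v : A * B => h v.1 v.2) -> Cmp beta l ->
  Cmp beta (fun a => [seq b <- l a | h a b]).
Proof.
move=> hh hl.
apply: (Cmp_ext (f := fun a => rev (foldl (fun c b =>
    (fun a b c => if h a b then b :: c else c) a b c) [::] (l a)))).
  by move=> a /=; rewrite foldl_filter_cons -/(rev _) revK.
apply: Cmp_rev; apply: (Cmp_foldl_add (k := 1)); [| |by fp|by fp].
  apply: Cmp_if; [|by fp|by fp].
  by apply: (Cmp_comp hh (f := fun v : A * B * seq B => v.1)); fp.
move=> a b c; rewrite expn1 /bd sz_pair; case: ifP; rewrite ?sz_cons; lia.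
Qed.

Lemma sz_cat (B : encType) (s t : seq B) : sz (s ++ t) <= sz s + sz t.
Proof. by elim: s => [|b s IH] /=; rewrite ?sz_cons; lia. Qed.

Lemma foldl_cat_flatten T (l : seq (seq T)) s :
  foldl (fun c b => c ++ b) s l = s ++ flatten l.
Proof. by elim: l s => [|b l IH] s /=; rewrite ?cats0 // IH catA. Qed.
End ListFunctions.

Ltac fp_list ::= lazymatch goal with
  | |- Cmp _ (fun a => catrev _ _) => apply: Cmp_catrev
  | |- Cmp _ (fun a => rev _) => apply: Cmp_rev
  | |- Cmp _ (fun a => _ ++ _) => apply: Cmp_cat
  | |- Cmp _ (fun a => map _ _) => apply: Cmp_map
  | |- Cmp _ (fun a => seq.filter _ _) => apply: Cmp_filter
  end.

Section MoreLists.
Variables (A : encType) (beta : A -> nat).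

Lemma Cmp_flatten (B : encType) (l : A -> seq (seq B)) :
  Cmp beta l -> Cmp beta (fun a => flatten (l a)).
Proof.
move=> hl; apply: (Cmp_ext (f := fun a => foldl (fun c b =>
    (fun a b c => c ++ b) a b c) [::] (l a))).
  by move=> a; rewrite foldl_cat_flatten.
apply: (Cmp_foldl_add (k := 1)); [by fp| |by fp|by fp].
move=> a b c; rewrite expn1 /bd sz_pair; have := sz_cat c b; lia.
Qed.

Lemma Cmp_size (B : encType) (l : A -> seq B) :
  Cmp beta l -> Cmp beta (fun a => size (l a)).
Proof.
move=> hl; apply: (Cmp_ext (f := fun a => foldl (fun c b =>
    (fun a b c => c.+1) a b c) 0 (l a))).
  by move=> a /=; rewrite -[RHS]addn0; elim: (l a) 0 => //= b l' IH c; rewrite IH addnS.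
apply: (Cmp_foldl_add (k := 1)); [by fp| |by fp|by fp].
by move=> a b c; rewrite expn1 /bd sz_pair !sz_nat; lia.
Qed.

Lemma Cmp_addn (f g : A -> nat) : Cmp beta f -> Cmp beta g -> Cmp beta (fun a => f a + g a).
Proof.
move=> hf hg; apply: (Cmp_ext (f := fun a => foldl (fun c b =>
    (fun a b c => c.+1) a b c) (g a) (units (f a)))).
  by move=> a /=; elim: (f a) (g a) => [|n IH] c //=; rewrite IH addSnnS.
apply: (Cmp_foldl_add (k := 1)); [by fp| |by fp|by fp].
by move=> a b c; rewrite expn1 /bd sz_pair !sz_nat; lia.
Qed.

Lemma Cmp_subn (f g : A -> nat) : Cmp beta f -> Cmp beta g -> Cmp beta (fun a => f a - g a).
Proof.
move=> hf hg; apply: (Cmp_ext (f := fun a => foldl (fun c b =>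
    (fun a b c => c.-1) a b c) (f a) (units (g a)))).
  by move=> a /=; elim: (g a) (f a) => [|n IH] c /=; rewrite ?subn0 // IH -subn1 -subnDA.
apply: (Cmp_foldl_add (k := 1)); [by fp| |by fp|by fp].
by move=> a b c; rewrite expn1 /bd sz_pair !sz_nat; lia.
Qed.

Lemma Cmp_drop (B : encType) (n : A -> nat) (l : A -> seq B) :
  Cmp beta n -> Cmp beta l -> Cmp beta (fun a => drop (n a) (l a)).
Proof.
move=> hn hl; apply: (Cmp_ext (f := fun a => foldl (fun c b =>
    (fun a b c => behead c) a b c) (l a) (units (n a)))).
  move=> a /=; elim: (n a) (l a) => [|k IH] c /=; first by rewrite drop0.
  by rewrite IH -drop1 drop_drop addn1.
apply: (Cmp_foldl_add (k := 1)); [by fp| |by fp|by fp].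
by move=> a b [|x c]; rewrite expn1 /bd sz_pair ?sz_cons /=; lia.
Qed.

Lemma Cmp_nseq (B : encType) (n : A -> nat) (x : A -> B) :
  Cmp beta n -> Cmp beta x -> Cmp beta (fun a => nseq (n a) (x a)).
Proof.
apply: (Cmp_comp2 (h := @nseq B)).
apply: (Cmp_ext (f := fun p => foldl (fun c b => (fun p b c => p.2 :: c) p b c) [::] (units p.1))).
  have h m (y : B) c : foldl (fun c _ => y :: c) c (units m) = nseq m y ++ c.
    elim: m c => //= m IH c; rewrite IH.
    by elim: m {IH} => //= m ->.
  by move=> p /=; rewrite h cats0.
apply: (Cmp_foldl_add (k := 1)); [by fp| |by fp|by fp].
by move=> [? y] b c; rewrite expn1 /bd !sz_pair ?sz_cons /=; lia.
Qed.
End MoreLists.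

Ltac fp_list ::= lazymatch goal with
  | |- Cmp _ (fun a => catrev _ _) => apply: Cmp_catrev
  | |- Cmp _ (fun a => rev _) => apply: Cmp_rev
  | |- Cmp _ (fun a => _ ++ _) => apply: Cmp_cat
  | |- Cmp _ (fun a => map _ _) => apply: Cmp_map
  | |- Cmp _ (fun a => seq.filter _ _) => apply: Cmp_filter
  | |- Cmp _ (fun a => flatten _) => apply: Cmp_flatten
  | |- Cmp _ (fun a => size _) => apply: Cmp_size
  | |- Cmp _ (fun a => addn _ _) => apply: Cmp_addn
  | |- Cmp _ (fun a => subn _ _) => apply: Cmp_subn
  | |- Cmp _ (fun a => drop _ _) => apply: Cmp_drop
  | |- Cmp _ (fun a => nseq _ _) => apply: Cmp_nseq
  end.

Section Numbers.
Variables (A : encType) (beta : A -> nat).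

Lemma Cmp_leq (f g : A -> nat) : Cmp beta f -> Cmp beta g -> Cmp beta (fun a => f a <= g a).
Proof.
move=> hf hg; have h : Cmp beta (fun a => ~~ (0 < f a - g a)) by fp.
by apply: (Cmp_ext _ h) => a; lia.
Qed.

Lemma Cmp_eqn (f g : A -> nat) : Cmp beta f -> Cmp beta g -> Cmp beta (fun a => f a == g a).
Proof.
move=> hf hg; have h : Cmp beta (fun a => (f a <= g a) && (g a <= f a)).
  by apply: Cmp_and; exact: Cmp_leq.
by apply: (Cmp_ext _ h) => a; lia.
Qed.

Lemma Cmp_muln (f g : A -> nat) : Cmp beta f -> Cmp beta g -> Cmp beta (fun a => f a * g a).
Proof.
apply: (Cmp_comp2 (h := muln)).
apply: (Cmp_ext (f := fun p => foldl (fun c b => (fun p b c => p.2 + c) p b c) 0 (units p.1))).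
  have h n m c : foldl (fun c _ => m + c) c (units n) = n * m + c.
    by elim: n c => //= n IH c; rewrite IH mulSn; lia.
  by move=> p /=; rewrite h addn0.
apply: (Cmp_foldl_add (k := 1)); [by fp| |by fp|by fp].
by move=> [n m] b c; rewrite expn1 /bd !sz_pair !sz_nat /=; lia.
Qed.

Lemma Cmp_take (B : encType) (n : A -> nat) (l : A -> seq B) :
  Cmp beta n -> Cmp beta l -> Cmp beta (fun a => take (n a) (l a)).
Proof.
move=> hn hl; have h : Cmp beta (fun a => rev (drop (size (l a) - n a) (rev (l a)))) by fp.
apply: (Cmp_ext _ h) => a; rewrite drop_rev revK.
case: (leqP (n a) (size (l a))) => le; first by rewrite subKn.
by rewrite (eqP (ltnW le)) subn0 take_size take_oversize // ltnW.
Qed.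

Lemma Cmp_iota (n : A -> nat) : Cmp beta n -> Cmp beta (fun a => iota 0 (n a)).
Proof.
apply: (Cmp_comp (g := iota 0)).
have h k : foldl (fun (c : nat * seq nat) (_ : tree) => (c.1.+1, c.1 :: c.2)) (0, [::]) (units k)
    = (k, rev (iota 0 k)).
  elim: k => // k IH; have -> : iota 0 k.+1 = iota 0 k ++ [:: k] by rewrite -addn1 iotaD.
  have -> : units k.+1 = units k ++ [:: Leaf] by rewrite -addn1 /units nseqD.
  by rewrite foldl_cat IH rev_cat.
pose stp (v : nat * tree * (nat * seq nat)) := (v.2.1.+1, v.2.1 :: v.2.2).
have hs : FP stp by rewrite /stp; fp.
have hfold : FP (fun k => foldl (fun c b => stp (k, b, c)) (0, [::]) (units k)).
  apply: (Cmp_foldl hs (M := fun k => (sz k + 3) ^ 2)); [by fp|by fp| |].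
    by have := @pb_sz _ (fun _ : nat => 0) => ?; pb.
  move=> k i /=; rewrite size_nseq => ile; rewrite take_nseq // -/(units i) h.
  rewrite sz_pair !sz_nat.
  have : sz (rev (iota 0 i)) <= i * (2 * k).+2 + 1.
    elim: i ile => // i IH ile; rewrite -addn1 iotaD rev_cat /= sz_cons sz_nat.
    by have := IH (ltnW ile); nia.
  by nia.
have h2 : FP (fun k => rev (foldl (fun c b => stp (k, b, c)) (0, [::]) (units k)).2).
  by apply: Cmp_rev; exact: (Cmp_snd hfold).
by apply: (Cmp_ext _ h2) => k /=; rewrite h revK.
Qed.

Lemma Cmp_zip (B C : encType) (d : C) (s : A -> seq B) (t : A -> seq C) :
  Cmp beta s -> Cmp beta t -> Cmp beta (fun a => zip (s a) (t a)).
Proof.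
apply: (Cmp_comp2 (h := @zip B C)).
pose stp (p : seq B * seq C) (b : B) (c : seq C * seq (B * C)) :=
  (behead c.1, if full c.1 then (b, head d c.1) :: c.2 else c.2).
apply: (Cmp_ext (f := fun p => rev (foldl (fun c b => stp p b c) (p.2, [::]) p.1).2)).
  move=> p; have h (u : seq B) v w : (foldl (fun c b => stp p b c) (v, w) u).2 = catrev (zip u v) w.
    by elim: u v w => [|b u IH] [|c v] w //=; rewrite IH //; case: (u).
  by rewrite h -/(rev _) revK.
apply: Cmp_rev; apply: Cmp_snd; apply: (Cmp_foldl_add (k := 1)); [by rewrite /stp; fp| |by fp|by fp].
move=> p b [u v]; rewrite expn1 /bd /stp /= !sz_pair.
by case: u => [|c u] /=; rewrite ?sz_cons ?sz_pair; lia.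
Qed.

End Numbers.

Ltac fp_list ::= lazymatch goal with
  | |- Cmp _ (fun a => catrev _ _) => apply: Cmp_catrev
  | |- Cmp _ (fun a => rev _) => apply: Cmp_rev
  | |- Cmp _ (fun a => _ ++ _) => apply: Cmp_cat
  | |- Cmp _ (fun a => map _ _) => apply: Cmp_map
  | |- Cmp _ (fun a => seq.filter _ _) => apply: Cmp_filter
  | |- Cmp _ (fun a => flatten _) => apply: Cmp_flatten
  | |- Cmp _ (fun a => size _) => apply: Cmp_size
  | |- Cmp _ (fun a => addn _ _) => apply: Cmp_addn
  | |- Cmp _ (fun a => subn _ _) => apply: Cmp_subn
  | |- Cmp _ (fun a => drop _ _) => apply: Cmp_drop
  | |- Cmp _ (fun a => nseq _ _) => apply: Cmp_nseq
  | |- Cmp _ (fun a => take _ _) => apply: Cmp_take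
  | |- Cmp _ (fun a => muln _ _) => apply: Cmp_muln
  | |- Cmp _ (fun a => eq_op _ _) => apply: Cmp_eqn
  | |- Cmp _ (fun a => leq _ _) => apply: Cmp_leq
  | |- Cmp _ (fun a => iota 0 _) => apply: Cmp_iota
  end.

(** * Running an algorithm between two tree programs *)

Section RawConversion.

(* The raw input is not self-delimiting; the loop rebuilds it from its last bit
   as the code of a list of booleans. *)
Definition raw_loop : prog := While 1 (Case 1 Skip
  (Seq (Pop 1) (Seq (Push false 0) (Push true 0)))
  (Seq (Pop 1) (Seq (Push false 0) (Seq (Push false 0) (Seq (Push true 0) (Push true 0)))))).

Definition raw_to_tree : prog := Seq (mv 0 1) (Seq (Push false 0) raw_loop).

Lemma exec_raw_to_tree (w : seq bool) s :
  exec_le raw_to_tree (st w [::] [::] [::] s) (16 * size w + 5)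
    (st (code (enc w)) [::] [::] [::] s).
Proof.
have loop (r u : seq bool) : exec_le raw_loop (st (code (enc u)) r [::] [::] s)
    (11 * size r + 1) (st (code (enc (catrev r u))) [::] [::] [::] s).
  elim: r u => [|b r IH] u; first exact: exec_while_stop.
  apply: (@exec_weak _ _ (10 + (11 * size r + 1)).+1); first by rewrite /=; lia.
  apply: (exec_while_go _ _ (IH (b :: u))) => //.
  by case: b {IH}; exec_block.
eapply exec_weak; first last.
  eapply exec_seq; first exact: exec_mv01.
  eapply exec_seq; first exact: exec_push.
  rewrite upd_st cats0; have := loop (rev w) [::].
  by rewrite -/(rev _) revK; apply.
by rewrite size_rev; lia.
Qed.

(** Stack 2 holds one mark that keeps the loop alive until the leaf at the end of the list. In the
    code of a list, [false] reads as 1 0 and [true] as 1 1 0 0; the bits arrive reversed on stack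
    1. *)
Definition tree_loop : prog := While 2 (Case 0 Skip (Seq (Pop 0) (Pop 2))
  (Seq (Pop 0) (Case 0 Skip (Seq (Pop 0) (Push false 1))
    (Seq (Pop 0) (Seq (Pop 0) (Seq (Pop 0) (Push true 1))))))).

Lemma exec_tree_loop (w : seq bool) v s :
  exec_le (Seq (Push true 2) tree_loop) (st (code (enc w) ++ v) [::] [::] [::] s)
    (12 * size w + 10) (st v (rev w) [::] [::] s).
Proof.
have loop (u r : seq bool) : exec_le tree_loop (st (code (enc u) ++ v) r [:: true] [::] s)
    (12 * size u + 6) (st v (catrev u r) [::] [::] s).
  elim: u r => [|b u IH] r.
    apply: (@exec_weak _ _ (4 + 1).+1) => //.
    apply: (@exec_while_go _ _ _ _ (st v r [::] [::] s)) => //; first by exec_block.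
    exact: exec_while_stop.
  apply: (@exec_weak _ _ (11 + (12 * size u + 6)).+1); first by rewrite /=; lia.
  apply: (exec_while_go _ _ (IH (b :: r))) => //.
  by case: b {IH}; exec_block.
apply: (@exec_weak _ _ (1 + (12 * size w + 6)).+1); first by lia.
by apply: exec_seq; [exact: exec_push|rewrite upd_st; exact: loop].
Qed.

End RawConversion.

Lemma sz_bits (w : seq bool) : size w <= sz w <= 4 * size w + 1.
Proof.
elim: w => // b w /andP [h1 h2]; rewrite sz_cons /=.
by have := sz_bool_le b; have := sz_gt0 b; lia.
Qed.

(** * Confining the given algorithm to the first N stacks *)

Fixpoint fits (N : nat) (c : prog) : bool :=
  match c with
  | Skip => true
  | Push _ x | Pop x | Flip x => x < N
  | Seq c1 c2 => fits N c1 && fits N c2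
  | Case x c1 c2 c3 => [&& x < N, fits N c1, fits N c2 & fits N c3]
  | While x c1 => (x < N) && fits N c1
  end.

Lemma fits_weak N M c : N <= M -> fits N c -> fits M c.
Proof.
move=> NM; elim: c => //=.
- by move=> _ x /leq_trans; apply.
- by move=> x /leq_trans; apply.
- by move=> x /leq_trans; apply.
- by move=> c1 IH1 c2 IH2 /andP [/IH1 -> /IH2].
- by move=> x c1 IH1 c2 IH2 c3 IH3 /and4P [/leq_trans -> // /IH1 -> /IH2 -> /IH3].
- by move=> x c IH /andP [/leq_trans -> // /IH].
Qed.

Lemma fits_exists c : exists N, fits N c.
Proof.
elim: c => /=.
- by exists 0.
- by move=> _ x; exists x.+1.
- by move=> x; exists x.+1.
- by move=> x; exists x.+1.
- move=> c1 [N1 h1] c2 [N2 h2]; exists (N1 + N2).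
  by rewrite (fits_weak _ h1) ?(fits_weak _ h2) ?leq_addr ?leq_addl.
- move=> x c1 [N1 h1] c2 [N2 h2] c3 [N3 h3]; exists (x.+1 + N1 + N2 + N3).
  by rewrite (fits_weak _ h1) ?(fits_weak _ h2) ?(fits_weak _ h3) //=; lia.
- by move=> x c [N h]; exists (x.+1 + N); rewrite (fits_weak _ h) /=; lia.
Qed.

(* A program that fits N does not see the stacks from N on, which can therefore
   keep the parameters (n, m) while the given algorithm runs. *)
Definition patch (N : nat) (s h : store) : store := fun y => if y < N then s y else h y.

Lemma patch_upd N s h x w : x < N -> patch N (upd s x w) h = upd (patch N s h) x w.
Proof.
by move=> xN; apply/funext => y; rewrite /patch /upd; case: eqP => // ->; rewrite xN.
Qed.

Lemma frame_step N s h kk k b : all (fits N) kk -> 0 < size kk ->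
  step (patch N s h, kk ++ k) b =
    (patch N (step (s, kk) b).1 h, (step (s, kk) b).2 ++ k) /\
  all (fits N) (step (s, kk) b).2.
Proof.
case: kk => [//|c kk] /= /andP [hc hkk] _.
case: c hc => [|b' x|x|x|c1 c2|x c1 c2 c3|x c] /= hc; rewrite ?hkk //=.
- by rewrite patch_upd // /patch hc.
- by rewrite patch_upd // /patch hc.
- by rewrite patch_upd // /patch hc.
- by case/andP: hc => -> ->.
- case/and4P: hc => hx h1 h2 h3; have -> : patch N s h x = s x by rewrite /patch hx.
  by case: (s x) => [|[] ?]; rewrite ?h1 ?h2 ?h3.
- case/andP: hc => hx h1; have -> : patch N s h x = s x by rewrite /patch hx.
  by case: (s x) => [|? ?] /=; rewrite ?hx ?h1 hkk.
Qed.

Lemma run_halted s r : foldl step (s, [::]) r = (s, [::]).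
Proof. by elim: r. Qed.

(** The algorithm may halt before its coins are used up, hence the prefix [take t r]: the
    continuation [k] takes over right after step t, whereas a run on its own would idle. *)
Lemma frame_run N s h kk k r : all (fits N) kk -> halted (foldl step (s, kk) r) ->
  exists2 t, t <= size r &
    foldl step (patch N s h, kk ++ k) (take t r) =
    (patch N (foldl step (s, kk) r).1 h, k).
Proof.
elim: r s kk => [|b r IH] s [|c kk] hkk.
- by exists 0.
- by [].
- by move=> _; exists 0; rewrite // run_halted take0.
- have [e hkk'] := frame_step s h k b hkk isT.
  rewrite -[foldl _ _ _]/(foldl step (step (s, c :: kk) b) r).
  move: e hkk'; case: (step (s, c :: kk) b) => s1 kk1 e hkk1 hh.
  have [t lt et] := IH s1 kk1 hkk1 hh; exists t.+1 => //.
  by rewrite -[foldl _ _ _]/(foldl step (step (patch N s h, (c :: kk) ++ k) b) (take t r)) e.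
Qed.

Lemma size_run s kk r y : size ((foldl step (s, kk) r).1 y) <= size (s y) + size r.
Proof.
elim: r s kk => [|b r IH] s kk; first by rewrite addn0.
rewrite -[foldl _ _ _]/(foldl step (step (s, kk) b) r).
have h : size ((step (s, kk) b).1 y) <= (size (s y)).+1.
  case: kk => [|[|b' x|x|x|c1 c2|x c1 c2 c3|x c1] kk] //=; rewrite ?leqnSn /upd //.
  - by case: eqVneq => [->|].
  - by case: eqVneq => [<-|] //; rewrite size_behead; lia.
  - by case: eqVneq => [->|].
case: (step (s, kk) b) h => s1 k1 /= h.
by apply: leq_trans (IH _ _) _ => /=; lia.
Qed.

Lemma exec_run c s t s' r : exec_le c s t s' -> t <= size r ->
  foldl step (s, [:: c]) r = (s', [::]).
Proof.
move=> [t' le' e] lt; rewrite -[r](cat_take_drop t') foldl_cat e ?run_halted //.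
by rewrite size_take; case: ltnP => //; lia.
Qed.

(** The algorithm may leave anything on the stacks that it uses, but the tree programs expect empty
    scratch stacks. Stack 0 is spared because it holds the output. *)
Fixpoint clear_below (N : nat) : prog :=
  if N is M.+1 then Seq (clear_below M) (if M is 0 then Skip else While M (Pop M)) else Skip.

Lemma exec_clear_below N s T : (forall y, size (s y) <= T) ->
  exec_le (clear_below N) s (N * (2 * T + 3) + 1)
    (fun y => if (0 < y) && (y < N) then [::] else s y).
Proof.
move=> hT; elim: N => [|[|N] IH].
- by apply: exec_eq (exec_skip _); apply/funext => y; rewrite ltn0 andbF.
- apply: (@exec_weak _ _ (1 + 1).+1); first by lia.
  by apply: exec_seq; [exact: exec_skip|apply: exec_eq (exec_skip _); apply/funext => -[|y]].
set c := clear_below N.+1 in IH *.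
apply: (@exec_weak _ _ (N.+1 * (2 * T + 3) + 1 + (2 * T + 1)).+1); first by lia.
rewrite -[clear_below _]/(Seq c (While N.+1 (Pop N.+1))).
apply: exec_seq; first exact: IH.
apply: (@exec_weak _ _ (2 * size (s N.+1) + 1)); first by rewrite leq_add2r leq_mul2l hT.
apply: exec_eq (exec_clear _); last by rewrite ltnn andbF.
apply/funext => y; rewrite /upd; case: eqVneq => [->|ny]; first by rewrite /= ltnSn.
by have -> : (y < N.+2) = (y < N.+1) by move/eqP: ny; lia.
Qed.

Section Driver.
Variables (A cpre cpost : prog) (N : nat).
Hypotheses (N_ge4 : 3 < N) (A_fits : fits N A).

(** Popping the node bit of the pair (instance, parameters) leaves two codes in a row. The first is
    turned into raw bits, the second moves to stack N, out of reach of the algorithm; [post_prog]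
    pairs it with the output again. *)
Definition pre_prog : prog := Seq raw_to_tree (Seq cpre (Seq (Pop 0)
  (Seq (Seq (Push true 2) tree_loop) (Seq (mv 0 N) (mv 1 0))))).
Definition post_prog : prog := Seq (clear_below N) (Seq raw_to_tree (Seq (mv N 0)
  (Seq (Push true 0) (Seq cpost (Seq (Seq (Push true 2) tree_loop) (mv 1 0)))))).
Definition driver : prog := Seq pre_prog (Seq A post_prog).

Let noth : store := fun=> [::].
Let init w := upd noth 0 w.

Lemma exec_pre (P : encType) w inst (par : P) t :
  computes cpre (enc w) (enc (inst, par)) t ->
  exec_le pre_prog (init w) (100 * (size w + t + 1))
    (upd (init inst) N (rev (code (enc par)))).
Proof.
move=> h; have hs : sz (inst, par) <= sz w + t := computes_size h.
rewrite sz_pair in hs.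
have -> : init w = st w [::] [::] [::] noth by apply/funext => -[|[|[|[|y]]]].
eapply exec_weak; first last.
  eapply exec_seq; first exact: exec_raw_to_tree.
  eapply exec_seq; first by rewrite -[code _]cats0; exact: h.
  eapply exec_seq; first exact: exec_pop.
  rewrite upd_st cats0 /=; eapply exec_seq; first exact: exec_tree_loop.
  eapply exec_seq; first by apply: exec_mv => //; rewrite neq_ltn (leq_trans _ N_ge4).
  apply: exec_eq; last by apply: (@exec_mv 1 0 _ (rev inst)); rewrite // /upd /=; case: eqP => // e; move: N_ge4; rewrite -e.
  rewrite revK; apply/funext => y; rewrite /upd /init.
  have N0 : N != 0 by lia.
  have N1 : N != 1 by lia.
  case: (eqVneq y N) => [->|yN].
    rewrite (negPf N0) (negPf N1).
    by move: N_ge4; move: (N) => [|[|[|[|M]]]] //= _; rewrite cats0.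
  by move: y yN => [|[|[|[|y]]]] /=; rewrite ?cats0.
have := sz_bits w; have := sz_bits inst; rewrite size_rev.
rewrite -/(sz par) /=; lia.
Qed.

Lemma exec_post (P : encType) (s : store) out (par : P) res T t :
  s 0 = out -> (forall y, size (s y) <= T) ->
  computes cpost (enc (par, out)) (enc res) t ->
  exists2 s' : store, s' 0 = res &
  exec_le post_prog (patch N s (upd noth N (rev (code (enc par)))))
    (100 * N * (T + t + sz par + 1)) s'.
Proof.
move=> s0 hT h; have hs : sz res <= sz (par, out) + t := computes_size h.
pose s1 : store := upd noth N (rev (code (enc par))).
have s1N : s1 N = rev (code (enc par)) by rewrite /s1 /upd eqxx.
have stN w0 : st w0 [::] [::] [::] s1 N = rev (code (enc par)).
  by rewrite -s1N; move: N_ge4; move: (N) => [|[|[|[|M]]]].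
have s1n y : y != N -> s1 y = [::] by rewrite /s1 /upd => /negPf ->.
exists (st res [::] [::] [::] noth) => //.
have outT : size out <= T by rewrite -s0.
eapply exec_weak; first last.
  eapply exec_seq.
    apply: (@exec_clear_below N _ (T + sz par)) => y; rewrite /patch /upd /noth.
    case: ifP => _; first exact: leq_trans (hT y) (leq_addr _ _).
    by case: eqP => _ //; rewrite size_rev leq_addl.
  have -> : (fun y => if (0 < y) && (y < N) then [::] else patch N s s1 y) =
      st out [::] [::] [::] s1.
    have [n0 n1 n2] : [/\ 0 < N, 1 < N & 2 < N] by split; lia.
    apply/funext => -[|[|[|[|y]]]] /=; rewrite /patch ?n0 ?n1 ?n2 ?N_ge4 ?s0 //=.
    by case: (ltnP y.+4 N) => // lt; rewrite s1n // neq_ltn lt.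
  eapply exec_seq; first exact: exec_raw_to_tree.
  eapply exec_seq; first by apply: exec_mv; [lia|exact: stN].
  have -> : upd (upd (st (code (enc out)) [::] [::] [::] s1) 0
      (rev (rev (code (enc par))) ++ st (code (enc out)) [::] [::] [::] s1 0)) N [::] =
      st (code (enc par) ++ code (enc out)) [::] [::] [::] noth.
    rewrite revK /=; apply/funext => y; rewrite /upd; case: eqP => [->|/eqP yN].
      by move: N_ge4; move: (N) => [|[|[|[|M]]]].
    by move: y yN => [|[|[|[|y]]]] //= yN; rewrite s1n.
  eapply exec_seq; first exact: exec_push.
  rewrite upd_st; eapply exec_seq; first by have := h [::] noth; rewrite /= !cats0; apply.
  eapply exec_seq; first by have := exec_tree_loop res [::] noth; rewrite cats0; apply.
  by apply: exec_eq (exec_mv10 _ _ _ _ _); rewrite revK cats0.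
have := sz_bits out; have := sz_bits res; rewrite !size_rev -/(sz par).
have m1 := leq_mul N_ge4 (leqnn T); have m2 := leq_mul N_ge4 (leqnn t).
have m3 := leq_mul N_ge4 (leqnn (sz par)).
move: hs; rewrite sz_pair; move: m1 m2 m3 N_ge4 outT.
move: (size res) (size out) (sz par) (sz res) (sz out) (N) => a b c d e M.
lia.
Qed.

Lemma driver_run (P : encType) w inst (par : P) (post : seq bool -> seq bool) t1 t3 TA :
  computes cpre (enc w) (enc (inst, par)) t1 ->
  halts_within A inst TA ->
  (forall out, size out <= size inst + TA ->
     computes cpost (enc (par, out)) (enc (post out)) t3) ->
  exists t0 T, [/\ t0 + TA <= T, T <= 1000 * N * (size w + t1 + TA + t3 + 1) &
    forall r, size r = T ->
      halted (run driver w r) /\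
      output (run driver w r) = post (output (run A inst (take TA (drop t0 r))))].
Proof.
move=> hpre hA hpost; have hs : sz (inst, par) <= sz w + t1 := computes_size hpre.
have [t1' le1 e1] := exec_pre hpre.
pose tp := 100 * N * (size inst + TA + t3 + sz par + 1).
(* The coins of the algorithm start after the steps of [pre_prog] and two more, one for each [Seq]
   that is unfolded in [driver]. *)
exists t1'.+2, (t1'.+2 + TA + tp); split; first exact: leq_addr.
  move: hs le1; rewrite /tp sz_pair.
  have := sz_bits w; have := sz_bits inst; move: N_ge4.
  move: (size w) (size inst) (sz w) (sz inst) (sz par) (N) => a b c d e M M4 h1 h2 h3 h4.
  have m0 := leq_mul M4 (leqnn t1); have m1 := leq_mul M4 (leqnn TA).
  have m2 := leq_mul M4 (leqnn t3); have m3 := leq_mul M4 (leqnn a).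
  have m4 := leq_mul (leqnn M) (_ : b + e <= 8 * a + 2 * t1 + 2).
  by have := m4 ltac:(lia); lia.
move=> r sr; rewrite /run -/(init _).
case: r sr => // b0 r [sr].
rewrite -[drop _ _]/(drop t1'.+1 r).
rewrite -[foldl _ _ (b0 :: r)]/(foldl step (init w, [:: pre_prog; Seq A post_prog]) r).
rewrite -{1 2}[r](cat_take_drop t1') foldl_cat e1; last by rewrite size_take; case: ltnP => //; lia.
case e : (drop t1' r) => [|b1 q]; first by have := size_drop t1' r; rewrite e /=; lia.
have eq : drop t1'.+1 r = q by rewrite -add1n -drop_drop e /= drop0.
have sq : size q = TA + tp by rewrite -eq size_drop; lia.
rewrite eq; set S1 := upd (init inst) N _.
rewrite -[foldl _ _ (b1 :: q)]/(foldl step (S1, [:: A; post_prog]) q).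
have -> : S1 = patch N (init inst) (upd noth N (rev (code (enc par)))).
  apply/funext => y; rewrite /S1 /patch /upd /init.
  case: ltnP => yN; first by rewrite (ltn_eqF yN).
  by case: eqP => // _; rewrite /upd; case: eqP => // y0; move: yN N_ge4; rewrite y0; lia.
have stA : size (take TA q) == TA by rewrite size_takel // sq leq_addr.
have hhA : halted (run A inst (take TA q)) := hA (Tuple stA).
have fitsA : all (fits N) [:: A] by rewrite /= A_fits.
(* If the algorithm stops after t < TA steps, the rest of its block of coins goes to [post_prog],
   which ignores coins; the output is the one obtained on the whole block. *)
have [t tle et] := frame_run (upd noth N (rev (code (enc par)))) [:: post_prog] fitsA hhA.
rewrite (eqP stA) in tle; rewrite take_takel // in et.
rewrite -{1 2}[q](cat_take_drop t) foldl_cat et -/(run A inst _).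
set cfA := run A inst _.
have szA y : size (cfA.1 y) <= size inst + TA.
  apply: leq_trans (size_run _ _ _ _) _; rewrite (eqP stA) leq_add2r /upd.
  by case: eqP.
have [s' s'0 es] := exec_post (erefl (cfA.1 0)) szA (hpost _ (szA 0)).
rewrite (exec_run es) //; rewrite size_drop sq -/tp; lia.
Qed.

End Driver.

(* [lia] takes sizes for different atoms when their type arguments are only
   convertible. *)
Ltac gen_sz := repeat match goal with
  | |- context [@sz ?A ?x] => let n := fresh in move: (@sz A x) => n
  | |- context [@size ?A ?x] => let n := fresh in move: (@size A x) => n end.

(** * Gaussian integers and elimination *)

Fixpoint bval (w : seq bool) : nat := if w is b :: w' then b + (bval w').*2 else 0.

Lemma bval_cat u v : bval (u ++ v) = bval u + 2 ^ size u * bval v.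
Proof. elim: u => [|b u IH] /=; rewrite ?mul1n // IH expnS; lia. Qed.

Definition add_step (b : bool) (s : seq bool * bool * seq bool) :=
  let yb := head false s.1.1 in let c := s.1.2 in
  (behead s.1.1, (b && yb) || (b && c) || (yb && c),
   (if b then (if yb then c else ~~ c) else (if yb then ~~ c else c)) :: s.2).

Definition add_fold := foldl (fun s b => add_step b s).

Definition badd (x y : seq bool) : seq bool :=
  let s1 := add_fold (y, false, [::]) x in
  let s2 := add_fold ([::], s1.1.2, s1.2) s1.1.1 in
  rev (s2.1.2 :: s2.2).

(** The invariant of the addition: digits already written, plus the carry and the unread digits of
    both summands at the current binary place. *)
Definition add_val (s : seq bool * bool * seq bool) (x : seq bool) : nat :=
  bval (rev s.2) + 2 ^ size s.2 * (s.1.2 + bval x + bval s.1.1).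

Lemma add_fold_val s x : add_val (add_fold s x) [::] = add_val s x.
Proof.
elim: x s => //= b x IH s; rewrite {}IH.
case: s => [[y c] out]; rewrite /add_val /= rev_cons -cats1 bval_cat size_rev expnS /=.
by case: y => [|yb y] /=; case: b; try case: yb; case: c => /=; lia.
Qed.

Lemma badd_val x y : bval (badd x y) = bval x + bval y.
Proof.
rewrite /badd; set s1 := add_fold _ x; set s2 := add_fold _ _.
have e1 : add_val s1 [::] = bval x + bval y.
  by rewrite /s1 add_fold_val /add_val /= mul1n add0n.
have e2 : add_val s2 [::] = add_val s1 [::].
  by rewrite /s2 add_fold_val /add_val /= !addn0.
have n2 : s2.1.1 = [::].
  rewrite /s2; move: s1.1.1 s1.1.2 s1.2 => u c out {e1 e2}.
  by elim: u c out => //= b u IH c out; exact: IH.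
rewrite -e1 -e2 rev_cons -cats1 bval_cat size_rev /add_val n2 /=.
by rewrite ?addn0.
Qed.

Lemma add_fold_size s x : size (add_fold s x).2 = size s.2 + size x /\
  size (add_fold s x).1.1 = size s.1.1 - size x.
Proof.
elim: x s => [|b x IH] s /=; first by rewrite addn0 subn0.
by have [-> ->] := IH (add_step b s); rewrite /= size_behead; lia.
Qed.

Lemma size_badd x y : size (badd x y) = (maxn (size x) (size y)).+1.
Proof.
rewrite /badd size_rev /=.
have [-> _] := add_fold_size ([::], (add_fold (y, false, [::]) x).1.2, (add_fold (y, false, [::]) x).2) (add_fold (y, false, [::]) x).1.1.
by have [-> ->] := add_fold_size (y, false, [::]) x; rewrite /=; lia.
Qed.

Lemma Cmp_add_fold (A : encType) (beta : A -> nat) f g : Cmp beta f -> Cmp beta g ->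
  Cmp beta (fun a => add_fold (f a) (g a)).
Proof.
apply: (Cmp_comp2 (h := add_fold)).
apply: (Cmp_foldl_add (stp := fun _ b s => add_step b s) (k := 1)); [by rewrite /add_step; fp| |by fp|by fp].
move=> a b [[y c] out]; rewrite expn1 /bd /add_step !sz_pair !sz_cons /=.
set c1 := _ || _; set c2 := if _ then _ else _; clearbody c1 c2.
have := sz_bool_le c1; have := sz_bool_le c2; have := sz_gt0 c; have := sz_gt0 a.1.
have := sz_gt0 b; have := sz_gt0 a.2; have -> : sz a = (sz a.1 + sz a.2).+1 by rewrite -sz_pair; case: (a).
have : sz (@behead bool y) <= sz y by rewrite -drop1; exact: (@sz_drop bool_encType).
gen_sz; lia.
Qed.

Lemma Cmp_badd (A : encType) (beta : A -> nat) f g : Cmp beta f -> Cmp beta g ->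
  Cmp beta (fun a => badd (f a) (g a)).
Proof.
apply: (Cmp_comp2 (h := badd)); rewrite /badd.
have h : FP (fun p : seq bool * seq bool => add_fold (p.2, false, [::]) p.1).
  by apply: Cmp_add_fold; fp.
by apply: Cmp_rev; apply: Cmp_cons; [apply: Cmp_snd; apply: Cmp_fst|apply: Cmp_snd];
  apply: Cmp_add_fold; fp.
Qed.

Definition bmul (x y : seq bool) : seq bool :=
  foldl (fun acc (b : bool) => if b then badd (false :: acc) y else false :: acc) [::] (rev x).

Lemma bmul_cons b x y :
  bmul (b :: x) y = if b then badd (false :: bmul x y) y else false :: bmul x y.
Proof. by rewrite /bmul rev_cons foldl_rcons. Qed.

Lemma bmul_val x y : bval (bmul x y) = bval x * bval y.
Proof. by elim: x => //= -[] x IH; rewrite bmul_cons ?badd_val /= IH; lia. Qed.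

Lemma size_bmul x y : size (bmul x y) <= 2 * size x + size y.
Proof. by elim: x => //= -[] x IH; rewrite bmul_cons ?size_badd /=; lia. Qed.

Lemma Cmp_bmul (A : encType) (beta : A -> nat) f g : Cmp beta f -> Cmp beta g ->
  Cmp beta (fun a => bmul (f a) (g a)).
Proof.
apply: (Cmp_comp2 (h := bmul)); rewrite /bmul.
pose stp (v : seq bool * seq bool * bool * seq bool) :=
  if v.1.2 then badd (false :: v.2) v.1.1.2 else false :: v.2.
have hs : FP stp by rewrite /stp; apply: Cmp_if; [fp|apply: Cmp_badd; fp|fp].
apply: (Cmp_foldl hs (M := fun p => 4 * (2 * sz p + sz p) + 1)); [by fp|by fp| |].
  by pb; exact: pb_sz.
(* A partial fold is itself a product, with the leading digits of x as the first factor, so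
   [size_bmul] bounds every accumulator. *)
move=> [x y] i _; rewrite [foldl _ _ _](_ : _ = bmul (rev (take i (rev x))) y); last first.
  by rewrite /bmul revK.
have := size_bmul (rev (take i (rev x))) y; have /andP [_] := sz_bits (bmul (rev (take i (rev x))) y).
have : size (rev (take i (rev x))) <= size x.
  by rewrite size_rev size_take size_rev; case: ltnP => // /ltnW.
have /andP [+ _] := sz_bits x; have /andP [+ _] := sz_bits y; rewrite sz_pair.
by gen_sz; lia.
Qed.

(** Digits come least significant first, so the last place at which the numbers differ decides; the
    flag is the verdict on the places read so far, and equal digits keep it. *)
Definition gt_step (b : bool) (s : seq bool * bool) :=
  (behead s.1, let yb := head false s.1 in
    if b then (if yb then s.2 else true) else (if yb then false else s.2)).

Definition bgt (x y : seq bool) : bool :=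
  let s := foldl (fun s b => gt_step b s) (y, false) x in
  foldl (fun r yb : bool => if yb then false else r) s.2 s.1.

Lemma bgt_val x y : bgt x y = (bval y < bval x).
Proof.
pose cmp (r : bool) (X Y : nat) : bool := if X == Y then r else Y < X.
have h2 r v : foldl (fun r yb : bool => if yb then false else r) r v = cmp r 0 (bval v).
  rewrite /cmp; elim: v r => //= b v IH r; rewrite IH.
  by case: b; case: (bval v) => [|k]; case: r.
have h1 r v : let s := foldl (fun s b => gt_step b s) (v, r) x in
    cmp s.2 0 (bval s.1) = cmp r (bval x) (bval v).
  elim: x r v => [|b x IH] r v //=; rewrite IH /cmp.
  have h (X Y : nat) (b2 : bool) :
      (if X == Y then (if b then (if b2 then r else true) else (if b2 then false else r))
       else Y < X) = (if b + X.*2 == b2 + Y.*2 then r else b2 + Y.*2 < b + X.*2).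
    by case: b; case: b2; case: r; case: (ltngtP X Y) => c; case: eqP => e; lia.
  by case: v => [|b2 v]; [exact: (h _ 0 false)|exact: h].
by rewrite /bgt h2 h1 /cmp; case: eqP => // ->; rewrite ltnn.
Qed.

Lemma Cmp_bgt (A : encType) (beta : A -> nat) f g : Cmp beta f -> Cmp beta g ->
  Cmp beta (fun a => bgt (f a) (g a)).
Proof.
apply: (Cmp_comp2 (h := bgt)); rewrite /bgt.
have h : FP (fun p : seq bool * seq bool => foldl (fun s b => gt_step b s) (p.2, false) p.1).
  apply: (Cmp_foldl_add (stp := fun _ b s => gt_step b s) (k := 1)); [by rewrite /gt_step; fp| |by fp|by fp].
  move=> a b [y c]; rewrite expn1 /bd /gt_step !sz_pair /=.
  set c1 := if _ then _ else _; clearbody c1; have := sz_bool_le c1.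
  have : sz (@behead bool y) <= sz y by rewrite -drop1; exact: (@sz_drop bool_encType).
  by have := sz_gt0 c; lia.
apply: (Cmp_foldl_add (stp := fun _ (b r : bool) => if b then false else r) (k := 1)); [by fp| |by fp|by fp].
move=> a [] r; last exact: leq_addr.
by apply: leq_trans (sz_bool_le false) _; rewrite expn1 /bd; have := sz_gt0 r; gen_sz; lia.
Qed.

Ltac fp_user ::= lazymatch goal with
  | |- Cmp _ (fun a => badd _ _) => apply: Cmp_badd
  | |- Cmp _ (fun a => bmul _ _) => apply: Cmp_bmul
  | |- Cmp _ (fun a => bgt _ _) => apply: Cmp_bgt
  end.

(* The pair (x, y) stands for the integer x - y, and a pair of such pairs for a
   Gaussian integer. *)
Definition zint := (seq bool * seq bool)%type.
Definition gint := (zint * zint)%type.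

Definition iadd (a b : seq bool * seq bool) := (badd a.1 b.1, badd a.2 b.2).
Definition ineg (a : seq bool * seq bool) := (a.2, a.1).
Definition imul (a b : seq bool * seq bool) :=
  (badd (bmul a.1 b.1) (bmul a.2 b.2), badd (bmul a.1 b.2) (bmul a.2 b.1)).
Definition gadd (a b : gint) : gint := (iadd a.1 b.1, iadd a.2 b.2).
Definition gneg (a : gint) : gint := (ineg a.1, ineg a.2).
Definition gconj (a : gint) : gint := (a.1, ineg a.2).
Definition gmul (a b : gint) : gint :=
  (iadd (imul a.1 b.1) (ineg (imul a.2 b.2)), iadd (imul a.1 b.2) (imul a.2 b.1)).
Definition gint0 : gint := (([::], [::]), ([::], [::])).
Definition gint1 : gint := (([:: true], [::]), ([::], [::])).

Section GaussianFP.
Variables (A : encType) (beta : A -> nat).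
Notation Z := (seq bool * seq bool)%type.
Notation G := (Z * Z)%type.

Lemma Cmp_iadd (f g : A -> Z) : Cmp beta f -> Cmp beta g -> Cmp beta (fun a => iadd (f a) (g a)).
Proof. by apply: (Cmp_comp2 (h := iadd)); rewrite /iadd; fp. Qed.

Lemma Cmp_ineg (f : A -> Z) : Cmp beta f -> Cmp beta (fun a => ineg (f a)).
Proof. by move=> hf; rewrite /ineg; fp. Qed.

Lemma Cmp_imul (f g : A -> Z) : Cmp beta f -> Cmp beta g -> Cmp beta (fun a => imul (f a) (g a)).
Proof. by apply: (Cmp_comp2 (h := imul)); rewrite /imul; fp. Qed.
End GaussianFP.

Ltac fp_user ::= lazymatch goal with
  | |- Cmp _ (fun a => badd _ _) => apply: Cmp_badd
  | |- Cmp _ (fun a => bmul _ _) => apply: Cmp_bmul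
  | |- Cmp _ (fun a => bgt _ _) => apply: Cmp_bgt
  | |- Cmp _ (fun a => iadd _ _) => apply: Cmp_iadd
  | |- Cmp _ (fun a => ineg _) => apply: Cmp_ineg
  | |- Cmp _ (fun a => imul _ _) => apply: Cmp_imul
  end.

Section GaussianFP2.
Variables (A : encType) (beta : A -> nat).
Notation G := ((seq bool * seq bool) * (seq bool * seq bool))%type.

Lemma Cmp_gadd (f g : A -> G) : Cmp beta f -> Cmp beta g -> Cmp beta (fun a => gadd (f a) (g a)).
Proof. by apply: (Cmp_comp2 (h := gadd)); rewrite /gadd; fp. Qed.

Lemma Cmp_gneg (f : A -> G) : Cmp beta f -> Cmp beta (fun a => gneg (f a)).
Proof. by move=> hf; rewrite /gneg; fp. Qed.

Lemma Cmp_gconj (f : A -> G) : Cmp beta f -> Cmp beta (fun a => gconj (f a)).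
Proof. by move=> hf; rewrite /gconj; fp. Qed.

Lemma Cmp_gmul (f g : A -> G) : Cmp beta f -> Cmp beta g -> Cmp beta (fun a => gmul (f a) (g a)).
Proof. by apply: (Cmp_comp2 (h := gmul)); rewrite /gmul; fp. Qed.
End GaussianFP2.

(** * Growth of the number of digits *)

Definition ilen (a : zint) := maxn (size a.1) (size a.2).
Definition glen (a : gint) := maxn (ilen a.1) (ilen a.2).

Lemma ilen_iadd a b L : ilen a <= L -> ilen b <= L -> ilen (iadd a b) <= L.+1.
Proof. by rewrite /ilen /= !size_badd; lia. Qed.

Lemma ilen_ineg a : ilen (ineg a) = ilen a.
Proof. by rewrite /ilen /= maxnC. Qed.

Lemma ilen_imul a b L : ilen a <= L -> ilen b <= L -> ilen (imul a b) <= (3 * L).+1.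
Proof.
rewrite /ilen /= !size_badd => h1 h2.
have := size_bmul a.1 b.1; have := size_bmul a.1 b.2.
by have := size_bmul a.2 b.1; have := size_bmul a.2 b.2; lia.
Qed.

Lemma glen_leE a L : (glen a <= L) = (ilen a.1 <= L) && (ilen a.2 <= L).
Proof. exact: geq_max. Qed.

Lemma glen_gadd a b L : glen a <= L -> glen b <= L -> glen (gadd a b) <= L.+1.
Proof.
rewrite !glen_leE => /andP [a1 a2] /andP [b1 b2].
by apply/andP; split; apply: ilen_iadd.
Qed.

Lemma glen_gneg a : glen (gneg a) = glen a.
Proof. by rewrite /glen /= !ilen_ineg. Qed.

Lemma glen_gconj a : glen (gconj a) = glen a.
Proof. by rewrite /glen /= ilen_ineg. Qed.

Lemma glen_gmul a b L : glen a <= L -> glen b <= L -> glen (gmul a b) <= (3 * L).+2.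
Proof.
rewrite !glen_leE => /andP [a1 a2] /andP [b1 b2].
by apply/andP; split; apply: ilen_iadd; rewrite ?ilen_ineg; apply: ilen_imul.
Qed.

Lemma sz_glen (a : gint) : glen a <= sz a <= 16 * glen a + 7.
Proof.
case: a => [[a b] [c d]]; rewrite /glen /ilen !sz_pair /=.
have := sz_bits a; have := sz_bits b; have := sz_bits c; have := sz_bits d.
gen_sz; lia.
Qed.

Definition gdot (a b : seq gint) : gint :=
  foldl (fun acc xy => gadd acc (gmul (gconj xy.1) xy.2)) gint0 (zip a b).

(* <a, a> b - <a, b> a: the Gram-Schmidt step without division, so that the
   vectors stay integral; the lengths of the entries grow by a constant factor
   per round. *)
Definition gproj (a b : seq gint) : seq gint :=
  [seq gadd (gmul (gdot a a) xy.1) (gneg (gmul (gdot a b) xy.2)) | xy <- zip b a].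

Definition ground (vs : seq (seq gint)) : seq (seq gint) :=
  [seq gproj (head [::] vs) b | b <- behead vs].

Definition gelim (n : nat) (vs : seq (seq gint)) : seq (seq gint) :=
  foldl (fun c _ => ground c) vs (units n).

Lemma gelimS n vs : gelim n.+1 vs = gelim n (ground vs).
Proof. by []. Qed.

Lemma gelimSr n vs : gelim n.+1 vs = ground (gelim n vs).
Proof. by elim: n vs => // n IH vs; rewrite gelimS IH. Qed.

Lemma glen_gdot a b L : all (fun c => glen c <= L) a -> all (fun c => glen c <= L) b ->
  glen (gdot a b) <= 3 * L + 2 + size (zip a b).
Proof.
move=> ha hb; rewrite /gdot.
have : all (fun xy : gint * gint => (glen xy.1 <= L) && (glen xy.2 <= L)) (zip a b).
  elim: a b ha hb => [|x a IH] [|y b] //= /andP [-> ha] /andP [-> hb] /=.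
  exact: IH.
suff h (l : seq (gint * gint)) K g : 3 * L + 2 <= K -> glen g <= K ->
    all (fun xy : gint * gint => (glen xy.1 <= L) && (glen xy.2 <= L)) l ->
    glen (foldl (fun acc xy => gadd acc (gmul (gconj xy.1) xy.2)) g l) <= K + size l.
  exact: h.
elim: l K g => [|[x y] l IH] K g hK hg /=; first by rewrite addn0.
move=> /andP [/andP [hx hy] hl]; rewrite -addSnnS; apply: IH => //; first exact: leqW.
apply: glen_gadd => //; apply: leq_trans (glen_gmul _ hy) _; first by rewrite glen_gconj.
by rewrite -addn2.
Qed.

Lemma all_glen_le (a : seq gint) : all (fun c => glen c <= sz a) a.
Proof.
elim: a => //= c a IH; rewrite sz_cons; apply/andP; split.
  by have /andP [+ _] := sz_glen c; gen_sz; lia.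
by apply: sub_all IH => d; gen_sz; lia.
Qed.

Lemma sz_grow (a : seq gint) S L : size a <= S -> all (fun c => glen c <= L) a ->
  sz a <= S * (16 * L + 8) + 1.
Proof.
move=> hS; have : sz a <= size a * (16 * L + 8) + 1 -> sz a <= S * (16 * L + 8) + 1.
  by move=> h; apply: leq_trans h _; rewrite leq_add2r leq_mul2r hS orbT.
move=> h ha; apply: h; elim: a ha {hS} => //= c a IH /andP [hc ha]; rewrite sz_cons.
by have := IH ha; have /andP [_] := sz_glen c; gen_sz; nia.
Qed.

Lemma all_take_sub T (P : pred T) i (s : seq T) : all P s -> all P (take i s).
Proof. by rewrite -{1}(cat_take_drop i s) all_cat => /andP []. Qed.

Section LinearAlgebraFP.
Variables (A : encType) (beta : A -> nat).
Notation G := ((seq bool * seq bool) * (seq bool * seq bool))%type.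

Lemma Cmp_gdot (f g : A -> seq G) : Cmp beta f -> Cmp beta g ->
  Cmp beta (fun a => gdot (f a) (g a)).
Proof.
apply: (Cmp_comp2 (h := gdot)); rewrite /gdot.
pose stp (v : seq G * seq G * (G * G) * G) := gadd v.2 (gmul (gconj v.1.2.1) v.1.2.2).
have hs : FP stp.
  by rewrite /stp; apply: Cmp_gadd; [fp|apply: Cmp_gmul; [apply: Cmp_gconj; fp|fp]].
apply: (Cmp_foldl hs (M := fun p => 16 * (4 * sz p + 2) + 7)); [by apply: (Cmp_zip gint0); fp|by fp| |].
  by pb; exact: pb_sz.
move=> [a b] i ile; set l := take i _.
have -> : l = zip (take i a) (take i b).
  by rewrite /l /=; elim: (a) (b) (i) => [|x a' IH] [|y b'] [|j] //=; rewrite IH.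
have le1 := glen_gdot (L := sz a + sz b) (a := take i a) (b := take i b).
have /andP [_ h] := sz_glen (gdot (take i a) (take i b)).
apply: leq_trans h _; rewrite leq_add2r leq_mul2l /=.
apply: leq_trans (le1 _ _) _.
- by apply: sub_all (all_take_sub i (all_glen_le a)) => c; gen_sz; lia.
- by apply: sub_all (all_take_sub i (all_glen_le b)) => c; gen_sz; lia.
have : size (zip (take i a) (take i b)) <= size a.
  by rewrite size_zip geq_min size_take_min geq_minr.
have := @size_le_sz _ a; rewrite sz_pair; gen_sz; lia.
Qed.
End LinearAlgebraFP.

Definition gbd (S L : nat) (vs : seq (seq gint)) : bool :=
  [&& size vs <= S, all (fun r => size r <= S) vs &
      all (all (fun c => glen c <= L)) vs].

(** The dot products have at most 3 L + 2 + S digits; the product with an entry has three times as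
    many plus 2, and the final sum one more. *)
Lemma gproj_bd S L a b : size a <= S -> all (fun c => glen c <= L) a ->
  all (fun c => glen c <= L) b ->
  all (fun c => glen c <= 9 * L + 3 * S + 9) (gproj a b).
Proof.
move=> hS ha hb; rewrite /gproj all_map.
have hX x y : size (zip x y) <= S -> all (fun c => glen c <= L) x -> all (fun c => glen c <= L) y ->
    glen (gdot x y) <= 3 * L + 2 + S.
  by move=> h hx hy; apply: leq_trans (glen_gdot hx hy) _; rewrite leq_add2l.
have hN : glen (gdot a a) <= 3 * L + 2 + S by apply: hX; rewrite // size_zip minnn.
have hd : glen (gdot a b) <= 3 * L + 2 + S by apply: hX; rewrite // size_zip geq_min hS.
have : all (fun xy : gint * gint => (glen xy.1 <= L) && (glen xy.2 <= L)) (zip b a).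
  elim: b a ha hb {hS hX hN hd} => [|x b IH] [|y a] //= /andP [-> ha] /andP [-> hb] /=.
  exact: IH.
apply: sub_all => -[x y] /andP [/= hx hy].
have e : 9 * L + 3 * S + 9 = (3 * (3 * L + 2 + S)).+3 by lia.
rewrite e; apply: glen_gadd; rewrite ?glen_gneg; apply: glen_gmul => //.
  by apply: leq_trans hx _; lia.
by apply: leq_trans hy _; lia.
Qed.

Lemma ground_bd S L vs : gbd S L vs -> gbd S (9 * L + 3 * S + 9) (ground vs).
Proof.
case: vs => [|a vs]; first by move=> /and3P [h _ _]; rewrite /gbd h.
rewrite /gbd /ground /= => /and3P [hS /andP [ha hvs] /andP [ga gvs]].
rewrite size_map (ltnW hS) !all_map /=; apply/andP; split.
  by apply: sub_all hvs => b /= hb; rewrite size_map size_zip geq_min hb.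
by apply: sub_all gvs => b gb; exact: gproj_bd.
Qed.

(** A round takes L to 9 L + 3 S + 9. Adding S + 1 to this gives 9 L + 4 S + 10 <= 10 (L + S + 1),
    so L + S + 1 grows at most tenfold per round. *)
Lemma gelim_bd S L n vs : gbd S L vs -> gbd S (10 ^ n * (L + S + 1)) (gelim n vs).
Proof.
move=> h; suff : exists2 L', L' + S + 1 <= 10 ^ n * (L + S + 1) & gbd S L' (gelim n vs).
  move=> [L' le' /and3P [h1 h2 h3]]; rewrite /gbd h1 h2 /=.
  by apply: sub_all h3 => r; apply: sub_all => c hc; apply: leq_trans hc _; lia.
elim: n => [|n [L' le' IH]]; first by exists L; rewrite // expn0 mul1n.
exists (9 * L' + 3 * S + 9); last by rewrite gelimSr ground_bd.
by rewrite expnS; lia.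
Qed.

Lemma gbd_sz (vs : seq (seq gint)) : gbd (sz vs) (sz vs) vs.
Proof.
rewrite /gbd; apply/and3P; split.
- exact: (@size_le_sz (seq_encType (prod_encType (prod_encType _ _) (prod_encType _ _)))).
- elim: vs => //= r vs IH; rewrite sz_cons; apply/andP; split.
    by have := @size_le_sz _ r; gen_sz; lia.
  by apply: sub_all IH => x; gen_sz; lia.
elim: vs => //= r vs IH; rewrite sz_cons; apply/andP; split.
  by apply: sub_all (all_glen_le r) => x; gen_sz; lia.
by apply: sub_all IH => x; apply: sub_all => c; gen_sz; lia.
Qed.

Lemma sz_gbd S L (vs : seq (seq gint)) : gbd S L vs ->
  sz vs <= S * (S * (16 * L + 8) + 2) + 1.
Proof.
move=> /and3P [h1 h2 h3].
have : sz vs <= size vs * (S * (16 * L + 8) + 2) + 1.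
  elim: vs h2 h3 {h1} => //= r vs IH /andP [hr hvs] /andP [gr gvs]; rewrite sz_cons.
  by have := IH hvs gvs; have := sz_grow hr gr; gen_sz; move: (16 * L + 8) => K; nia.
by move/leq_trans; apply; rewrite leq_add2r leq_mul2r h1 orbT.
Qed.

Ltac fp_user ::= lazymatch goal with
  | |- Cmp _ (fun a => badd _ _) => apply: Cmp_badd
  | |- Cmp _ (fun a => bmul _ _) => apply: Cmp_bmul
  | |- Cmp _ (fun a => bgt _ _) => apply: Cmp_bgt
  | |- Cmp _ (fun a => iadd _ _) => apply: Cmp_iadd
  | |- Cmp _ (fun a => ineg _) => apply: Cmp_ineg
  | |- Cmp _ (fun a => imul _ _) => apply: Cmp_imul
  | |- Cmp _ (fun a => gadd _ _) => apply: Cmp_gadd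
  | |- Cmp _ (fun a => gneg _) => apply: Cmp_gneg
  | |- Cmp _ (fun a => gconj _) => apply: Cmp_gconj
  | |- Cmp _ (fun a => gmul _ _) => apply: Cmp_gmul
  | |- Cmp _ (fun a => gdot _ _) => apply: Cmp_gdot
  end.

Section EliminationFP.
Variables (A : encType) (beta : A -> nat).
Notation G := ((seq bool * seq bool) * (seq bool * seq bool))%type.

Lemma Cmp_gproj (f g : A -> seq G) : Cmp beta f -> Cmp beta g ->
  Cmp beta (fun a => gproj (f a) (g a)).
Proof.
apply: (Cmp_comp2 (h := gproj)); rewrite /gproj.
apply: (Cmp_map (h := fun (p : seq G * seq G) (xy : G * G) =>
  gadd (gmul (gdot p.1 p.1) xy.1) (gneg (gmul (gdot p.1 p.2) xy.2)))); first by fp.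
by apply: (Cmp_zip gint0); fp.
Qed.

End EliminationFP.

Section EliminationFP2.
Variables (A : encType) (beta : A -> nat).
Notation G := ((seq bool * seq bool) * (seq bool * seq bool))%type.

Lemma FP_ground : FP (ground : seq (seq G) -> seq (seq G)).
Proof.
rewrite /ground.
apply: (Cmp_map (h := fun (p : seq (seq G)) (b : seq G) => gproj (head [::] p) b)); last by fp.
by apply: Cmp_gproj; fp.
Qed.

Lemma Cmp_gelim (n : A -> nat) (vs : A -> seq (seq G)) : Cmp beta n -> Cmp beta vs ->
  pb (bd beta) (fun a => 10 ^ n a) -> Cmp beta (fun a => gelim (n a) (vs a)).
Proof.
move=> hn hvs hb; have svs := Cmp_sz hvs.
pose stp (v : A * tree * seq (seq G)) := ground v.2.
have hs : FP stp by rewrite /stp; apply: (Cmp_comp FP_ground); fp.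
pose S a := sz (vs a); pose L a := 10 ^ n a * (S a + S a + 1).
apply: (Cmp_foldl hs (M := fun a => S a * (S a * (16 * L a + 8) + 2) + 1)); [by fp|by fp| |].
  by rewrite /L /S; pb.
move=> a i ile; rewrite /units take_nseq; last by rewrite size_nseq in ile.
rewrite -/(units i) -/(gelim i (vs a)) /stp; apply: sz_gbd.
have := gelim_bd i (gbd_sz (vs a)); rewrite size_nseq in ile.
rewrite -/(S a) => /and3P [h1 h2 h3]; rewrite /gbd h1 h2 /=.
apply: sub_all h3 => r; apply: sub_all => c hc; apply: leq_trans hc _.
by rewrite /L leq_mul2r leq_exp2l // ile orbT.
Qed.
End EliminationFP2.

(* The state consists of the flag that announces a bit, the current word and the
   list of the complete words, both reversed. *)
Definition dec_step (b : bool) (s : bool * seq bool * seq (seq bool)) :=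
  if s.1.1 then (false, b :: s.1.2, s.2)
  else if b then (true, s.1.2, s.2) else (false, [::], rev s.1.2 :: s.2).

Definition decode (w : seq bool) : seq (seq bool) :=
  rev (foldl (fun s b => dec_step b s) (false, [::], [::]) w).2.

Lemma decode_encode ws : decode (encode ws) = ws.
Proof.
rewrite /decode /encode.
have hw w c d : foldl (fun s b => dec_step b s) (false, c, d)
    (rcons (flatten [seq [:: true; b] | b <- w]) false) = (false, [::], rev (catrev w c) :: d).
  by elim: w c => //= b w IH c; rewrite IH.
have h d : foldl (fun s b => dec_step b s) (false, [::], d)
    (flatten [seq rcons (flatten [seq [:: true; b] | b <- w]) false | w <- ws])
    = (false, [::], catrev ws d).
  by elim: ws d => //= w ws IH d; rewrite foldl_cat hw IH -/(rev w) revK.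
by rewrite h -/(rev ws) revK.
Qed.

Lemma sz_rev (A : encType) (s : seq A) : sz (rev s) = sz s.
Proof.
have h (u v : seq A) : sz (catrev u v) = sz u + sz v - 1.
  elim: u v => [|x u IH] v; first by rewrite sz_nil; gen_sz; lia.
  by rewrite /= IH !sz_cons; have := sz_gt0 v; gen_sz; lia.
by rewrite /rev h sz_nil; lia.
Qed.

Lemma Cmp_decode (A : encType) (beta : A -> nat) f : Cmp beta f ->
  Cmp beta (fun a => decode (f a)).
Proof.
apply: (Cmp_comp (g := decode)); rewrite /decode; apply: Cmp_rev; apply: Cmp_snd.
apply: (Cmp_foldl_add (stp := fun (_ : seq bool) b s => dec_step b s) (k := 1));
  [by rewrite /dec_step; fp| |by fp|by fp].
move=> a b [[f1 c] d]; rewrite expn1 /bd /dec_step.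
case: f1; [|case: b]; rewrite !sz_pair ?sz_cons ?sz_rev ?sz_nil.
- have := sz_bool_le b; have -> : sz false = 1 by [].
  by have -> : sz true = 3 by []; gen_sz; lia.
- by have -> : sz false = 1 by []; have -> : sz true = 3 by []; gen_sz; lia.
by have -> : sz false = 1 by []; gen_sz; lia.
Qed.

Definition zint_of (w : seq bool) : zint :=
  if head false w then ([::], behead w) else (behead w, [::]).

Definition pair_step (a : zint) (s : seq zint * seq gint) :=
  if full s.1 then ([::], (head ([::], [::]) s.1, a) :: s.2) else ([:: a], s.2).

Definition gints_of (ws : seq (seq bool)) : seq gint :=
  rev (foldl (fun s w => pair_step (zint_of w) s) ([::], [::]) ws).2.

Lemma gints_of_flatten (l : seq (seq bool * seq bool)) :
  gints_of (flatten [seq [:: x.1; x.2] | x <- l]) = [seq (zint_of x.1, zint_of x.2) | x <- l].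
Proof.
rewrite /gints_of.
have h d : foldl (fun s w => pair_step (zint_of w) s) ([::], d) (flatten [seq [:: x.1; x.2] | x <- l])
    = ([::], catrev [seq (zint_of x.1, zint_of x.2) | x <- l] d).
  by elim: l d => //= x l IH d; rewrite IH.
by rewrite h -/(rev _) revK.
Qed.

Definition rows_of (n m : nat) (gs : seq gint) : seq (seq gint) :=
  rev (foldl (fun s _ => (drop m s.1, take m s.1 :: s.2)) (gs, [::]) (units n)).2.

Lemma rows_of_flatten m (rs : seq (seq gint)) : all (fun r => size r == m) rs ->
  rows_of (size rs) m (flatten rs) = rs.
Proof.
rewrite /rows_of => h.
have e d t : (foldl (fun (s : seq gint * seq (seq gint)) (_ : tree) => (drop m s.1, take m s.1 :: s.2))
    (flatten rs ++ t, d) (units (size rs))).2 = catrev rs d.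
  elim: rs h d => //= r rs IH /andP [/eqP hr h] d.
  by rewrite -catA drop_size_cat // take_size_cat // IH.
by rewrite -[flatten rs]cats0 e -/(rev _) revK.
Qed.

Section DecisionFP.
Variables (A : encType) (beta : A -> nat).
Notation G := ((seq bool * seq bool) * (seq bool * seq bool))%type.

Lemma Cmp_gints_of (f : A -> seq (seq bool)) : Cmp beta f -> Cmp beta (fun a => gints_of (f a)).
Proof.
apply: (Cmp_comp (g := gints_of)); rewrite /gints_of; apply: Cmp_rev; apply: Cmp_snd.
apply: (Cmp_foldl_add (stp := fun (_ : seq (seq bool)) w s => pair_step (zint_of w) s) (k := 1));
  [| |by fp|by fp].
  have h : FP (fun v : seq (seq bool) * seq bool * (seq (seq bool * seq bool) * seq G) => zint_of v.1.2).
    rewrite /zint_of; fp.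
  by rewrite /pair_step; fp.
move=> a b [u v]; rewrite expn1 /bd /pair_step.
have hz : sz (zint_of b) <= sz b + 2.
  rewrite /zint_of; case: b => [|[] b] //=; rewrite sz_pair !sz_cons ?sz_nil; gen_sz; lia.
have := sz_gt0 a; move: hz; case: u => [|x u] /=; rewrite !sz_pair !sz_cons ?sz_pair ?sz_nil; gen_sz; lia.
Qed.

Lemma Cmp_rows_of (n m : A -> nat) (f : A -> seq G) : Cmp beta n -> Cmp beta m -> Cmp beta f ->
  Cmp beta (fun a => rows_of (n a) (m a) (f a)).
Proof.
apply: (Cmp_comp3 (h := rows_of)); rewrite /rows_of; apply: Cmp_rev; apply: Cmp_snd.
apply: (Cmp_foldl_add (stp := fun (p : nat * nat * seq G) (_ : tree) (s : seq G * seq (seq G)) =>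
  (drop p.1.2 s.1, take p.1.2 s.1 :: s.2)) (k := 1)); [by fp| |by fp|by fp].
move=> p b [u v]; rewrite expn1 /bd !sz_pair sz_cons /=.
have h (B : encType) (s : seq B) i : sz (take i s) + sz (drop i s) = sz s + 1.
  elim: s i => // x s IH [|i] /=; rewrite !sz_cons ?sz_nil; first by gen_sz; lia.
  by have := IH i; gen_sz; lia.
by have := h _ u p.1.2; have := sz_gt0 p; gen_sz; lia.
Qed.
End DecisionFP.

(** * The instance and its circuit *)

Definition vertices (n p : nat) : seq (nat * nat) :=
  [seq (i, n + (i * p + a)) | i <- iota 0 n, a <- iota 0 p].

(* The pairs of modes that must not be occupied together: two vertices of one
   colour, two nonadjacent vertices, or one of the first n modes and a vertex. *)
Definition bad_pairs (n p : nat) (bits : seq bool) : seq (nat * nat) :=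
  [seq (x.1.1.2, x.1.2.2) | x <- [seq x <- zip [seq (u, v) | u <- vertices n p, v <- vertices n p] bits
     | ~~ (x.1.1.2 == x.1.2.2) && ((x.1.1.1 == x.1.2.1) || ~~ x.2)]]
  ++ [seq (i, v.2) | i <- iota 0 n, v <- vertices n p].

(** [ok] is the index of the last wire so far, which carries the current conjunction. The NAND of
    the pair goes to the next wire, and two further NAND gates form its conjunction with [ok]. *)
Fixpoint chain (ok : nat) (l : seq (nat * nat)) : seq (nat * nat) :=
  if l is x :: l' then [:: x; (ok, ok.+1); (ok.+2, ok.+2)] ++ chain ok.+3 l' else [::].

Definition chain_step (x : nat * nat) (s : nat * seq (nat * nat)) :=
  (s.1.+3, [:: (s.1.+2, s.1.+2), (s.1, s.1.+1), x & s.2]).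

Lemma chain_foldl ok l :
  chain ok l = rev (foldl (fun s x => chain_step x s) (ok, [::]) l).2.
Proof.
have h k d : (foldl (fun s x => chain_step x s) (k, d) l).2 = catrev (chain k l) d.
  by elim: l k d => //= x l IH k d; rewrite IH.
by rewrite h -/(rev _) revK.
Qed.

(* Wires m to m + 3 carry ~ x_0, true, false and true. From m + 3 on, [chain]
   accumulates the conjunction [ok] of the negated bad pairs, and the last gate
   computes ok && ~~ x_0. *)
Definition instance_gates (m : nat) (l : seq (nat * nat)) : seq (nat * nat) :=
  let ok := m.+3 + 3 * size l in
  [:: (0, 0); (0, m); (m.+1, m.+1); (m.+2, m.+2)] ++ chain m.+3 l
  ++ [:: (ok, 0); (ok, ok.+1); (ok.+2, ok.+2)].

(* The sign bit is false and the digits are ok followed by t copies of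
   ok && ~~ x_0: the amplitude is 1 on the set of the first n modes (where x_0
   holds) and 2 ^ t.+1 - 1 on the sets of vertices of cliques. *)
Definition instance_wires (t m : nat) (l : seq (nat * nat)) : seq nat :=
  let ok := m.+3 + 3 * size l in [:: m.+2, ok & nseq t ok.+3].

Definition instance_circuit (t m : nat) (l : seq (nat * nat)) : circuit :=
  Circuit (instance_gates m l) (instance_wires t m l) [::].

Definition encode_nats (l : seq nat) : seq bool :=
  flatten [seq flatten (nseq k [:: true; true]) ++ [:: false] | k <- l].

Lemma encode_natsE l : encode_nats l = encode [seq unary k | k <- l].
Proof.
rewrite /encode_nats /encode; elim: l => //= k l ->; congr (_ ++ _).
by rewrite cats1; congr rcons; elim: k => //= k ->.
Qed.

Definition instance_bits (t n m : nat) (l : seq (nat * nat)) : seq bool :=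
  let gs := instance_gates m l in
  let ws := instance_wires t m l in
  encode_nats ([:: n; m; size gs] ++ flatten [seq [:: g.1; g.2] | g <- gs] ++
    size ws :: ws ++ [:: 0]).

Lemma instance_bitsE t n m l :
  instance_bits t n m l = encode_instance n m (instance_circuit t m l).
Proof.
rewrite /instance_bits /encode_instance /instance_circuit.
move: (instance_gates m l) (instance_wires t m l) => gs ws; rewrite encode_natsE /=.
by rewrite !map_cat map_flatten -map_comp /= map_cat.
Qed.

Definition pre (t : nat) (w : seq bool) : seq bool * (nat * nat) :=
  let ws := decode w in
  let n := size (head [::] ws) in
  let p := size (head [::] (behead ws)) in
  let m := n + n * p in
  (instance_bits t n m (bad_pairs n p (head [::] (behead (behead ws)))), (n, m)).

Section PreFP.
Variables (A : encType) (beta : A -> nat).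

Lemma Cmp_vertices (n p : A -> nat) : Cmp beta n -> Cmp beta p ->
  Cmp beta (fun a => vertices (n a) (p a)).
Proof. by apply: (Cmp_comp2 (h := vertices)); rewrite /vertices; fp. Qed.

Lemma Cmp_chain (ok : A -> nat) (l : A -> seq (nat * nat)) : Cmp beta ok -> Cmp beta l ->
  Cmp beta (fun a => chain (ok a) (l a)).
Proof.
apply: (Cmp_comp2 (h := chain)).
apply: (Cmp_ext (f := fun p => rev (foldl (fun s x => chain_step x s) (p.1, [::]) p.2).2)).
  by move=> p; rewrite chain_foldl.
apply: Cmp_rev; apply: Cmp_snd.
pose stp (v : nat * seq (nat * nat) * (nat * nat) * (nat * seq (nat * nat))) := chain_step v.1.2 v.2.
have hs : FP stp by rewrite /stp /chain_step; fp.
(* The new gates contain wire numbers in unary, taken from the accumulator, so [Cmp_foldl_add] does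
   not apply. The counter stays below the initial one plus three per pair, which gives a quadratic
   bound. *)
apply: (Cmp_foldl hs (M := fun p => 40 * (sz p + 1) ^ 2)); [by fp|by fp| |].
  by pb; exact: pb_sz.
move=> [k0 l0] i ile; rewrite /stp /=.
have h (u : seq (nat * nat)) k d K : k + 3 * size u <= K ->
    sz (foldl (fun s x => chain_step x s) (k, d) u) <= sz u + sz d + size u * (8 * K + 20) + 2 * K + 3.
  elim: u k d => [|x u IH] k d hk.
    rewrite /= sz_pair sz_nat; move: hk; rewrite muln0 addn0; gen_sz; lia.
  apply: leq_trans (IH _ _ _) _; first by move: hk => /=; lia.
  rewrite /= !sz_cons !sz_pair !sz_nat; move: hk => /=.
  move: (sz u) (sz d) (sz x) => q1 q2 q3; move: (size u) => q4; nia.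
have hi := h (take i l0) k0 [::] (sz (k0, l0) * 3).
apply: leq_trans (hi _) _.
  rewrite sz_pair sz_nat size_take; have := @size_le_sz _ l0; case: ltnP; gen_sz; lia.
have := @sz_take _ l0 i.
have : size (take i l0) <= sz l0.
  by rewrite size_take; have := @size_le_sz _ l0; case: ltnP; gen_sz; lia.
rewrite sz_nil sz_pair sz_nat; gen_sz => *; nia.
Qed.

Lemma Cmp_encode_nats (l : A -> seq nat) : Cmp beta l -> Cmp beta (fun a => encode_nats (l a)).
Proof. by apply: (Cmp_comp (g := encode_nats)); rewrite /encode_nats; fp. Qed.

End PreFP.

Ltac fp_user ::= lazymatch goal with
  | |- Cmp _ (fun a => vertices _ _) => apply: Cmp_vertices
  | |- Cmp _ (fun a => chain _ _) => apply: Cmp_chain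
  | |- Cmp _ (fun a => encode_nats _) => apply: Cmp_encode_nats
  | |- Cmp _ (fun a => decode _) => apply: Cmp_decode
  | |- Cmp _ (fun a => seq.zip _ _) => refine (Cmp_zip (false : bool_encType) _ _)
  end.

Section PreFP2.
Variables (A : encType) (beta : A -> nat).

Lemma Cmp_bad_pairs (n p : A -> nat) (b : A -> seq bool) : Cmp beta n -> Cmp beta p ->
  Cmp beta b -> Cmp beta (fun a => bad_pairs (n a) (p a) (b a)).
Proof.
apply: (Cmp_comp3 (h := bad_pairs)); rewrite /bad_pairs; fp.
Qed.

Lemma Cmp_instance_gates (m : A -> nat) (l : A -> seq (nat * nat)) : Cmp beta m -> Cmp beta l ->
  Cmp beta (fun a => instance_gates (m a) (l a)).
Proof. by apply: (Cmp_comp2 (h := instance_gates)); rewrite /instance_gates; fp. Qed.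

Lemma Cmp_instance_wires t (m : A -> nat) (l : A -> seq (nat * nat)) : Cmp beta m -> Cmp beta l ->
  Cmp beta (fun a => instance_wires t (m a) (l a)).
Proof. by apply: (Cmp_comp2 (h := instance_wires t)); rewrite /instance_wires; fp. Qed.
End PreFP2.

Ltac fp_user ::= lazymatch goal with
  | |- Cmp _ (fun a => instance_gates _ _) => apply: Cmp_instance_gates
  | |- Cmp _ (fun a => instance_wires _ _ _) => apply: Cmp_instance_wires
  | |- Cmp _ (fun a => bad_pairs _ _ _) => apply: Cmp_bad_pairs
  | |- Cmp _ (fun a => encode_nats _) => apply: Cmp_encode_nats
  | |- Cmp _ (fun a => decode _) => apply: Cmp_decode
  end.

Lemma FP_pre t : FP (pre t).
Proof.
have h : FP (fun v : nat * nat * seq (nat * nat) => instance_bits t v.1.1 v.1.2 v.2).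
  by rewrite /instance_bits; fp.
rewrite /pre; apply: Cmp_pair; last by fp.
by apply: (Cmp_comp3 (h := instance_bits t)); fp.
Qed.

Definition eval_gates (vs : seq bool) (gs : seq (nat * nat)) : seq bool :=
  foldl (fun vs g => rcons vs (~~ (nth false vs g.1 && nth false vs g.2))) vs gs.

Lemma eval_gates_cat vs g1 g2 : eval_gates vs (g1 ++ g2) = eval_gates (eval_gates vs g1) g2.
Proof. exact: foldl_cat. Qed.

Lemma size_eval_gates vs gs : size (eval_gates vs gs) = size vs + size gs.
Proof. by elim: gs vs => [|g gs IH] vs /=; rewrite ?addn0 // IH size_rcons addSnnS. Qed.

Lemma nth_eval_gates vs gs j : j < size vs -> nth false (eval_gates vs gs) j = nth false vs j.
Proof.
elim: gs vs => [|g gs IH] vs //= hj; rewrite IH ?nth_rcons ?hj // size_rcons.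
exact: leqW.
Qed.

Lemma size_chain ok l : size (chain ok l) = 3 * size l.
Proof. by elim: l ok => //= x l IH ok; rewrite IH; lia. Qed.

Lemma eval_chain (m : nat) (inI : nat -> bool) ok vs l b :
  size vs = ok.+1 -> m <= ok -> nth false vs ok = b ->
  (forall j, j < m -> nth false vs j = inI j) ->
  all (fun x : nat * nat => (x.1 < m) && (x.2 < m)) l ->
  nth false (eval_gates vs (chain ok l)) (ok + 3 * size l) =
    b && all (fun x : nat * nat => ~~ (inI x.1 && inI x.2)) l.
Proof.
elim: l ok vs b => [|[u v] l IH] ok vs b svs mok hb hin /=; first by rewrite addn0 andbT.
move=> /andP [/andP [hu hv] hl].
have -> : ok + 3 * (size l).+1 = ok.+3 + 3 * size l by lia.
set vs1 := rcons vs _; set vs2 := rcons vs1 _; set vs3 := rcons vs2 _.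
have s1 : size vs1 = ok.+2 by rewrite size_rcons svs.
have s2 : size vs2 = ok.+3 by rewrite size_rcons s1.
have n1 j : nth false vs1 j = if j == ok.+1 then ~~ (inI u && inI v) else nth false vs j.
  rewrite /vs1 nth_rcons svs; case: (ltngtP j ok.+1) => h //; last by rewrite !hin.
  by rewrite nth_default // svs ltnW.
have n2 : nth false vs2 ok.+2 = ~~ (b && ~~ (inI u && inI v)).
  by rewrite /vs2 nth_rcons s1 ltnn eqxx !n1 eqxx (ltn_eqF (ltnSn ok)) hb.
have n3 : nth false vs3 ok.+3 = b && ~~ (inI u && inI v).
  by rewrite /vs3 nth_rcons s2 ltnn eqxx n2 andbb negbK.
rewrite (IH _ _ _ _ _ n3) //; first by rewrite andbA.
- by rewrite size_rcons s2.
- by lia.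
move=> j hj; rewrite /vs3 nth_rcons s2 ifT; last by lia.
rewrite /vs2 nth_rcons s1 ifT; last by lia.
by rewrite n1 ifN ?hin //; lia.
Qed.

Section CircuitValue.
Variables (t m : nat) (l : seq (nat * nat)) (x : seq bool).
Hypotheses (m_gt0 : 0 < m) (size_x : size x = m)
  (hl : all (fun u : nat * nat => (u.1 < m) && (u.2 < m)) l).

Let no_pair := all (fun u : nat * nat => ~~ (nth false x u.1 && nth false x u.2)) l.

Lemma instance_wire_values :
  let vs := eval_gates x (instance_gates m l) in
  [/\ nth false vs m.+2 = false, nth false vs (m.+3 + 3 * size l) = no_pair &
      nth false vs (m.+3 + 3 * size l).+3 = no_pair && ~~ nth false x 0].
Proof.
rewrite /instance_gates eval_gates_cat; set vs0 := eval_gates x _.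
set ok := m.+3 + _; rewrite eval_gates_cat; set vs1 := eval_gates vs0 _.
have s0 : size vs0 = m.+4 by rewrite size_eval_gates size_x addn4.
have s1 : size vs1 = ok.+1 by rewrite size_eval_gates s0 size_chain.
have e0 j : j < m -> nth false vs0 j = nth false x j.
  by move=> hj; rewrite nth_eval_gates ?size_x.
have [f0 ok0] : nth false vs0 m.+2 = false /\ nth false vs0 m.+3 = true.
  rewrite /vs0 /= !nth_rcons !size_rcons size_x !ltnn !eqxx.
  by rewrite ?(ltn_eqF (ltnSn _)) ?ltnSn m_gt0 ?ltnS ?leqnn ?leqnSn /=; case: (nth false x 0).
have ok1 : nth false vs1 ok = no_pair.
  by rewrite (eval_chain _ _ ok0 e0 hl) //; lia.
split.
- rewrite nth_eval_gates; last by rewrite s1 /ok; lia.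
  by rewrite nth_eval_gates // s0; lia.
- by rewrite nth_eval_gates ?s1.
have x0 : nth false vs1 0 = nth false x 0.
  by rewrite nth_eval_gates ?s0 // e0.
rewrite /= !nth_rcons !size_rcons s1.
have l1 : ok < ok.+2 by lia.
rewrite ?ltnn ?eqxx ?ltnSn ?l1 ?x0 ?ok1 /=.
by case: no_pair; case: (nth false x 0).
Qed.
End CircuitValue.

(** * The decision *)

(** The unit vector of mode 0 is appended below the n output rows. Each round consumes the top row,
    so after n rounds only the transform of the unit vector is left. *)
Definition last_vector (n m : nat) (out : seq bool) : seq gint :=
  head [::] (gelim n (rows_of n m (gints_of (decode out)) ++ [:: gint1 :: nseq m.-1 gint0])).

(* Let e_0 = p + o with p in the span of the orbitals and o orthogonal to it, and
   let w be a multiple of o. Since o_0 = |o|^2, one has |o|^2 = |w_0|^2 / |w|^2;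
   the test is 2 |w_0|^2 > |w|^2. *)
Definition decide_bits (w : seq gint) : bool :=
  let x := gmul (gconj (head gint0 w)) (head gint0 w) in let y := gdot w w in
  bgt (badd (badd x.1.1 x.1.1) y.1.2) (badd (badd x.1.2 x.1.2) y.1.1).

Definition decision (a : nat * nat * seq bool) : seq bool :=
  [:: decide_bits (last_vector a.1.1 a.1.2 a.2)].

Ltac fp_user ::= lazymatch goal with
  | |- Cmp _ (fun a => badd _ _) => apply: Cmp_badd
  | |- Cmp _ (fun a => bgt _ _) => apply: Cmp_bgt
  | |- Cmp _ (fun a => gconj _) => apply: Cmp_gconj
  | |- Cmp _ (fun a => gmul _ _) => apply: Cmp_gmul
  | |- Cmp _ (fun a => gdot _ _) => apply: Cmp_gdot
  | |- Cmp _ (fun a => rows_of _ _ _) => apply: Cmp_rows_of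
  | |- Cmp _ (fun a => gints_of _) => apply: Cmp_gints_of
  | |- Cmp _ (fun a => decode _) => apply: Cmp_decode
  end.

Lemma FP_decide_bits :
  FP (decide_bits : seq ((seq bool * seq bool) * (seq bool * seq bool)) -> bool).
Proof. by rewrite /decide_bits; fp. Qed.

Lemma Cmp_decision : Cmp (fun a : nat * nat * seq bool => 10 ^ a.1.1) decision.
Proof.
rewrite /decision; apply: Cmp_cons; last by fp.
apply: (Cmp_comp FP_decide_bits); rewrite /last_vector; apply: Cmp_head.
by apply: Cmp_gelim; [fp|fp|exact: pb_beta].
Qed.

Import Order.TTheory GRing.Theory Num.Theory.

(** The t0 + u coins around the middle block are free, and concatenation is injective: each good
    block yields 2 ^ (t0 + u) good strings. *)
Lemma card_middle t0 T1 u (Q : pred (seq bool)) (Q' : pred ((t0 + (T1 + u)).-tuple bool)) :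
  (forall r : (t0 + (T1 + u)).-tuple bool, Q (take T1 (drop t0 r)) -> Q' r) ->
  2 ^ (t0 + u) * #|[pred r : T1.-tuple bool | Q r]| <= #|Q'|.
Proof.
move=> h.
pose D := [pred x : t0.-tuple bool * T1.-tuple bool * u.-tuple bool | Q x.1.2].
pose f (x : t0.-tuple bool * T1.-tuple bool * u.-tuple bool) :=
  [tuple of x.1.1 ++ (x.1.2 ++ x.2)].
have f_inj : injective f.
  move=> [[a b] c] [[a' b'] c'] /(congr1 val) /= /eqP.
  rewrite eqseq_cat ?size_tuple // => /andP [/eqP ea].
  rewrite eqseq_cat ?size_tuple // => /andP [/eqP eb /eqP ec].
  by rewrite (val_inj ea) (val_inj eb) (val_inj ec).
have fQ : {subset [set f x | x in D] <= Q'}.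
  move=> r /imsetP [[[a b] c] /= hx ->]; apply: h => /=.
  by rewrite drop_size_cat ?size_tuple // take_size_cat ?size_tuple.
have cD : #|D| = 2 ^ (t0 + u) * #|[pred r : T1.-tuple bool | Q r]|.
  pose E := [predX [predX predT & [pred r : T1.-tuple bool | Q r]] & predT]
    : pred (t0.-tuple bool * T1.-tuple bool * u.-tuple bool).
  have -> : #|D| = #|E| by apply: eq_card => -[[a b] c]; rewrite !inE andbT.
  rewrite /E !cardX !card_tuple card_bool expnD.
  by rewrite mulnAC -mulnA mulnC.
rewrite -cD -(card_imset _ f_inj); apply: subset_leq_card; apply/fintype.subsetP; exact: fQ.
Qed.

(** The block of coins on which A runs is uniformly distributed among the coins of B, so B succeeds
    at least as often as A. *)
Lemma prob_driver (R : realType) (A B : prog) w w' T1 T t0 (Q P : seq bool -> Prop) :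
  t0 + T1 <= T ->
  (forall r, size r = T -> Q (output (run A w (take T1 (drop t0 r)))) ->
     P (output (run B w' r))) ->
  (prob R A w T1 Q <= prob R B w' T P)%R.
Proof.
move=> le h; rewrite /prob.
have [u eu] : exists u, T = t0 + (T1 + u) by exists (T - (t0 + T1)); lia.
subst T.
rewrite ler_pdivrMr ?ltr0n ?expn_gt0 // mulrAC ler_pdivlMr ?ltr0n ?expn_gt0 //.
rewrite -!natrM ler_nat [X in _ <= X]mulnC.
have -> : 2 ^ (t0 + (T1 + u)) = 2 ^ T1 * 2 ^ (t0 + u) by rewrite -expnD addnCA.
rewrite mulnC -mulnA leq_mul2l; apply/orP; right.
pose Qb := [pred r : seq bool | `[< Q (output (run A w r)) >]].
apply: (@card_middle t0 T1 u Qb).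
move=> r /asboolP hq; rewrite inE; apply/asboolP; apply: h => //.
by rewrite size_tuple.
Qed.

Local Open Scope ring_scope.

(** * Creation and annihilation *)

Section Fock.
Variables (R : realType) (m : nat).
Notation C := (R[i])%type.
Implicit Types (phi psi : fock R m) (I : {set 'I_m}) (u v w : 'rV[R[i]]_m).

(** The sign that [cdag] picks up by passing the occupied modes below j; the annihilator uses the
    same one. *)
Definition sg (j : 'I_m) (I : {set 'I_m}) : R[i] := (-1) ^+ #|[set i in I | (i < j)%N]|.

Definition ann (j : 'I_m) (psi : fock R m) : fock R m :=
  [ffun I : {set 'I_m} => if j \in I then 0 else sg j I * psi (j |: I)].

(** Antilinear in [v]: the conjugates make it the adjoint of [create v]. *)
Definition annv (v : 'rV[R[i]]_m) (psi : fock R m) : fock R m :=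
  [ffun I => \sum_j (v 0 j)^* * ann j psi I].

Definition ip (u v : 'rV[R[i]]_m) : R[i] := \sum_j (u 0 j)^* * v 0 j.

Lemma cdagE j psi I : cdag j psi I = if j \in I then sg j I * psi (I :\ j) else 0.
Proof. by rewrite ffunE. Qed.

Lemma sgU j k I : k \notin I -> sg j (k |: I) = (-1) ^+ (k < j)%N * sg j I.
Proof.
move=> kI; rewrite /sg -exprD; congr (_ ^+ _).
case: (boolP (k < j)%N) => kj.
  have -> : [set i in k |: I | (i < j)%N] = k |: [set i in I | (i < j)%N].
    apply/finset.setP => i; rewrite !inE; case: eqVneq => [->|] //=.
  by rewrite finset.cardsU1 inE (negPf kI).
congr #|pred_of_set _|; apply/finset.setP => i; rewrite !inE.
by case: eqVneq => [->|] //=; rewrite (negPf kj) andbF.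
Qed.

Lemma sgD j k I : k \in I -> sg j (I :\ k) = (-1) ^+ (k < j)%N * sg j I.
Proof.
move=> kI; rewrite -{2}(finset.setD1K kI) sgU ?finset.setD11 //.
by rewrite mulrA -expr2 sqrr_sign mul1r.
Qed.

Lemma sg_sq j I : sg j I * sg j I = 1.
Proof. by rewrite /sg -expr2 sqrr_sign. Qed.

Lemma conj_sg j I : (sg j I)^* = sg j I.
Proof. by rewrite /sg rmorphXn rmorphN1. Qed.

(** For j = k exactly one of the two terms survives, according to whether the mode is occupied. For
    j <> k each product sees one sign after the other mode has changed; as exactly one of k < j and
    j < k holds, the terms are opposite. *)
Lemma car j k psi I :
  ann j (cdag k psi) I + cdag k (ann j psi) I = (j == k)%:R * psi I.
Proof.
rewrite !ffunE -!/(sg _ _) !inE; case: (eqVneq j k) => [->|jk].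
  case: (boolP (k \in I)) => kI.
    by rewrite /= add0r sgD // ltnn !mul1r mulrA sg_sq finset.setD1K // mul1r.
  by rewrite /= addr0 sgU // ltnn !mul1r mulrA sg_sq finset.setU1K // mul1r.
rewrite /= mul0r.
case: (boolP (j \in I)) => jI; case: (boolP (k \in I)) => kI;
  rewrite /= ?mulr0 ?addr0 ?add0r ?mulr0 //.
have -> : (j |: I) :\ k = j |: (I :\ k).
  by apply/finset.setP => i; rewrite !inE; case: (eqVneq i j) => [->|]; rewrite ?jk.
rewrite sgU // sgD //; move: (psi _ : R[i]) (sg j I) (sg k I) => x a b.
case: (ltngtP j k) => [| |/val_inj e]; last by rewrite e eqxx in jk.
all: by move=> _; rewrite ?expr1 ?expr0; ring.
Qed.

Lemma cdagC j k psi I : cdag j (cdag k psi) I = - cdag k (cdag j psi) I.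
Proof.
rewrite !ffunE -!/(sg _ _) !inE; case: (eqVneq j k) => [->|jk].
  by case: ifP => _; rewrite ?mulr0 oppr0.
rewrite /=.
case: (boolP (j \in I)) => jI; case: (boolP (k \in I)) => kI;
  rewrite /= ?mulr0 ?oppr0 //.
have -> : I :\ k :\ j = I :\ j :\ k.
  by apply/finset.setP => i; rewrite !inE andbCA.
rewrite !sgD //; move: (psi _ : R[i]) (sg j I) (sg k I) => x a b.
case: (ltngtP j k) => [| |/val_inj e]; last by rewrite e eqxx in jk.
all: by move=> _; rewrite ?expr1 ?expr0; ring.
Qed.

Lemma ann_create j v psi I :
  ann j (create v psi) I = \sum_k v 0 k * ann j (cdag k psi) I.
Proof.
rewrite ffunE; case: ifP => jI.
  by rewrite big1 // => k _; rewrite [ann _ _ _]ffunE jI mulr0.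
rewrite ffunE mulr_sumr; apply: eq_bigr => k _.
by rewrite [ann _ _ _]ffunE jI mulrCA.
Qed.

Lemma cdag_annv k v psi I :
  cdag k (annv v psi) I = \sum_j (v 0 j)^* * cdag k (ann j psi) I.
Proof.
rewrite cdagE; case: ifP => kI.
  rewrite ffunE mulr_sumr; apply: eq_bigr => j _.
  by rewrite cdagE kI mulrCA.
by rewrite big1 // => j _; rewrite cdagE kI mulr0.
Qed.

Lemma cdag_create k v psi I :
  cdag k (create v psi) I = \sum_j v 0 j * cdag k (cdag j psi) I.
Proof.
rewrite cdagE; case: ifP => kI.
  rewrite ffunE mulr_sumr; apply: eq_bigr => j _.
  by rewrite [cdag k (cdag j psi) I]cdagE kI mulrCA.
by rewrite big1 // => j _; rewrite [cdag k (cdag j psi) I]cdagE kI mulr0.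
Qed.

Lemma car_vec w v psi I :
  annv w (create v psi) I + create v (annv w psi) I = ip w v * psi I.
Proof.
have -> : annv w (create v psi) I =
    \sum_j \sum_k (w 0 j)^* * v 0 k * ann j (cdag k psi) I.
  rewrite ffunE; apply: eq_bigr => j _; rewrite ann_create mulr_sumr.
  by apply: eq_bigr => k _; rewrite mulrA.
have -> : create v (annv w psi) I =
    \sum_j \sum_k (w 0 j)^* * v 0 k * cdag k (ann j psi) I.
  rewrite ffunE exchange_big; apply: eq_bigr => k _; rewrite cdag_annv mulr_sumr.
  by apply: eq_bigr => j _; rewrite mulrCA mulrA.
rewrite -big_split /ip mulr_suml; apply: eq_bigr => j _ /=.
rewrite -big_split (bigD1 j) //= big1 ?addr0 => [|k kj]; rewrite -mulrDr car.
  by rewrite eqxx mul1r.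
by rewrite eq_sym (negPf kj) mul0r mulr0.
Qed.

Lemma createC u v psi I : create u (create v psi) I = - create v (create u psi) I.
Proof.
have e (a b : 'rV[R[i]]_m) : create a (create b psi) I =
    \sum_j \sum_k a 0 j * b 0 k * cdag j (cdag k psi) I.
  rewrite ffunE; apply: eq_bigr => j _; rewrite cdag_create mulr_sumr.
  by apply: eq_bigr => k _; rewrite mulrA.
rewrite !e exchange_big -sumrN; apply: eq_bigr => k _ /=.
by rewrite -sumrN; apply: eq_bigr => j _ /=; rewrite cdagC mulrN (mulrC (u 0 j)).
Qed.

Lemma inner_conj psi phi : inner psi phi = (inner phi psi)^*.
Proof.
rewrite /inner rmorph_sum; apply: eq_bigr => I _.
by rewrite rmorphM /= conjCK mulrC.
Qed.

Lemma cdag_adj j psi phi : inner (cdag j psi) phi = inner psi (ann j phi).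
Proof.
rewrite /inner (bigID (fun I : {set 'I_m} => j \in I)) /= [X in _ + X]big1; last first.
  by move=> I /negPf jI; rewrite cdagE jI conjC0 mul0r.
rewrite addr0 [RHS](bigID (fun I : {set 'I_m} => j \in I)) /= [X in _ = X + _]big1; last first.
  by move=> I jI; rewrite [ann _ _ _]ffunE jI mulr0.
rewrite add0r (reindex_onto (fun I : {set 'I_m} => j |: I) (fun I : {set 'I_m} => I :\ j)) /=; last first.
  by move=> I jI; rewrite finset.setD1K.
apply: eq_big => [I|I].
  rewrite finset.setU11 /=; apply/eqP/idP => [e|jI]; last by rewrite finset.setU1K.
  by rewrite -e finset.setD11.
rewrite finset.setU11 /= => /eqP e.
have jI : j \notin I by rewrite -e finset.setD11.
rewrite cdagE finset.setU11 e [ann _ _ _]ffunE (negPf jI) sgU // ltnn mul1r.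
by rewrite rmorphM /= conj_sg -mulrA mulrCA mulrA.
Qed.

Lemma create_adj v psi phi : inner (create v psi) phi = inner psi (annv v phi).
Proof.
have -> : inner (create v psi) phi = \sum_j (v 0 j)^* * inner (cdag j psi) phi.
  rewrite /inner; under [RHS]eq_bigr do rewrite mulr_sumr.
  rewrite exchange_big; apply: eq_bigr => I _ /=; rewrite [create _ _ _]ffunE rmorph_sum mulr_suml.
  by apply: eq_bigr => j _; rewrite rmorphM /= mulrA.
have -> : inner psi (annv v phi) = \sum_j (v 0 j)^* * inner psi (ann j phi).
  rewrite /inner; under [RHS]eq_bigr do rewrite mulr_sumr.
  rewrite exchange_big; apply: eq_bigr => I _ /=; rewrite [annv _ _ _]ffunE mulr_sumr.
  by apply: eq_bigr => j _; rewrite mulrCA.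
by apply: eq_bigr => j _; rewrite cdag_adj.
Qed.

(** By adjointness the left side is the expectation in psi of the anticommutator of [annv v] and
    [create v], which is the scalar |v|^2. *)
Lemma norm_create_ann v psi :
  inner (create v psi) (create v psi) + inner (annv v psi) (annv v psi) =
  ip v v * inner psi psi.
Proof.
have -> : inner (annv v psi) (annv v psi) = inner psi (create v (annv v psi)).
  by rewrite [RHS]inner_conj create_adj -inner_conj.
rewrite create_adj /inner -big_split mulr_sumr; apply: eq_bigr => I _ /=.
by rewrite -mulrDr car_vec mulrCA.
Qed.

(** * Slater determinants as products of creation operators *)

Definition slate (vs : seq 'rV[R[i]]_m) : fock R m := foldr (@create R m) (vacuum R m) vs.

Lemma wedge_slate n (M : 'M[R[i]]_(n, m)) : wedge M = slate [seq row i M | i <- enum 'I_n].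
Proof. by rewrite /slate foldr_map. Qed.

Lemma create0 v psi : psi =1 (fun=> 0) -> create v psi =1 (fun=> 0).
Proof.
move=> h I; rewrite ffunE big1 // => j _; rewrite cdagE h.
by case: ifP; rewrite ?mulr0.
Qed.

(** The annihilator anticommutes past every creation operator orthogonal to it and finally kills the
    vacuum. *)
Lemma annv_slate w vs : {in vs, forall v, ip w v = 0} -> annv w (slate vs) =1 (fun=> 0).
Proof.
elim: vs => [|v vs IH] h I.
  rewrite ffunE big1 // => j _; rewrite [ann _ _ _]ffunE; case: ifP => _; rewrite ?mulr0 //.
  rewrite ffunE; case: eqP => [/finset.setP /(_ j)|]; rewrite ?mulr0 //.
  by rewrite finset.setU11 finset.in_set0.
have := car_vec w v (slate vs) I; rewrite h ?mem_head // mul0r.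
rewrite (create0 v (IH _)) ?addr0 // => u uvs; apply: h.
by rewrite in_cons uvs orbT.
Qed.

Definition orthonormal_seq (vs : seq 'rV[R[i]]_m) : Prop :=
  forall i j, (i < size vs)%N -> (j < size vs)%N ->
    ip (nth 0 vs i) (nth 0 vs j) = (i == j)%:R.

Lemma vacuum_norm : inner (vacuum R m) (vacuum R m) = 1.
Proof.
rewrite /inner (bigD1 finset.set0) //= big1 => [|I /negPf nI]; rewrite !ffunE.
  by rewrite eqxx conjC1 mulr1 addr0.
by rewrite nI conjC0 mul0r.
Qed.

Lemma inner0 psi : psi =1 (fun=> 0) -> inner psi psi = 0.
Proof. by move=> h; rewrite /inner big1 // => I _; rewrite h mulr0. Qed.

(** Annihilation along the first orbital kills the product of the others, so [norm_create_ann]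
    reduces to a factor |v|^2 = 1 per orbital; no Gram determinant is expanded. *)
Lemma slate_norm vs : orthonormal_seq vs -> inner (slate vs) (slate vs) = 1.
Proof.
elim: vs => [|v vs IH] h; first exact: vacuum_norm.
have := norm_create_ann v (slate vs); rewrite IH; last first.
  by move=> i j hi hj; exact: (h i.+1 j.+1).
rewrite (inner0 (annv_slate _)); last first.
  move=> u /(nthP 0) [i lt <-]; exact: (h 0%N i.+1).
by rewrite addr0 mulr1 => ->; exact: (h 0%N 0%N).
Qed.

(** Pauli principle: the operator moves, up to sign, to its own copy in the product, and its square
    vanishes because it anticommutes with itself. *)
Lemma create_mem_slate v vs : v \in vs -> create v (slate vs) =1 (fun=> 0).
Proof.
elim: vs => // u vs IH; rewrite in_cons => /orP [/eqP ->|vvs] I /=.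
  have /eqP := createC u u (slate vs) I; rewrite -addr_eq0 -mulr2n mulrn_eq0 /=.
  by move/eqP.
by rewrite createC (create0 u (IH vvs)) oppr0.
Qed.

End Fock.

Local Open Scope complex_scope.

(** * Moduli of complex numbers as real numbers *)

Section Modulus.
Variable R : realType.
Implicit Types z w : R[i].

Definition nm z : R := complex.Re `|z|.

Lemma nmC z : (nm z)%:C = `|z|.
Proof. by rewrite /nm normc_def. Qed.

Lemma nm_ge0 z : 0 <= nm z.
Proof. by rewrite -lecR nmC rmorph0 normr_ge0. Qed.

Lemma nmM z w : nm (z * w) = nm z * nm w.
Proof. by apply: (@complexI R); rewrite rmorphM /= !nmC normrM. Qed.

Lemma nmD z w : nm (z + w) <= nm z + nm w.
Proof. by rewrite -lecR rmorphD /= !nmC ler_normD. Qed.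

Lemma nm_conj z : nm (Num.conj z) = nm z.
Proof. by apply: (@complexI R); rewrite !nmC norm_conjC. Qed.

Lemma nm0 : nm 0 = 0.
Proof. by apply: (@complexI R); rewrite nmC normr0 rmorph0. Qed.

Lemma sqmodE z : sqmod z = nm z ^+ 2.
Proof. by []. Qed.

Lemma sqmodC z : (sqmod z)%:C = z * Num.conj z.
Proof. by rewrite sqmodE rmorphXn /= nmC normCK. Qed.

Lemma sqmod_ge0 z : 0 <= sqmod z.
Proof. by rewrite sqmodE sqr_ge0. Qed.

Lemma sqmodM z w : sqmod (z * w) = sqmod z * sqmod w.
Proof. by rewrite !sqmodE nmM exprMn. Qed.

Lemma sqmod_conj z : sqmod (Num.conj z) = sqmod z.
Proof. by rewrite !sqmodE nm_conj. Qed.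

Lemma sqmod0 : sqmod (0 : R[i]) = 0.
Proof. by rewrite sqmodE nm0 expr0n. Qed.

Lemma nm_sum (I : finType) (F : I -> R[i]) : nm (\sum_i F i) <= \sum_i nm (F i).
Proof.
elim/big_rec2: _ => [|i y x _ h]; first by rewrite nm0.
by apply: le_trans (nmD _ _) _; rewrite lerD2l.
Qed.

End Modulus.

Section SlaterFacts.
Variables (R : realType) (n m : nat).
Implicit Types (phi psi : fock R m) (I : {set 'I_m}) (M : 'M[R[i]]_(n, m)).

Lemma sqnormC phi : (sqnorm phi)%:C = inner phi phi.
Proof.
by rewrite /sqnorm rmorph_sum; apply: eq_bigr => I _ /=; rewrite sqmodC mulrC.
Qed.

Definition vnorm2 (v : 'rV[R[i]]_m) : R := \sum_j sqmod (v 0 j).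

Lemma vnorm2C v : (vnorm2 v)%:C = ip v v.
Proof.
by rewrite /vnorm2 rmorph_sum; apply: eq_bigr => j _ /=; rewrite sqmodC mulrC.
Qed.

Lemma vnorm2_ge0 v : 0 <= vnorm2 v.
Proof. by apply: sumr_ge0 => j _; exact: sqmod_ge0. Qed.

Lemma sqnorm_create_ann v phi :
  sqnorm (create v phi) + sqnorm (annv v phi) = vnorm2 v * sqnorm phi.
Proof.
apply: (@complexI R); rewrite rmorphD rmorphM /= !sqnormC vnorm2C.
exact: norm_create_ann.
Qed.

Lemma sqnorm_ge0 phi : 0 <= sqnorm phi.
Proof. by apply: sumr_ge0 => j _; exact: sqmod_ge0. Qed.

Lemma sqmod_le_sqnorm phi I : sqmod (phi I) <= sqnorm phi.
Proof.
rewrite /sqnorm (bigD1 I) //= lerDl; apply: sumr_ge0 => j _; exact: sqmod_ge0.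
Qed.

Lemma ip_row M i j : M \is unitarymx -> ip (row i M) (row j M) = (i == j)%:R.
Proof.
move=> /unitarymxP /matrixP /(_ j i); rewrite !mxE eq_sym => <-.
by apply: eq_bigr => k _; rewrite !mxE mulrC.
Qed.

Lemma wedge_sqnorm M : M \is unitarymx -> sqnorm (wedge M) = 1.
Proof.
move=> hM; apply: (@complexI R); rewrite sqnormC wedge_slate slate_norm //.
move=> i j; rewrite size_map size_enum_ord => hi hj.
have e k (hk : (k < n)%N) : nth 0 [seq row i0 M | i0 <- enum 'I_n] k = row (Ordinal hk) M.
  rewrite (nth_map (Ordinal hk)) ?size_enum_ord //; congr row.
  by apply: val_inj; rewrite /= nth_enum_ord.
by rewrite (e _ hi) (e _ hj) ip_row.
Qed.

Lemma ip_mulmx (u : 'rV[R[i]]_m) (a : 'rV[R[i]]_n) M :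
  ip u (a *m M) = \sum_i a 0 i * ip u (row i M).
Proof.
rewrite /ip; under [RHS]eq_bigr do rewrite mulr_sumr.
rewrite exchange_big; apply: eq_bigr => j _ /=; rewrite mxE mulr_sumr.
by apply: eq_bigr => i _; rewrite mxE mulrCA.
Qed.

(** * Mode z split along and across the span of the orbitals *)

Variables (M : 'M[R[i]]_(n, m)) (z : 'I_m) (p o : 'rV[R[i]]_m).
Hypotheses (unitary_M : M \is unitarymx) (p_sub : (p <= M)%MS)
  (o_orth : forall i, ip o (row i M) = 0) (p_plus_o : p + o = delta_mx 0 z).

Lemma create_delta phi : create (delta_mx 0 z) phi =1 cdag z phi.
Proof.
move=> I; rewrite ffunE (bigD1 z) //= big1 ?addr0 => [|k kz].
  by rewrite mxE !eqxx mul1r.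
by rewrite mxE (negPf kz) mul0r.
Qed.

Lemma annv_delta phi : annv (delta_mx 0 z) phi =1 ann z phi.
Proof.
move=> I; rewrite ffunE (bigD1 z) //= big1 ?addr0 => [|k kz].
  by rewrite mxE !eqxx conjC1 mul1r.
by rewrite mxE (negPf kz) conjC0 mul0r.
Qed.

Lemma createD (u v : 'rV[R[i]]_m) phi I : create (u + v) phi I = create u phi I + create v phi I.
Proof.
by rewrite !ffunE -big_split; apply: eq_bigr => j _ /=; rewrite mxE mulrDl.
Qed.

Lemma annvD (u v : 'rV[R[i]]_m) phi I : annv (u + v) phi I = annv u phi I + annv v phi I.
Proof.
by rewrite !ffunE -big_split; apply: eq_bigr => j _ /=; rewrite mxE rmorphD mulrDl.
Qed.

(** By linearity this is the Pauli principle for each orbital. *)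
Lemma create_sub_wedge : create p (wedge M) =1 (fun=> 0).
Proof.
move=> I; case/submxP: p_sub => a ->.
have -> : create (a *m M) (wedge M) I = \sum_i a 0 i * create (row i M) (wedge M) I.
  rewrite ffunE; under [RHS]eq_bigr do rewrite ffunE mulr_sumr.
  rewrite exchange_big; apply: eq_bigr => j _ /=; rewrite mxE mulr_suml.
  by apply: eq_bigr => i _; rewrite mxE mulrA.
apply: big1 => i _; rewrite wedge_slate create_mem_slate ?mulr0 //.
by apply: map_f; rewrite mem_enum.
Qed.

Lemma annv_orth_wedge : annv o (wedge M) =1 (fun=> 0).
Proof. by rewrite wedge_slate; apply: annv_slate => v /mapP [i _ ->]. Qed.

Lemma sqnorm_ext phi psi : phi =1 psi -> sqnorm phi = sqnorm psi.
Proof. by move=> e; apply: eq_bigr => I _; rewrite e. Qed.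

Lemma sqnorm0 phi : phi =1 (fun=> 0) -> sqnorm phi = 0.
Proof. by move=> e; rewrite /sqnorm big1 // => I _; rewrite e sqmod0. Qed.

(* Creation along p and annihilation along o both kill the wedge S, so that
   |c_z^dagger S|^2 = |a^dagger(o) S|^2 = |o|^2 and |c_z S|^2 = |a(p) S|^2 = |p|^2
   by the anticommutation relations. *)
Lemma wedge_out I : z \notin I -> sqmod (wedge M I) <= vnorm2 o.
Proof.
move=> zI; have <- : sqnorm (cdag z (wedge M)) = vnorm2 o.
  have := sqnorm_create_ann o (wedge M).
  rewrite (sqnorm0 annv_orth_wedge) wedge_sqnorm // addr0 mulr1 => <-.
  apply: sqnorm_ext => J; rewrite -create_delta -p_plus_o createD.
  by rewrite create_sub_wedge add0r.
apply: le_trans (sqmod_le_sqnorm _ (z |: I)).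
rewrite cdagE finset.setU11 finset.setU1K // sqmodM.
suff -> : sqmod (sg R z (z |: I)) = 1 by rewrite mul1r.
by apply: (@complexI R); rewrite sqmodC conj_sg sg_sq.
Qed.

Lemma wedge_in I : z \in I -> sqmod (wedge M I) <= vnorm2 p.
Proof.
move=> zI; have <- : sqnorm (ann z (wedge M)) = vnorm2 p.
  have := sqnorm_create_ann p (wedge M).
  rewrite (sqnorm0 create_sub_wedge) wedge_sqnorm // add0r mulr1 => <-.
  apply: sqnorm_ext => J; rewrite -annv_delta -p_plus_o annvD.
  by rewrite annv_orth_wedge addr0.
apply: le_trans (sqmod_le_sqnorm _ (I :\ z)).
rewrite [ann _ _ _]ffunE finset.setD11 finset.setD1K // sqmodM.
suff -> : sqmod (sg R z (I :\ z)) = 1 by rewrite mul1r.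
by apply: (@complexI R); rewrite sqmodC conj_sg sg_sq.
Qed.

Lemma ip_sub_orth : ip o p = 0.
Proof.
case/submxP: p_sub => a ->; rewrite ip_mulmx.
by apply: big1 => i _; rewrite o_orth mulr0.
Qed.

Lemma ipDr (u v w : 'rV[R[i]]_m) : ip u (v + w) = ip u v + ip u w.
Proof. by rewrite /ip -big_split; apply: eq_bigr => j _ /=; rewrite mxE mulrDr. Qed.

Lemma ip_conj (u v : 'rV[R[i]]_m) : ip u v = Num.conj (ip v u).
Proof.
by rewrite /ip rmorph_sum; apply: eq_bigr => j _; rewrite rmorphM /= conjCK mulrC.
Qed.

Lemma vnorm2_pyth : vnorm2 p + vnorm2 o = 1.
Proof.
apply: (@complexI R); rewrite rmorphD /= !vnorm2C.
have : ip (delta_mx 0 z) (delta_mx 0 z : 'rV[R[i]]_m) = 1.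
  rewrite /ip (bigD1 z) //= big1 ?addr0 => [|k kz]; rewrite !mxE.
    by rewrite !eqxx conjC1 mulr1.
  by rewrite (negPf kz) conjC0 mul0r.
have po : ip p o = 0 by rewrite ip_conj ip_sub_orth conjC0.
have ipDl (u v w : 'rV[R[i]]_m) : ip (u + v) w = ip u w + ip v w.
  by rewrite ip_conj ipDr rmorphD /= -!ip_conj.
by rewrite -p_plus_o ipDl !ipDr ip_sub_orth po addr0 add0r.
Qed.

End SlaterFacts.

(** * Lower bounds for the optimum from basis determinants *)

Section Optimum.
Variables (R : realType) (n m : nat).
Implicit Types (phi : fock R m) (I : {set 'I_m}).

(** [sup] is an upper bound only once the set is known to be bounded. The amplitudes of a normalized
    determinant have modulus at most 1, which bounds each overlap in terms of [phi] alone. *)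
Lemma le_OPT phi S : slater n S -> overlap S phi <= OPT n phi.
Proof.
move=> hS; apply: ub_le_sup; last by exists S.
exists ((\sum_I nm (phi I)) ^+ 2 / sqnorm phi) => _ [S' [M hM ->] <-].
rewrite /overlap; apply: ler_wpM2r; first by rewrite invr_ge0 sqnorm_ge0.
rewrite sqmodE ler_sqr ?nnegrE ?nm_ge0 ?sumr_ge0 // => [|I _]; last exact: nm_ge0.
apply: le_trans (nm_sum _) _; apply: ler_sum => I _.
rewrite nmM nm_conj ler_piMl ?nm_ge0 //.
have := sqmod_le_sqnorm (wedge M) I; rewrite wedge_sqnorm // sqmodE.
by rewrite expr_le1 ?nm_ge0.
Qed.

Lemma slate_coord (js : seq 'I_m) I :
  slate [seq delta_mx 0 j : 'rV[R[i]]_m | j <- js] I != 0 -> I = [set j in js].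
Proof.
elim: js I => [|j js IH] I /=.
  rewrite ffunE; case: (eqVneq I finset.set0) => [-> _|_]; last by rewrite eqxx.
  by apply/finset.setP => j; rewrite !inE.
rewrite create_delta cdagE; case: ifP => jI; last by rewrite eqxx.
rewrite mulf_eq0 negb_or => /andP [_ /IH e].
rewrite -(finset.setD1K jI) e; apply/finset.setP => i; rewrite !inE.
by case: eqVneq.
Qed.

Lemma slater_coord I : #|I| = n -> exists S : fock R m,
  [/\ slater n S, forall J, J != I -> S J = 0 & sqmod (S I) = 1].
Proof.
move=> cI; pose f (i : 'I_n) : 'I_m := enum_val (cast_ord (esym cI) i).
have f_inj : injective f by move=> i j /enum_val_inj /cast_ord_inj.
pose M : 'M[R[i]]_(n, m) := \matrix_(i, j) (j == f i)%:R.
have rowM i : row i M = delta_mx 0 (f i).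
  by apply/rowP => j; rewrite !mxE eqxx.
have hM : M \is unitarymx.
  apply/unitarymxP/matrixP => i j; rewrite !mxE.
  rewrite (bigD1 (f i)) //= big1 ?addr0 => [|k kz]; rewrite !mxE.
    by rewrite eqxx mul1r (inj_eq f_inj) conjC_nat.
  by rewrite (negPf kz) mul0r.
have supp J : wedge M J != 0 -> J = I.
  rewrite wedge_slate.
  have -> : [seq row i M | i <- enum 'I_n] =
      [seq delta_mx 0 j : 'rV[R[i]]_m | j <- [seq f i | i <- enum 'I_n]].
    by elim: (enum 'I_n) => //= i s ->; rewrite rowM.
  move/slate_coord => ->; apply/finset.setP => j; rewrite inE.
  apply/mapP/idP => [[i _ ->]|jI]; first exact: enum_valP.
  exists (cast_ord cI (enum_rank_in jI j)); first by rewrite mem_enum.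
  by rewrite /f cast_ordK enum_rankK_in.
exists (wedge M); split; first by exists M.
  by move=> J /eqP nJ; apply/eqP; case: (eqVneq (wedge M J) 0) => // /supp /nJ.
rewrite -(wedge_sqnorm hM) /sqnorm (bigD1 I) //= big1 ?addr0 // => J /eqP nJ.
by case: (eqVneq (wedge M J) 0) => [->|/supp /nJ] //; rewrite sqmod0.
Qed.

Lemma OPT_coord phi I : #|I| = n -> sqmod (phi I) / sqnorm phi <= OPT n phi.
Proof.
move=> /slater_coord [S [hS S0 S1]]; apply: le_trans (le_OPT phi hS).
rewrite /overlap /inner (bigD1 I) //= big1 => [|J nJ]; last by rewrite S0 // conjC0 mul0r.
by rewrite addr0 sqmodM sqmod_conj S1 mul1r.
Qed.

End Optimum.

(** * Separation of the two cases by the distance |o|^2 *)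

Section Decision.
Variables (R : realType) (n m : nat) (z : 'I_m) (M : 'M[R[i]]_(n, m)).
Variables (p o : 'rV[R[i]]_m).
Hypotheses (unitary_M : M \is unitarymx) (p_sub : (p <= M)%MS)
  (o_orth : forall i, ip o (row i M) = 0) (p_plus_o : p + o = delta_mx 0 z).
Variables (phi : fock R m) (E : {set 'I_m}).
Hypotheses (cE : #|E| = n) (zE : z \in E) (phiE : sqmod (phi E) = 1)
  (near_opt : OPT n phi - 8^-1 <= overlap (wedge M) phi).

(** OPT is at least 1, so S has weight at least 7/8 on E. Since E contains mode z, this weight is at
    most |p|^2 = 1 - |o|^2. *)
Lemma decide_no : (forall I, I != E -> phi I = 0) -> vnorm2 o <= 8^-1.
Proof.
move=> h; have s1 : sqnorm phi = 1.
  by rewrite /sqnorm (bigD1 E) //= big1 ?addr0 // => I nI; rewrite h // sqmod0.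
have := OPT_coord phi cE; rewrite phiE s1 divr1 => opt.
have := wedge_in unitary_M p_sub o_orth p_plus_o zE.
have := vnorm2_pyth p_sub o_orth p_plus_o.
move: near_opt; rewrite /overlap s1 divr1 /inner (bigD1 E) //= big1 => [|I nI].
  by rewrite addr0 sqmodM sqmod_conj phiE mulr1; lra.
by rewrite h // mulr0.
Qed.

(** With a and b the moduli of S on D and E, near-optimality gives k^2 <= (a k + b)^2 + (k^2 + 1) /
    8. If |o|^2 <= 1/2, then a^2 <= 1/2, b^2 <= 1 and 2 a b <= 3/2, which leads to k^2 <= 4 k + 3,
    impossible for k >= 8. *)
Lemma decide_yes (D : {set 'I_m}) (k : R) : 8 <= k -> #|D| = n -> z \notin D ->
  sqmod (phi D) = k ^+ 2 ->
  (forall I, I != E -> I != D -> phi I = 0) -> 2^-1 < vnorm2 o.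
Proof.
move=> k8 cD zD phiD h.
have DE : D != E by apply: contra zD => /eqP ->.
have s1 : sqnorm phi = k ^+ 2 + 1.
  rewrite /sqnorm (bigD1 D) //= (bigD1 E) 1?eq_sym //= big1 ?addr0 ?phiE ?phiD //.
  by move=> I /andP [nD nE]; rewrite h // sqmod0.
have k2 : 0 < k ^+ 2 + 1 by rewrite ltr_wpDl ?sqr_ge0.
have := OPT_coord phi cD; rewrite phiD s1 => opt.
have := wedge_out unitary_M p_sub o_orth p_plus_o zD.
have y1 := sqmod_le_sqnorm (wedge M) E; rewrite wedge_sqnorm // in y1.
move: near_opt; rewrite /overlap s1 /inner (bigD1 D) //= (bigD1 E) 1?eq_sym //= big1 => [|I /andP [nD nE]]; last by rewrite h // mulr0.
rewrite addr0; set A := _ * phi D; set B := _ * phi E.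
rewrite ltNge => near out; apply/negP => o_le.
have nA : nm A = nm (wedge M D) * k.
  rewrite nmM nm_conj; congr (_ * _); apply/eqP.
  by rewrite -(@eqrXn2 _ 2) ?nm_ge0 //; [rewrite -sqmodE phiD|lra].
have nB : nm B = nm (wedge M E).
  rewrite nmM nm_conj -[RHS]mulr1; congr (_ * _); apply/eqP.
  by rewrite -(@eqrXn2 _ 2) ?nm_ge0 // -sqmodE phiE expr1n.
have hAB := nmD A B; rewrite nA nB in hAB.
have ab0 := nm_ge0 (A + B).
have a0 := nm_ge0 (wedge M D); have b0 := nm_ge0 (wedge M E).
rewrite !sqmodE in near out y1.
move: near; rewrite lerBlDr => near.
have : k ^+ 2 / (k ^+ 2 + 1) <= nm (A + B) ^+ 2 / (k ^+ 2 + 1) + 8^-1 by exact: le_trans opt near.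
rewrite ler_pdivrMr // mulrDl divfK ?gt_eqF //.
move: (nm (A + B)) (nm (wedge M D)) (nm (wedge M E)) hAB ab0 a0 b0 out y1 => c a b hAB c0 a0 b0 out y1.
have c2 : c ^+ 2 <= (a * k + b) ^+ 2 by rewrite ler_sqr ?nnegrE // addr_ge0 // mulr_ge0 //; lra.
have ab : 2 * a * b <= 3 / 2 by nra.
move=> hc; have : k ^+ 2 <= (a * k + b) ^+ 2 + 8^-1 * (k ^+ 2 + 1) by apply: le_trans hc _; rewrite lerD2r.
have -> : (a * k + b) ^+ 2 = a ^+ 2 * k ^+ 2 + 2 * a * b * k + b ^+ 2 by ring.
have t1 : a ^+ 2 * k ^+ 2 <= 2^-1 * k ^+ 2.
  by apply: ler_wpM2r; [exact: sqr_ge0|exact: le_trans out o_le].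
have t2 : 2 * a * b * k <= 3 / 2 * k by apply: ler_wpM2r => //; lra.
move=> hk; have : k * 8 <= k ^+ 2 by rewrite expr2; apply: ler_wpM2l => //; lra.
lra.
Qed.

End Decision.

(** * Correctness of the decision *)

Section GaussianValue.
Variable R : realType.

Definition ival (a : zint) : R := (bval a.1)%:R - (bval a.2)%:R.
Definition gval (a : gint) : R[i] := ival a.1 +i* ival a.2.

Lemma ival_add a b : ival (iadd a b) = ival a + ival b.
Proof. by rewrite /ival /= !badd_val !natrD; ring. Qed.

Lemma ival_neg a : ival (ineg a) = - ival a.
Proof. by rewrite /ival /= opprB. Qed.

Lemma ival_mul a b : ival (imul a b) = ival a * ival b.
Proof. by rewrite /ival /= !badd_val !bmul_val !natrD !natrM; ring. Qed.

Lemma gval_add a b : gval (gadd a b) = gval a + gval b.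
Proof. by rewrite /gval /= !ival_add. Qed.

Lemma gval_neg a : gval (gneg a) = - gval a.
Proof. by rewrite /gval /= !ival_neg. Qed.

Lemma gval_conj a : gval (gconj a) = Num.conj (gval a).
Proof. by rewrite /gval /= ival_neg. Qed.

Lemma gval_mul a b : gval (gmul a b) = gval a * gval b.
Proof.
rewrite /gval /= !ival_add ival_neg !ival_mul.
by rewrite /GRing.mul /=; congr (_ +i* _).
Qed.

Lemma gval0 : gval gint0 = 0.
Proof. by rewrite /gval /ival /= subrr. Qed.

Lemma gval1 : gval gint1 = 1.
Proof. by rewrite /gval /ival /= subrr subr0. Qed.

Lemma ival_zint_of w : ival (zint_of w) = (int_of_bits w)%:~R.
Proof.
rewrite /zint_of /int_of_bits.
have -> : foldr (fun (b : bool) k => (b + k.*2)%N) 0%N (behead w) = bval (behead w).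
  by elim: (behead w) => //= b v ->.
by case: (head false w); rewrite /ival /= ?sub0r ?subr0 ?expr1 ?expr0 ?mulN1r ?mul1r ?rmorphN.
Qed.

Lemma gval_gaussian x y : gval (zint_of x, zint_of y) = gaussian R x y.
Proof. by rewrite /gval /gaussian !ival_zint_of. Qed.

Variable m : nat.

Definition vval (r : seq gint) : 'rV[R[i]]_m := \row_j gval (nth gint0 r j).

Lemma gdot_val a b : size a = m -> size b = m -> gval (gdot a b) = ip (vval a) (vval b).
Proof.
move=> sa sb; rewrite /gdot.
have h l g : gval (foldl (fun acc xy => gadd acc (gmul (gconj xy.1) xy.2)) g l) =
    gval g + \sum_(xy <- l) Num.conj (gval xy.1) * gval xy.2.
  elim: l g => [|xy l IH] g /=; first by rewrite big_nil addr0.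
  by rewrite IH big_cons gval_add gval_mul gval_conj addrA.
rewrite h gval0 add0r (big_nth (gint0, gint0)) size_zip sa sb minnn big_mkord.
by apply: eq_bigr => j _; rewrite nth_zip ?sa ?sb // !mxE.
Qed.

Definition vproj (a b : 'rV[R[i]]_m) : 'rV[R[i]]_m := ip a a *: b - ip a b *: a.

Lemma size_gproj a b : size a = m -> size b = m -> size (gproj a b) = m.
Proof. by move=> sa sb; rewrite size_map size_zip sa sb minnn. Qed.

Lemma gproj_val a b : size a = m -> size b = m -> vval (gproj a b) = vproj (vval a) (vval b).
Proof.
move=> sa sb; apply/rowP => j; rewrite !mxE.
rewrite (nth_map (gint0, gint0)) ?size_zip ?sa ?sb ?minnn // nth_zip ?sa ?sb //=.
by rewrite gval_add gval_neg !gval_mul !gdot_val.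
Qed.

Lemma ipZr c (u v : 'rV[R[i]]_m) : ip u (c *: v) = c * ip u v.
Proof. by rewrite /ip mulr_sumr; apply: eq_bigr => j _; rewrite mxE mulrCA. Qed.

Lemma ipBr (u v w : 'rV[R[i]]_m) : ip u (v - w) = ip u v - ip u w.
Proof. by rewrite ipDr -scaleN1r ipZr mulN1r. Qed.

Lemma ip_span0 (u v : 'rV[R[i]]_m) X : v \in <<X>>%VS -> {in X, forall x, ip u x = 0} -> ip u v = 0.
Proof.
move=> hv h; rewrite (coord_span (hv : v \in <<in_tuple X>>%VS)).
have ipsum (F : 'I_(size X) -> 'rV[R[i]]_m) : ip u (\sum_i F i) = \sum_i ip u (F i).
  elim/big_rec2: _ => [|i y x _ <-]; last by rewrite ipDr.
  by rewrite /ip big1 // => j _; rewrite mxE mulr0.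
rewrite ipsum big1 // => i _; rewrite ipZr h ?mulr0 //.
by apply: mem_nth; rewrite /= ltn_ord.
Qed.

Lemma ip_eq0 (u : 'rV[R[i]]_m) : ip u u = 0 -> u = 0.
Proof.
rewrite -vnorm2C => h; have h0 : vnorm2 u = 0 by case: h.
apply/rowP => j; rewrite mxE; have hj : sqmod (u 0 j) = 0.
  have := (@psumr_eq0P _ _ predT (fun j => sqmod (u 0 j)) (fun j _ => sqmod_ge0 _) h0).
  exact.
by have := congr1 (fun x : R => x%:C) hj; rewrite sqmodC => /eqP; rewrite mul_conjC_eq0 => /eqP.
Qed.

(** [vproj a] is invertible modulo a: up to a multiple of a, division by |a|^2 recovers the
    vector. *)
Lemma span_vproj a (vs : seq 'rV[R[i]]_m) : ip a a != 0 ->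
  (<<a :: [seq vproj a v | v <- vs]>> = <<a :: vs>>)%VS.
Proof.
move=> na; apply/eqP; rewrite eqEsubv; apply/andP; split; apply/span_subvP => x.
  rewrite in_cons => /orP [/eqP ->|/mapP [v vvs ->]].
    by apply: memv_span; rewrite mem_head.
  apply: rpredB; apply: rpredZ; apply: memv_span; rewrite in_cons ?eqxx //.
  by rewrite vvs orbT.
rewrite in_cons => /orP [/eqP ->|xvs].
  by apply: memv_span; rewrite mem_head.
have -> : x = (ip a a)^-1 *: (vproj a x + ip a x *: a).
  by rewrite /vproj subrK scalerA mulVf // scale1r.
apply: rpredZ; apply: rpredD.
  by apply: memv_span; rewrite in_cons map_f ?orbT.
by apply: rpredZ; apply: memv_span; rewrite mem_head.
Qed.

(** Induction on the number of rows: a round projects everything off the first row, and [span_vproj]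
    preserves the span and hence freeness. Freeness keeps every pivot norm nonzero, and c is the
    product of these norms. *)
Lemma gelim_spec rs b : all (fun r => size r == m) rs -> size b = m ->
  free [seq vval r | r <- rs] ->
  let w := head [::] (gelim (size rs) (rs ++ [:: b])) in
  [/\ size w = m,
      exists2 c : R[i], c != 0 & vval w - c *: vval b \in <<[seq vval r | r <- rs]>>%VS &
      {in rs, forall r, ip (vval r) (vval w) = 0}].
Proof.
move: {2}(size rs) (erefl (size rs)) => k; elim: k rs b => [|k IH] [|a rs] b //=.
  move=> _ _ sb _; split=> //; exists 1; first exact: oner_neq0.
  by rewrite scale1r subrr mem0v.
move=> [srs] /andP [/eqP sa hrs] sb fr.
have a0 : vval a != 0.
  by apply: (free_not0 fr); exact: mem_head.
set N := ip (vval a) (vval a).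
have N0 : N != 0 by apply: contra a0 => /eqP /ip_eq0 ->.
pose rs' := [seq gproj a r | r <- rs].
have hrs' : all (fun r => size r == m) rs'.
  by rewrite all_map; apply: sub_all hrs => r /eqP sr /=; rewrite size_gproj.
have evs : [seq vval r | r <- rs'] = [seq vproj (vval a) v | v <- [seq vval r | r <- rs]].
  by rewrite -!map_comp; apply/eq_in_map => r /(allP hrs) /eqP sr /=; rewrite gproj_val.
have sp : (<<vval a :: [seq vval r | r <- rs']>> = <<vval a :: [seq vval r | r <- rs]>>)%VS.
  by rewrite evs span_vproj.
have fr' : free [seq vval r | r <- rs'].
  have : free (vval a :: [seq vval r | r <- rs']).
    by rewrite /free sp; move: fr; rewrite /free /= !size_map.
  by rewrite free_cons => /andP [].
have := IH rs' (gproj a b); rewrite size_map srs => /(_ erefl hrs' (size_gproj sa sb) fr').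
have -> : rs' ++ [:: gproj a b] = ground (a :: rs ++ [:: b]).
  by rewrite /ground /= map_cat.
rewrite -gelimS; set w := head _ _ => -[sw [c c0 hw] orth].
(* w is c times the projected b plus a combination of projected rows, and all of these are
   orthogonal to a. *)
have aw : ip (vval a) (vval w) = 0.
  have av v : ip (vval a) (vproj (vval a) v) = 0.
    by rewrite /vproj ipBr !ipZr mulrC subrr.
  rewrite -[vval w](subrK (c *: vval (gproj a b))) ipDr ipZr gproj_val // av mulr0 addr0.
  by rewrite -gproj_val //; apply: (ip_span0 hw) => x; rewrite evs => /mapP [v _ ->].
split=> //.
  exists (c * N); first by rewrite mulf_neq0.
  have -> : vval w - (c * N) *: vval b =
     (vval w - c *: vval (gproj a b)) - (c * ip (vval a) (vval b)) *: vval a.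
    have e (x y u : 'rV[R[i]]_m) : x - u = x - (u - y) - y.
      by rewrite opprB [y - u]addrC addrA addrK.
    have -> : c *: vval (gproj a b) =
        (c * N) *: vval b - (c * ip (vval a) (vval b)) *: vval a.
      by rewrite gproj_val // scalerBr !scalerA.
    exact: e.
  rewrite -sp; apply: rpredB; last first.
    by apply: rpredZ; apply: memv_span; rewrite mem_head.
  apply: (subvP _ _ hw); apply: sub_span => x; rewrite in_cons => ->; exact: orbT.
move=> r; rewrite in_cons => /orP [/eqP ->//|rrs].
have sr : size r = m by apply/eqP; exact: (allP hrs).
(* w is orthogonal to N r - <a, r> a and to a, hence to r, because N is nonzero. *)
have := orth (gproj a r) (map_f _ rrs); rewrite gproj_val // ip_conj.
move/eqP; rewrite conjC_eq0 /vproj ipBr !ipZr [ip (vval w) (vval a)]ip_conj aw conjC0 mulr0 subr0.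
by rewrite mulf_eq0 (negPf N0) /= => /eqP wr; rewrite ip_conj wr conjC0.
Qed.

End GaussianValue.

(** * The bit computed from the output determinant *)

Section DecisionCorrect.
Variables (R : realType) (n m : nat).
Notation m1 := m.+1.

Lemma vval_e0 : vval R m1 (gint1 :: nseq m gint0) = delta_mx 0 0.
Proof.
apply/rowP => j; rewrite !mxE eqxx /=; case: j => -[|j] hj /=; first exact: gval1.
by rewrite nth_nseq if_same gval0.
Qed.

Lemma free_rows (G : 'M[R[i]]_(n, m1)) : row_free G -> free [seq row i G | i <- enum 'I_n].
Proof.
move=> fG; have sX : size [seq row i G | i <- enum 'I_n] == n by rewrite size_map size_enum_ord.
rewrite -[[seq _ | _ <- _]]/(tval (Tuple sX)); apply/freeP => k hk i.
have e (j : 'I_n) : (Tuple sX)`_j = row j G.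
  by rewrite /= (nth_map j) ?size_enum_ord //= nth_ord_enum.
have : (\row_j k j) *m G = 0.
  rewrite mulmx_sum_row -[RHS]hk; apply: eq_bigr => j _.
  by rewrite mxE e.
move/eqP; rewrite mulmx_free_eq0 // => /eqP /rowP /(_ i).
by rewrite !mxE.
Qed.

Lemma decide_bits_val (w : seq gint) : size w = m1 ->
  decide_bits w =
    (vnorm2 (vval R m1 w) < 2 * sqmod (vval R m1 w 0 0)).
Proof.
move=> sw; rewrite /decide_bits; set x := gmul _ _; set y := gdot _ _; cbv zeta.
have ex : ival R x.1 = sqmod (vval R m1 w 0 0).
  have : gval R x = (sqmod (vval R m1 w 0 0))%:C.
    by rewrite gval_mul gval_conj sqmodC mulrC mxE nth0.
  by case.
have ey : ival R y.1 = vnorm2 (vval R m1 w).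
  have : gval R y = (vnorm2 (vval R m1 w))%:C by rewrite (gdot_val R sw sw) vnorm2C.
  by case.
move: x y ex ey => x y <- <-; rewrite bgt_val !badd_val /ival -(ltr_nat R) !natrD.
by apply/idP/idP; lra.
Qed.

Lemma decision_correct (out : seq bool) (S : fock R m1) :
  outputs_slater n out S -> exists (M : 'M[R[i]]_(n, m1)) (p o : 'rV[R[i]]_m1),
  [/\ M \is unitarymx, S = wedge M, (p <= M)%MS,
      (forall i, ip o (row i M) = 0) & p + o = delta_mx 0 0 /\
      decision ((n, m1), out) = [:: 2^-1 < vnorm2 o]].
Proof.
move=> [re [im [M [eout hM eM eS]]]].
set G := \matrix_(i, j) _ in eM.
pose rs := [seq [seq (zint_of (re i j), zint_of (im i j)) | j <- enum 'I_m1] | i <- enum 'I_n].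
have srs : size rs = n by rewrite size_map size_enum_ord.
have hrs : all (fun r => size r == m1) rs.
  by rewrite all_map; apply/allP => i _ /=; rewrite size_map size_enum_ord.
have vrs : [seq vval R m1 r | r <- rs] = [seq row i G | i <- enum 'I_n].
  rewrite -map_comp; apply/eq_in_map => i _ /=; apply/rowP => j; rewrite !mxE.
  by rewrite (nth_map j) ?size_enum_ord //= nth_ord_enum gval_gaussian.
have egs : gints_of (decode out) = flatten rs.
  rewrite eout decode_encode.
  pose l := [seq (re i j, im i j) | i <- enum 'I_n, j <- enum 'I_m1].
  have -> : [seq [:: re i j; im i j] | i <- enum 'I_n, j <- enum 'I_m1] = [seq [:: x.1; x.2] | x <- l].
    by rewrite /l map_allpairs.
  by rewrite gints_of_flatten /l map_allpairs.
have rG : row_free G by rewrite /row_free -eM mxrank_unitary.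
have fr : free [seq vval R m1 r | r <- rs] by rewrite vrs; exact: free_rows.
have sb : size (gint1 :: nseq m gint0) = m1 by rewrite /= size_nseq.
have := gelim_spec hrs sb fr; rewrite srs.
have -> : head [::] (gelim n (rs ++ [:: gint1 :: nseq m gint0])) = last_vector n m1 out.
  by have := rows_of_flatten hrs; rewrite srs /last_vector egs => ->.
set w := last_vector _ _ _ => -[sw [c c0 hw] orth].
set W := vval R m1 w in hw orth.
rewrite vval_e0 in hw; set u := W - _ in hw.
have uG : (u <= G)%MS.
  have : (<<[seq vval R m1 r | r <- rs]>> <= <<[seq row i G | i <- enum 'I_n]>>)%VS by rewrite vrs.
  move=> _; rewrite vrs in hw.
  rewrite (coord_span (hw : u \in <<in_tuple _>>%VS)) summx_sub // => i _.
  apply: scalemx_sub; have /mapP [k _ ->] : (in_tuple [seq row i G | i <- enum 'I_n])`_i \in [seq row i G | i <- enum 'I_n].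
    by apply: mem_nth; rewrite ltn_ord.
  exact: row_sub.
have oW i : ip W (row i M) = 0.
  have : (row i M <= G)%MS by rewrite -eM row_sub.
  case/submxP => a ->.
  rewrite ip_mulmx; apply: big1 => k _.
  have /mapP [r rrs er] : row k G \in [seq vval R m1 r | r <- rs].
    by rewrite vrs; apply/mapP; exists k; rewrite ?mem_enum.
  by rewrite ip_conj er orth // conjC0 mulr0.
(* W = c e_0 + u with u in the span of the orbitals and W orthogonal to it; division by c gives the
   orthogonal decomposition of e_0. *)
pose o := c^-1 *: W; pose p := - c^-1 *: u.
have po : p + o = delta_mx 0 0.
  by rewrite /p /o /u scaleNr -scalerN -scalerDr opprB subrK scalerA mulVf // scale1r.
have pM : (p <= M)%MS by rewrite eM scalemx_sub.
have oM i : ip o (row i M) = 0.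
  by rewrite ip_conj /o ipZr [ip (row i M) W]ip_conj oW conjC0 mulr0 conjC0.
exists M, p, o; split=> //; split=> //.
rewrite /decision /= decide_bits_val // -/W; congr [:: _].
have W0 : W = c *: o by rewrite /o scalerA mulfV // scale1r.
(* The entry is <e_0, o> = <p + o, o>, and p is orthogonal to o. *)
have o0 : o 0 0 = (vnorm2 o)%:C.
  rewrite vnorm2C; have : ip (delta_mx 0 0) o = o 0 0.
    rewrite /ip (bigD1 0) //= big1 ?addr0 => [|j j0]; rewrite !mxE.
      by rewrite !eqxx conjC1 mul1r.
    by rewrite (negPf j0) conjC0 mul0r.
  rewrite -po => <-; rewrite ip_conj ipDr rmorphD /= -!ip_conj.
  by rewrite [ip p o]ip_conj (ip_sub_orth pM oM) conjC0 add0r.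
have vW : vnorm2 W = sqmod c * vnorm2 o.
  by rewrite W0 /vnorm2 mulr_sumr; apply: eq_bigr => j _; rewrite mxE sqmodM.
have sW : sqmod (W 0 0) = sqmod c * vnorm2 o ^+ 2.
  rewrite W0 mxE sqmodM o0; congr (_ * _).
  apply: (@complexI R); rewrite sqmodC rmorphXn expr2.
  by rewrite -[Num.conj _]/(vnorm2 o -i* 0) oppr0.
have cp : 0 < sqmod c.
  rewrite lt_def sqmod_ge0 andbT; apply: contra c0 => /eqP h.
  have := congr1 (fun x : R => x%:C) h; rewrite sqmodC => /eqP.
  by rewrite mul_conjC_eq0.
rewrite vW sW mulrCA ltr_pM2l //.
(* With q = |o|^2 the test reads q < 2 q^2. Cancelling q requires q > 0; for q = 0 both sides of the
   equality are false. *)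
have := vnorm2_ge0 o; rewrite le_eqVlt => /orP [/eqP <-|q0].
  by rewrite expr0n mulr0 ltxx; apply/esym/negbTE; rewrite -leNgt invr_ge0.
by rewrite expr2 mulrA -{1}[vnorm2 o]mul1r ltr_pM2r // -ltr_pdivrMl // mulr1.
Qed.

End DecisionCorrect.

Local Close Scope complex_scope.
Local Close Scope ring_scope.

(** * The vector of a graph *)

Section Instance.
Variables (n0 p : nat).
Notation n := n0.+1.
Variable e : rel (vertex n p).
Hypothesis p_gt0 : 0 < p.
Notation m := (n + n * p).
Let bits := [seq e u v | u <- enum {: vertex n p}, v <- enum {: vertex n p}].
Let bad := bad_pairs n p bits.

Definition mode (u : vertex n p) : nat := n + (u.1 * p + u.2).

Lemma mode_lt u : mode u < m.
Proof.
rewrite /mode ltn_add2l; case: u => [[i hi] [a ha]] /=.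
by apply: (@leq_trans (i.+1 * p)); [rewrite mulSnr ltn_add2l|rewrite leq_mul2r hi orbT].
Qed.

Definition emb (u : vertex n p) : 'I_m := Ordinal (mode_lt u).

Lemma emb_inj : injective emb.
Proof.
move=> [[i hi] [a ha]] [[j hj] [b hb]] /(congr1 val) /addnI /= h.
have hd : i = j.
  by have := congr1 (divn^~ p) h; rewrite !divnMDl // !divn_small // !addn0.
subst j; move/addnI: h => h; subst b; congr (_, _); exact: val_inj.
Qed.

Lemma emb_onto (j : 'I_m) : n <= j -> exists u, j = emb u.
Proof.
move=> nj; have h : j - n < n * p by rewrite ltn_subLR // ltn_ord.
have hi : (j - n) %/ p < n by rewrite ltn_divLR.
have ha : (j - n) %% p < p by rewrite ltn_mod.
exists (Ordinal hi, Ordinal ha); apply: val_inj => /=.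
by rewrite /mode /= -divn_eq subnKC.
Qed.

Lemma enum_vertex : enum {: vertex n p} = [seq (i, a) | i <- enum 'I_n, a <- enum 'I_p].
Proof. by rewrite enumT unlock. Qed.

Lemma verticesE :
  vertices n p = [seq (val u.1, mode u) | u <- enum {: vertex n p}].
Proof.
rewrite enum_vertex map_allpairs /vertices -!val_enum_ord allpairs_mapl.
by rewrite (allpairs_mapr _ (fun _ => val)).
Qed.

Lemma bad_pairsP (inI : pred nat) :
  all (fun x : nat * nat => ~~ (inI x.1 && inI x.2)) bad <->
  (forall u v, u != v -> (u.1 == v.1) || ~~ e u v -> ~~ (inI (mode u) && inI (mode v))) /\
  (forall (i : 'I_n) v, ~~ (inI i && inI (mode v))).
Proof.
pose L := [seq (u, v) | u <- enum {: vertex n p}, v <- enum {: vertex n p}].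
have inL u v : (u, v) \in L by apply/allpairsP; exists (u, v); rewrite !mem_enum.
rewrite /bad /bad_pairs all_cat.
have -> : [seq (u, v) | u <- vertices n p, v <- vertices n p] =
    [seq ((val w.1.1, mode w.1), (val w.2.1, mode w.2)) | w <- L].
  by rewrite verticesE allpairs_mapl (allpairs_mapr _ (fun _ u => (val u.1, mode u))) map_allpairs.
have -> : bits = [seq e w.1 w.2 | w <- L] by rewrite map_allpairs.
rewrite zip_map all_map all_filter all_map.
split=> [/andP [/allP h1 /allP h2]|[h1 h2]].
  split=> [u v uv huv|i v].
    have := h1 (u, v) (inL u v); rewrite /= huv andbT => /implyP; apply.
    by apply: contra uv => /eqP h; apply/eqP/emb_inj/val_inj.
  apply: (h2 (val i, mode v)); apply/allpairsP; exists (val i, (val v.1, mode v)).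
  rewrite mem_iota /= ltn_ord verticesE; split=> //.
  by apply/mapP; exists v; rewrite ?mem_enum.
apply/andP; split.
  apply/allP => -[u v] _ /=; apply/implyP => /andP [uv huv]; apply: h1 => //.
  by apply: contra uv => /eqP ->.
apply/allP => _ /allpairsP [[i v] [hi hv ->]].
rewrite mem_iota in hi; rewrite verticesE in hv; case/mapP: hv => u _ /= ->.
exact: (h2 (Ordinal hi) u).
Qed.

Definition extras : {set 'I_m} := [set widen_ord (leq_addr _ _) i | i : 'I_n].

Lemma in_extras j : (j \in extras) = (j < n).
Proof.
apply/imsetP/idP => [[i _ ->]|hj]; first exact: (ltn_ord i).
by exists (Ordinal hj) => //; apply: val_inj.
Qed.

Lemma card_extras : #|extras| = n.
Proof.
rewrite card_imset ?card_ord // => i j /(congr1 val) /= h; exact: val_inj.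
Qed.

Definition clique_set (s : {ffun 'I_n -> 'I_p}) : {set 'I_m} := [set emb (i, s i) | i : 'I_n].

Lemma card_clique_set s : #|clique_set s| = n.
Proof. by rewrite card_imset ?card_ord // => i j /emb_inj [->]. Qed.

Lemma clique_set_ge s j : j \in clique_set s -> n <= j.
Proof. by case/imsetP => i _ ->; exact: leq_addr. Qed.

Section Support.
Variable I : {set 'I_m}.
Hypotheses (cI : #|I| = n)
  (h1 : forall u v, u != v -> (u.1 == v.1) || ~~ e u v -> ~~ ((emb u \in I) && (emb v \in I)))
  (h2 : forall (i : 'I_m) v, i < n -> ~~ ((i \in I) && (emb v \in I))).

Lemma sub_extras (i : 'I_m) : i < n -> i \in I -> I = extras.
Proof.
move=> hi iI; apply/eqP; rewrite eqEcard cI card_extras leqnn andbT.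
apply/fintype.subsetP => j jI; rewrite in_extras ltnNge; apply/negP => /emb_onto [v ev].
by have := h2 v hi; rewrite iI -ev jI.
Qed.

(** By [sub_extras] no extra mode is occupied. The n vertices in I have distinct colours, so every
    colour occurs exactly once and I is the graph of a choice of vertices. *)
Lemma support_clique : ord0 \notin I ->
  exists2 s, s \in multicolored_cliques e & I = clique_set s.
Proof.
move=> zI.
have Ige j : j \in I -> n <= j.
  move=> jI; rewrite leqNgt; apply/negP => hj; move: zI.
  by rewrite (sub_extras hj jI) in_extras.
pose U := [set u | emb u \in I].
have eI : I = emb @: U.
  apply/finset.setP => j; apply/idP/imsetP => [jI|[u + ->]]; last by rewrite inE.
  by have [u eu] := emb_onto (Ige j jI); exists u; rewrite ?inE -?eu.
have cU : #|U| = n by rewrite -(card_imset _ emb_inj) -eI.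
have injU : {in U &, injective (fun u : vertex n p => u.1)}.
  move=> u v; rewrite !inE => hu hv huv; apply/eqP; apply: contraT => nuv.
  by have := h1 nuv; rewrite huv eqxx hu hv => /(_ isT).
have full_col : (fun u : vertex n p => u.1) @: U = [set: 'I_n].
  by apply/eqP; rewrite eqEcard finset.subsetT (card_in_imset injU) cU cardsT card_ord leqnn.
(* The default [Ordinal p_gt0] is never taken, since every colour occurs in U. *)
pose s : {ffun 'I_n -> 'I_p} := [ffun i => odflt (Ordinal p_gt0) [pick a | (i, a) \in U]].
have sU i : (i, s i) \in U.
  have : i \in (fun u : vertex n p => u.1) @: U by rewrite full_col inE.
  case/imsetP => -[i' a] hU /= ->; rewrite ffunE; case: pickP => [//|/(_ a)].
  by rewrite hU.
exists s; last first.
  rewrite eI; apply/finset.setP => j; apply/imsetP/imsetP => [[u uU ->]|[i _ ->]].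
    by exists u.1 => //; congr emb; apply: injU.
  by exists (i, s i).
rewrite inE; apply/forallP => i; apply/forallP => j; apply/implyP => ij.
apply: contraT => ne; have uv : (i, s i) != (j, s j) by apply: contra ij => /eqP [->].
have := h1 uv; rewrite ne orbT => /(_ isT).
by have := sU i; have := sU j; rewrite !inE => -> ->.
Qed.

End Support.

(** * Amplitudes produced by the circuit *)

Section Amplitudes.
Variables (R : realType) (t : nat).
Let K := instance_circuit t m bad.
Definition clique_vector : fock R m := described_vector R n m K.

Definition weight : R := (2 ^ t.+1 - 1)%:R.

Local Open Scope ring_scope.
Local Open Scope complex_scope.

(** The digits stand for ok + 2 w (2 ^ t - 1); the premise rules out high digits without the lowest
    one. *)
Lemma gaussian_amplitude (ok w : bool) : (w -> ok) ->
  gaussian R [:: false, ok & nseq t w] [::] =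
  (if ok then (if w then weight else 1) else 0)%:C.
Proof.
move=> wok; rewrite /gaussian /int_of_bits /= ?expr0 ?mul1r.
have h : foldr (fun (b : bool) k => (b + k.*2)%N) 0%N (nseq t w) = (w * (2 ^ t - 1))%N.
  elim: (t) => [|k IH] /=; rewrite ?muln0 // IH expnS; case: w {IH wok} => /=; lia.
rewrite h /weight; congr (_ +i* _).
have e2 : (0 < 2 ^ t)%N by rewrite expn_gt0.
case: ok w wok {h} => [] [] wok //=; last by have := wok isT.
by rewrite -pmulrn; congr _%:R; rewrite expnS; lia.
Qed.

Lemma bad_lt : all (fun x : nat * nat => (x.1 < m)%N && (x.2 < m)%N) bad.
Proof.
have hv u : u \in vertices n p -> (u.2 < m)%N.
  by rewrite verticesE => /mapP [v _ ->]; exact: mode_lt.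
have bound : size bits = size [seq (u, v) | u <- vertices n p, v <- vertices n p].
  have sv : size (vertices n p) = size (enum {: vertex n p}) by rewrite verticesE size_map.
  by rewrite /bits [LHS]size_allpairs [RHS]size_allpairs sv.
rewrite all_cat !all_map; apply/andP; split.
  rewrite all_filter; apply/allP => -[[u v] b] /(map_f fst) /=.
  rewrite -/(unzip1 _) unzip1_zip ?bound // => /allpairsP [[u' v'] [/= hu' hv' [-> ->]]].
  by rewrite !hv ?implybT.
apply/allP => _ /allpairsP [[i v] [hi /hv /= hv' ->]] /=; rewrite hv' andbT.
by rewrite mem_iota in hi; apply: leq_trans hi _; exact: leq_addr.
Qed.

Lemma clique_vectorE (I : {set 'I_m}) : clique_vector I =
  (if (#|I| == n) && all (fun x : nat * nat => ~~ (nth false [seq i \in I | i <- enum 'I_m] x.1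
      && nth false [seq i \in I | i <- enum 'I_m] x.2)) bad
   then (if ord0 \in I then 1 else weight) else 0)%:C.
Proof.
rewrite ffunE; case: eqP => //= _; rewrite /circuit_amplitude /=.
set x := [seq _ | i <- _]; set ok := all _ _.
have sx : size x = m by rewrite size_map size_enum_ord.
have [e0 e1 e2] := instance_wire_values (isT : (0 < m)%N) sx bad_lt.
rewrite map_nseq -/(eval_gates x (instance_gates m bad)) e0 e1 e2 -/ok.
have -> : nth false x 0 = (ord0 \in I).
  rewrite (nth_map ord0) ?size_enum_ord //; congr (_ \in I).
  by apply: val_inj; rewrite /= nth_enum_ord.
rewrite gaussian_amplitude; last by case/andP.
by clearbody ok; case: ok {e1 e2}; case: (ord0 \in I).
Qed.

End Amplitudes.
End Instance.

Section CliqueVector.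
Variables (R : realType) (n0 p : nat).
Notation n := n0.+1.
Variables (e : rel (vertex n p)) (t : nat).
Hypothesis p_gt0 : 0 < p.
Notation m := (n + n * p).
Let bits := [seq e u v | u <- enum {: vertex n p}, v <- enum {: vertex n p}].
Let bad := bad_pairs n p bits.
Let Phi := clique_vector e R t.

Definition compatible (I : {set 'I_m}) : Prop :=
  (forall u v : vertex n p, u != v -> (u.1 == v.1) || ~~ e u v ->
     ~~ ((emb u \in I) && (emb v \in I))) /\
  (forall (i : 'I_m) (v : vertex n p), i < n -> ~~ ((i \in I) && (emb v \in I))).

Lemma compatibleP (I : {set 'I_m}) :
  reflect (compatible I) (all (fun x : nat * nat => ~~ (nth false [seq i \in I | i <- enum 'I_m] x.1
      && nth false [seq i \in I | i <- enum 'I_m] x.2)) bad).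
Proof.
set inI := nth false _.
have inE' (j : 'I_m) : inI j = (j \in I).
  by rewrite /inI (nth_map j) ?size_enum_ord ?nth_ord_enum.
have emode u : inI (mode u) = (emb u \in I) by rewrite -inE'.
have hb := bad_pairsP e p_gt0 inI.
apply: (iffP idP) => [/hb [h1 h2]|[h1 h2]].
  split=> [u v|i v hi]; first by rewrite -!emode; exact: h1.
  by rewrite -emode -inE'; exact: (h2 (Ordinal hi) v).
apply/hb; split=> [u v|i v]; first by rewrite !emode; exact: h1.
rewrite emode; have hi : i < m by apply: leq_trans (ltn_ord i) (leq_addr _ _).
by have := h2 (Ordinal hi) v (ltn_ord i); rewrite -inE'.
Qed.

Lemma compatible_extras : compatible (extras n0 p).
Proof.
have h u : (emb u \in extras n0 p) = false by rewrite in_extras ltnNge leq_addr.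
by split=> [u v _ _|i v hi]; rewrite !h ?andbF.
Qed.

Lemma compatible_clique s : s \in multicolored_cliques e -> compatible (clique_set s).
Proof.
rewrite inE => /forallP hs; split=> [u v uv huv|i v hi]; last first.
  by apply/negP => /andP [/clique_set_ge]; rewrite leqNgt hi.
apply/negP => /andP [/imsetP [i _ /(emb_inj p_gt0) eu] /imsetP [j _ /(emb_inj p_gt0) ev]].
have ij : i != j by apply: contra uv => /eqP ij; rewrite eu ev ij.
have /implyP /(_ ij) hij := forallP (hs i) j.
by move: huv; rewrite eu ev hij orbF /= (negPf ij).
Qed.

Local Open Scope ring_scope.
Local Open Scope complex_scope.

Lemma clique_vector_extras : Phi (extras n0 p) = 1.
Proof.
rewrite /Phi clique_vectorE // card_extras eqxx /=.
by rewrite (introT (compatibleP _) compatible_extras) in_extras.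
Qed.

Lemma clique_vector_clique s : s \in multicolored_cliques e ->
  Phi (clique_set s) = (weight R t)%:C.
Proof.
move=> hs; rewrite /Phi clique_vectorE // (card_clique_set p_gt0) eqxx /=.
rewrite (introT (compatibleP _) (compatible_clique hs)).
by case: ifP => // /clique_set_ge.
Qed.

Lemma clique_vector_support (I : {set 'I_m}) : Phi I != 0 ->
  I = extras n0 p \/ exists2 s, s \in multicolored_cliques e & I = clique_set s.
Proof.
rewrite /Phi clique_vectorE //; case: ifP => [/andP [/eqP cI /compatibleP [h1 h2]] _|_]; last first.
  by rewrite rmorph0 eqxx.
case: (boolP (ord0 \in I)) => zI; first by left; exact: (sub_extras p_gt0 cI h2 _ zI).
by right; exact: (support_clique p_gt0 cI h1 h2 zI).
Qed.

Lemma clique_vector_neq0 : Phi <> 0.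
Proof.
move=> h; have := clique_vector_extras; rewrite h ffunE => /eqP.
by rewrite eq_sym oner_eq0.
Qed.

Lemma sqmod_realC (x : R) : sqmod x%:C = x ^+ 2.
Proof.
by apply: (@complexI R); rewrite sqmodC rmorphXn expr2 -[Num.conj _]/(x -i* 0) oppr0.
Qed.

Lemma no_clique_decision (M : 'M[R[i]]_(n, m)) (pv o : 'rV[R[i]]_m) :
  #|multicolored_cliques e| = 0%N ->
  M \is unitarymx -> (pv <= M)%MS -> (forall i, ip o (row i M) = 0) ->
  pv + o = delta_mx 0 ord0 -> OPT n Phi - 8^-1 <= overlap (wedge M) Phi ->
  vnorm2 o <= 8^-1.
Proof.
move=> h0 hM hp ho hpo near; apply: (decide_no hM hp ho hpo (card_extras n0 p) _ _ near).
- by rewrite in_extras.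
- by rewrite clique_vector_extras sqmod_realC expr1n.
move=> I nI; apply/eqP; case: (eqVneq (Phi I) 0) => // /clique_vector_support [/eqP|[s hs]].
  by rewrite (negPf nI).
by have := card0_eq h0 s; rewrite hs.
Qed.

Lemma one_clique_decision (M : 'M[R[i]]_(n, m)) (pv o : 'rV[R[i]]_m) :
  8 <= weight R t -> #|multicolored_cliques e| = 1%N ->
  M \is unitarymx -> (pv <= M)%MS -> (forall i, ip o (row i M) = 0) ->
  pv + o = delta_mx 0 ord0 -> OPT n Phi - 8^-1 <= overlap (wedge M) Phi ->
  2^-1 < vnorm2 o.
Proof.
move=> w8 /eqP /cards1P [s hs] hM hp ho hpo near.
have sc : s \in multicolored_cliques e by rewrite hs finset.in_set1.
apply: (@decide_yes _ _ _ _ _ _ _ hM hp ho hpo _ (extras n0 p) _ _ near _ _ w8 (card_clique_set p_gt0 s)).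
- by rewrite in_extras.
- by rewrite clique_vector_extras sqmod_realC expr1n.
- by apply/negP => /clique_set_ge.
- by rewrite clique_vector_clique // sqmod_realC.
move=> I nE nC; apply/eqP; case: (eqVneq (Phi I) 0) => // /clique_vector_support [/eqP|[s']].
  by rewrite (negPf nE).
by rewrite hs finset.in_set1 => /eqP -> /eqP; rewrite (negPf nC).
Qed.

Lemma OPT_no_clique : #|multicolored_cliques e| = 0%N -> 1 <= OPT n Phi.
Proof.
move=> h0; have := OPT_coord Phi (card_extras n0 p).
have h I : I != extras n0 p -> Phi I = 0.
  move=> nI; apply/eqP; case: (eqVneq (Phi I) 0) => // /clique_vector_support [/eqP|[s hs]].
    by rewrite (negPf nI).
  by have := card0_eq h0 s; rewrite hs.
rewrite /sqnorm (bigD1 (extras n0 p)) //= big1 => [|I nI]; last by rewrite h // sqmod0.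
by rewrite clique_vector_extras sqmod_realC expr1n addr0 divr1.
Qed.

Lemma OPT_one_clique : #|multicolored_cliques e| = 1%N ->
  weight R t ^+ 2 / (weight R t ^+ 2 + 1) <= OPT n Phi.
Proof.
move=> /eqP /cards1P [s hs].
have sc : s \in multicolored_cliques e by rewrite hs finset.in_set1.
have := OPT_coord Phi (card_clique_set p_gt0 s).
have nEs : extras n0 p != clique_set s.
  apply/eqP => h; have : ord0 \in clique_set s by rewrite -h in_extras.
  by move/clique_set_ge.
rewrite /sqnorm (bigD1 (clique_set s)) //= (bigD1 (extras n0 p)) //= big1 ?addr0.
  by rewrite clique_vector_extras clique_vector_clique // !sqmod_realC expr1n.
move=> I /andP [nC nE]; case: (eqVneq (Phi I) 0) => [->|]; first by rewrite sqmod0.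
move/clique_vector_support => [/eqP|[s']]; first by rewrite (negPf nE).
by rewrite hs finset.in_set1 => /eqP -> /eqP; rewrite (negPf nC).
Qed.

Local Close Scope ring_scope.
Local Close Scope complex_scope.

Lemma size_bad_pairs : size bad <= 2 * m ^ 2.
Proof.
have sv : size (vertices n p) = n * p.
  by rewrite verticesE size_map -cardT card_prod !card_ord.
have s1 := size_allpairs pair (vertices n p) (vertices n p); rewrite sv in s1.
have s2 := size_allpairs (fun i (v : nat * nat) => (i, v.2)) (iota 0 n) (vertices n p).
rewrite size_iota sv in s2.
rewrite /bad /bad_pairs size_cat size_map size_filter.
apply: leq_trans (leq_add (count_size _ _) (leqnn _)) _.
rewrite size_zip; apply: leq_trans (leq_add (geq_minl _ _) (leqnn _)) _.
by rewrite s1 s2; nia.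
Qed.

Lemma circuit_size_instance : circuit_size (instance_circuit t m bad) <= m ^ (t + 12) + (t + 12).
Proof.
rewrite /circuit_size /= size_nseq size_cat size_chain /=.
have := size_bad_pairs; have m2 : 1 < m by rewrite addSn ltnS addn_gt0 muln_gt0 p_gt0 orbT.
(* There are at most 6 m ^ 2 + 7 gates, three per bad pair, and t + 2 output wires. Then 6 <= 2 ^ 3
   <= m ^ 3, and the exponent 5 is below t + 12. *)
move=> h; apply: (@leq_trans (6 * m ^ 2 + (t + 12))); first by lia.
rewrite leq_add2r; apply: (@leq_trans (m ^ (3 + 2))).
  rewrite expnD leq_mul2r; apply/orP; right.
  by apply: leq_trans (_ : 2 ^ 3 <= _); rewrite // leq_exp2r.
by rewrite leq_pexp2l; lia.
Qed.

Lemma instance_wf : circuit_wf m (instance_circuit t m bad).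
Proof.
have hl := bad_lt e.
have wf_chain ok l k : m <= ok -> all (fun x : nat * nat => (x.1 < m) && (x.2 < m)) l ->
    k < size (chain ok l) ->
    ((nth (0, 0) (chain ok l) k).1 < ok.+1 + k) && ((nth (0, 0) (chain ok l) k).2 < ok.+1 + k).
  elim: l ok k => [|x l IH] ok k hok // /andP [/andP [x1 x2] hl'].
  case: k => [|[|[|k]]] hk; rewrite [nth _ _ _]/=.
  - by apply/andP; split; rewrite addn0 ltnS; apply: leq_trans (ltnW _) hok.
  - by rewrite [(_, _).1]/= [(_, _).2]/=; lia.
  - by rewrite [(_, _).1]/= [(_, _).2]/=; lia.
  by have := IH ok.+3 k (leqW (leqW (leqW hok))) hl' hk; set q := nth _ _ _; lia.
pose ok := m.+3 + 3 * size bad.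
have sG : size (instance_gates m bad) = 3 * size bad + 7.
  by rewrite /= size_cat size_chain /=; lia.
rewrite /circuit_wf; apply/and3P; split=> //.
- apply/allP => k; rewrite mem_iota add0n => /andP [_ hk].
  rewrite -[gates _]/(instance_gates m bad) in hk *.
  have : ((nth (0, 0) (instance_gates m bad) k).1 < m + k) && ((nth (0, 0) (instance_gates m bad) k).2 < m + k).
    rewrite sG in hk; rewrite /instance_gates.
    case: k hk => [|[|[|[|k]]]] hk /=; [by lia|by lia|by lia|by lia|].
    rewrite nth_cat size_chain; case: (ltnP k (3 * size bad)) => hk'.
      have := @wf_chain m.+3 bad k _ hl; rewrite size_chain; set q := nth _ _ _.
      by move=> /(_ ltac:(lia) hk'); lia.
    have : k - 3 * size bad < 3 by lia.
    case ek : (k - 3 * size bad) => [|[|[|k']]] //= _; lia.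
  by case: (nth _ _ _).
rewrite -[gates _]/(instance_gates m bad) -[re_wires _]/(instance_wires t m bad) sG.
apply/allP => a; rewrite !inE mem_nseq => /or3P [/eqP ->|/eqP ->|/andP [_ /eqP ->]]; lia.
Qed.

End CliqueVector.

Import numFieldNormedType.Exports.

(** * The reduction *)

(* This absorbs the costs that are exponential in n and, |g n| being at most
   n + C, the factor (n + 1) ^ g n of (n + n * p) ^ g n. *)
Definition growth (K f n : nat) : nat := (f + n + 2) ^ (n.+1 * K).

Definition growth_post (K : nat) (a : nat * seq bool) : seq bool :=
  nseq (foldl (fun c _ => c * (size a.2 + a.1 + 2)) 1 (units (a.1.+1 * K))) true.

Lemma growth_postE K n out : growth_post K (n, out) = unary (growth K (size out) n).
Proof.
rewrite /growth_post /growth /unary /=; congr nseq.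
elim: (_ * K) => // k IH; have -> : units k.+1 = units k ++ [:: Leaf] by rewrite -addn1 /units nseqD.
by rewrite foldl_cat IH /= expnSr.
Qed.

Lemma Cmp_growth_post K :
  Cmp (fun a : nat * seq bool => growth K (size a.2) a.1) (growth_post K).
Proof.
rewrite /growth_post; apply: Cmp_nseq; last by fp.
pose stp (v : nat * seq bool * tree * nat) := v.2 * (size v.1.1.2 + v.1.1.1 + 2).
have hs : FP stp.
  rewrite /stp; apply: Cmp_muln; first by fp.
  apply: Cmp_addn; last by fp.
  by apply: Cmp_addn; fp.
apply: (Cmp_foldl hs (M := fun a => 2 * growth K (size a.2) a.1 + 1)).
- apply: Cmp_units; apply: Cmp_muln; [apply: Cmp_S; fp|fp].
- by fp.
- by pb; exact: pb_beta.
move=> [n out] i ile; rewrite /units take_nseq; last by rewrite size_nseq in ile.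
have -> : foldl (fun c b => stp ((n, out), b, c)) 1 (nseq i Leaf) = (size out + n + 2) ^ i.
  elim: i {ile} => // i IH; have -> : nseq i.+1 Leaf = nseq i Leaf ++ [:: Leaf] by rewrite -addn1 nseqD.
  rewrite foldl_cat IH /stp /=.
  by rewrite expnSr.
rewrite size_nseq in ile; rewrite sz_nat addn1 ltnS leq_mul2l /= /growth /=.
by rewrite leq_pexp2l // addn2.
Qed.

Lemma Cmp_computes (A B : encType) (beta : A -> nat) (f : A -> B) : Cmp beta f ->
  exists c k, forall a, computes c (enc a) (enc (f a)) ((beta a + sz a + 2) ^ k).
Proof.
move=> [c [T [[k hk] h]]]; exists c, k => a.
by apply: computes_weak (h a); exact: hk.
Qed.

(** The driver serves a second time: its first stage stores n as a parameter, the program for f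
    runs, and the last stage computes [growth] from n and f(n). As [computable] sets no time limit,
    the exponential cost is harmless. *)
Lemma computable_growth f K : computable f -> computable (fun n => growth K (f n) n).
Proof.
move=> [A hA]; have [N1 fitA] := fits_exists A; pose N := N1 + 4.
have fitN : fits N A by apply: fits_weak fitA; exact: leq_addr.
have hpre : FP (fun w : seq bool => (w, size w)) by fp.
have [cpre [k1 h1]] := Cmp_computes hpre; have [cpost [k2 h2]] := Cmp_computes (Cmp_growth_post K).
exists (driver A cpre cpost N) => n.
have [TA hTA] := hA n.
pose post out := growth_post K (n, out).
pose B0 := size (unary n) + TA.
have hhalt : halts_within A (unary n) TA by move=> r; have [] := hTA r.
have h1n := h1 (unary n); rewrite size_nseq in h1n.
have N4 : 3 < N by rewrite /N; lia.
have hpost out : size out <= B0 -> computes cpost (enc (n, out)) (enc (post out))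
    ((growth K B0 n + (2 * n + 4 * B0 + 3) + 2) ^ k2).
  move=> hs; apply: computes_weak (h2 (n, out)); apply: leq_exp_base.
  rewrite leq_add2r; apply: leq_add; first by apply: leq_exp_base; rewrite /= !leq_add2r.
  by rewrite sz_pair sz_nat; have /andP [_] := sz_bits out; move: hs; gen_sz; lia.
have [t0 [T [leT _ hT]]] := driver_run N4 fitN h1n hhalt hpost.
exists T => r; have [-> ->] := hT r (size_tuple r); split=> //.
have sr : size (take TA (drop t0 r)) == TA.
  by rewrite size_takel // size_drop size_tuple; lia.
have [_ e] := hTA (Tuple sr); rewrite /= in e.
by rewrite e /post growth_postE size_nseq.
Qed.

(** * Bounds on running times *)

Section Growth.
Local Open Scope ring_scope.
Variable R : realType.

(** The limit gives |g n| <= n beyond some N, and C is a sum that dominates the finitely many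
    earlier values. *)
Lemma little_o_bound (g : nat -> R) : little_o_id g ->
  exists C : nat, forall n, `|g n| <= (n + C)%:R.
Proof.
move=> /cvgrPdist_lt /(_ 1 ltr01) [N _ hN].
exists (\sum_(k < N.+1) (Num.truncn `|g k|).+1)%N => n.
have [nN|Nn] := leqP n N.
  apply: (@le_trans _ _ ((Num.truncn `|g n|).+1)%:R).
    exact/ltW/truncnS_gt.
  rewrite ler_nat; apply: leq_trans (leq_addl _ _).
  by rewrite (bigD1 (Ordinal (nN : n < N.+1)%N)) //= leq_addr.
have n0 : (0 : R) < n%:R by rewrite ltr0n (leq_ltn_trans _ Nn).
have := hN n (ltnW Nn); rewrite /= sub0r normrN normf_div (gtr0_norm n0) ltr_pdivrMr // mul1r.
by move/ltW/le_trans; apply; rewrite ler_nat leq_addr.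
Qed.

Lemma little_o_affine (g : nat -> R) k : little_o_id g ->
  little_o_id (fun n => k%:R * (1 + `|g n|)).
Proof.
move=> hg; apply/cvgrPdist_lt => eps eps0.
have d0 : 0 < eps / (2 * k.+1%:R) by rewrite divr_gt0 // mulr_gt0 ?ltr0n.
move/cvgrPdist_lt: hg => /(_ _ d0) [N _ hN].
exists (maxn N (Num.truncn (2 * k.+1%:R / eps)).+1) => // n /=.
rewrite geq_max => /andP [Nn tn].
have n0 : (0 : R) < n%:R by rewrite ltr0n (leq_trans _ tn).
have := hN n Nn; rewrite /= !sub0r !normrN => h1.
have h2 : n%:R^-1 < eps / (2 * k.+1%:R).
  rewrite -[ltRHS]invrK ltf_pV2 ?posrE ?invr_gt0 //.
  rewrite invf_div; apply: lt_le_trans (_ : ((Num.truncn (2 * k.+1%:R / eps)).+1)%:R <= _); last by rewrite ler_nat.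
  exact: truncnS_gt.
have -> : k%:R * (1 + `|g n|) / n%:R = k%:R * (n%:R^-1 + `|g n / n%:R|).
  by rewrite normf_div (gtr0_norm n0) -mulrA mulrDl mul1r.
rewrite ger0_norm ?mulr_ge0 ?ler0n ?addr_ge0 ?invr_ge0 //.
apply: (@le_lt_trans _ _ (k%:R * (eps / k.+1%:R))).
  apply: ler_wpM2l; rewrite ?ler0n //.
  have -> : eps / k.+1%:R = eps / (2 * k.+1%:R) + eps / (2 * k.+1%:R).
    have : k.+1%:R != 0 :> R by rewrite pnatr_eq0.
    by move: (k.+1%:R : R) => x x0; field.
  by apply/ltW/ltrD.
by rewrite mulrCA gtr_pMr // ltr_pdivrMr ?ltr0n // mul1r ltr_nat.
Qed.

(** With b = f + n + 2, the bounds n + n p <= 2 n p and 2 n <= b ^ 2 give (n + n p) ^ g <= b ^ (2 (n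
    + C)) p ^ |g|. Moreover 10 <= b ^ 3, as b >= 3, and p + 1 <= 2 p. The exponents of b add up to 3
    (n + 1) + 2 + 2 (n + C), at most (n + 1) (7 + 2 C). *)
Lemma time_bound (f n p TA C k : nat) (g : R) : (0 < n)%N -> (0 < p)%N ->
  `|g| <= (n + C)%:R -> TA%:R <= f%:R * (n + n * p)%:R `^ g ->
  ((10 ^ n.+1 * p.+1 * TA.+1) ^ k)%:R <=
    (growth (k * (7 + 2 * C)) f n)%:R * p%:R `^ (k%:R * (1 + `|g|)).
Proof.
move=> n0 p0 hg hT.
have p1 : 1 <= p%:R :> R by rewrite ler1n.
set h := `|g| in hg *.
have h0 : 0 <= h := normr_ge0 g.
have pp : 1 <= p%:R `^ h by rewrite -[leLHS](powRr0 p%:R) ler_powR.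
pose b := (f + n + 2)%N.
have b1 : (0 < b)%N by rewrite /b addn2.
have hm : (n + n * p)%:R `^ g <= (b ^ (2 * (n + C)))%:R * p%:R `^ h.
  have m1 : 1 <= (n + n * p)%:R :> R by rewrite ler1n addn_gt0 n0.
  apply: le_trans (ler_powR m1 (ler_norm g)) _; rewrite -/h.
  apply: (@le_trans _ _ (((2 * n) * p)%:R `^ h)).
    by apply: ge0_ler_powR; rewrite ?nnegrE ?ler0n ?ler_nat //; nia.
  rewrite natrM powRM ?ler0n // ler_wpM2r ?powR_ge0 //.
  have n1 : 1 <= (2 * n)%:R :> R by rewrite ler1n muln_gt0.
  apply: le_trans (ler_powR n1 hg) _; rewrite powR_mulrn ?ler0n // -natrX ler_nat.
  by rewrite mulnC expnM mulnC leq_exp_base // /b; nia.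
have hTA : (TA.+1)%:R <= (b * b ^ (2 * (n + C)))%:R * p%:R `^ h.
  rewrite -natr1; apply: (@le_trans _ _ (f%:R * ((b ^ (2 * (n + C)))%:R * p%:R `^ h) + 1)).
    by rewrite lerD2r; apply: le_trans hT _; rewrite ler_wpM2l ?ler0n.
  apply: (@le_trans _ _ ((f%:R + 1) * ((b ^ (2 * (n + C)))%:R * p%:R `^ h))).
    rewrite mulrDl lerD2l mul1r -[leLHS]mul1r ler_pM // ler1n expn_gt0 b1 //.
  rewrite natrM -mulrA ler_wpM2r ?mulr_ge0 ?ler0n ?powR_ge0 //.
  by rewrite natr1 ler_nat /b; lia.
have h10 : (10 ^ n.+1 <= b ^ (3 * n.+1))%N.
  by rewrite expnM leq_exp_base // (@leq_trans (3 ^ 3)) // leq_exp_base // /b; lia.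
have -> : p%:R `^ (k%:R * (1 + h)) = (p%:R * p%:R `^ h) ^+ k :> R.
  rewrite mulrC powRrM powR_mulrn ?powR_ge0 // powRD ?powRr1 ?ler0n //.
  by rewrite pnatr_eq0 -lt0n p0 implybT.
have -> : growth (k * (7 + 2 * C)) f n = ((b ^ (n.+1 * (7 + 2 * C))) ^ k)%N.
  by rewrite /growth -/b -expnM; congr (_ ^ _)%N; rewrite mulnCA mulnC.
rewrite natrX [in leRHS]natrX -exprMn; case: k => [|k]; first by rewrite !expr0.
rewrite ler_pXn2r ?nnegrE ?mulr_ge0 ?ler0n ?powR_ge0 //.
rewrite (natrM _ (10 ^ n.+1 * p.+1)) (natrM _ (10 ^ n.+1)).
apply: (@le_trans _ _ ((b ^ (3 * n.+1))%:R * (2 * p%:R) * ((b * b ^ (2 * (n + C)))%:R * p%:R `^ h))).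
  apply: ler_pM; rewrite ?mulr_ge0 ?ler0n //.
  apply: ler_pM; rewrite ?ler0n ?ler_nat // -natrM ler_nat; lia.
have -> : (b ^ (3 * n.+1))%:R * (2 * p%:R) * ((b * b ^ (2 * (n + C)))%:R * p%:R `^ h)
    = (b ^ (3 * n.+1) * 2 * (b * b ^ (2 * (n + C))))%:R * (p%:R * p%:R `^ h) :> R.
  by rewrite (natrM _ (b ^ (3 * n.+1) * 2)) (natrM _ (b ^ (3 * n.+1))); ring.
apply: ler_wpM2r; first by rewrite mulr_ge0 ?ler0n ?powR_ge0.
rewrite ler_nat.
apply: (@leq_trans (b ^ (3 * n.+1) * b ^ 1 * (b ^ 1 * b ^ (2 * (n + C))))).
  rewrite expn1 leq_mul // leq_mul // /b; lia.
by rewrite -!expnD leq_pexp2l //; nia.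
Qed.

End Growth.

(** [S0] bounds the tree size of the encoded graph, four times its length plus 1; [T1] and [T3] are
    the costs of the two tree programs, and the last line is the overhead in [driver_run]. *)
Definition reduction_time (N k1 k2 n p TA : nat) : nat :=
  let S0 := 4 * (2 * n + 2 * p + 2 * (n * p) ^ 2 + 3) + 1 in
  let T1 := (S0 + 2) ^ k1 in
  let T3 := (10 ^ n + (2 * n + 2 * (n + n * p) + 4 * (S0 + T1 + TA) + 6) + 2) ^ k2 in
  1000 * N * (S0 + T1 + TA + T3 + 1).

Lemma reduction_time_poly N k1 k2 : exists k, forall n p TA,
  reduction_time N k1 k2 n p TA <= (10 ^ n.+1 * p.+1 * TA.+1) ^ k.
Proof.
pose B (a : nat * nat * nat) := 10 ^ a.1.1.+1 * a.1.2.+1 * a.2.+1.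
have e1 n : n < 10 ^ n by rewrite ltn_expl.
have hB a : 1 < B a.
  have := e1 a.1.1; rewrite /B expnS.
  by move: (10 ^ _) (a.1.2) (a.2) => x y z hx; nia.
have hn : pb B (fun a => a.1.1).
  exists 1 => a; rewrite expn1 /B expnS.
  by have := e1 a.1.1; move: (10 ^ _) (a.1.2) (a.2) => x y z hx; nia.
have hp : pb B (fun a => a.1.2).
  exists 1 => a; rewrite expn1 /B expnS.
  by have := e1 a.1.1; move: (10 ^ _) (a.1.2) (a.2) => x y z hx; nia.
have hT : pb B (fun a => a.2).
  exists 1 => a; rewrite expn1 /B expnS.
  by have := e1 a.1.1; move: (10 ^ _) (a.1.2) (a.2) => x y z hx; nia.
have h10 : pb B (fun a => 10 ^ a.1.1).
  exists 1 => a; rewrite expn1 /B expnS.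
  by move: (10 ^ _) (a.1.2) (a.2) => x y z; nia.
have [k hk] : pb B (fun a => reduction_time N k1 k2 a.1.1 a.1.2 a.2).
  by rewrite /reduction_time; pb.
by exists k => n p TA; exact: (hk (n, p, TA)).
Qed.

Lemma size_encode ws : size (encode ws) = \sum_(w <- ws) (2 * size w).+1.
Proof.
elim: ws => [|w ws IH]; first by rewrite big_nil.
rewrite big_cons -IH /encode /= size_cat size_rcons; congr (_.+1 + _).
by elim: w => //= b w ->; lia.
Qed.

Section Reduction.
Variables (R : realType) (lambda : R) (t : nat) (A : prog).
Hypotheses (w8 : (8 <= weight R t)%R)
  (w_lambda : (lambda <= weight R t ^+ 2 / (weight R t ^+ 2 + 1))%R) (lambda1 : (lambda < 1)%R).
Hypothesis solves : solves_slater_task lambda (8^-1)%R A.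

Lemma pre_encode_graph n0 p (e : rel (vertex n0.+1 p)) :
  pre t (encode_graph e) =
    (encode_instance n0.+1 (n0.+1 + n0.+1 * p)
       (instance_circuit t (n0.+1 + n0.+1 * p) (bad_pairs n0.+1 p
         [seq e u v | u <- enum {: vertex n0.+1 p}, v <- enum {: vertex n0.+1 p}])),
     (n0.+1, n0.+1 + n0.+1 * p)).
Proof.
rewrite /pre /encode_graph decode_encode.
rewrite [head _ _]/= [head _ (behead _)]/= [head _ (behead (behead _))]/= !size_nseq.
have -> : size (true :: unary n0) = n0.+1 by rewrite -[true :: _]/(unary n0.+1) size_nseq.
by rewrite instance_bitsE.
Qed.

Lemma size_encode_graph n0 p (e : rel (vertex n0.+1 p)) :
  size (encode_graph e) = 2 * n0.+1 + 2 * p + 2 * (n0.+1 * p) ^ 2 + 3.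
Proof.
rewrite /encode_graph size_encode !big_cons big_nil !size_nseq.
have -> : size [seq e u v | u <- enum {: vertex n0.+1 p}, v <- enum {: vertex n0.+1 p}] = (n0.+1 * p) ^ 2.
  by rewrite size_allpairs -cardT card_prod !card_ord.
lia.
Qed.

Lemma reduction : exists B, distinguishes_cliques R B.
Proof.
have [cpre [k1 h1]] := Cmp_computes (FP_pre t).
have [cpost [k2 h2]] := Cmp_computes Cmp_decision.
have [N1 fitA] := fits_exists A; pose N := N1 + 4; exists (driver A cpre cpost N).
have fitN : fits N A by apply: fits_weak fitA; exact: leq_addr.
have N4 : 3 < N by rewrite /N; lia.
(* The exponent t + 12 depends on lambda alone, so a single pair f, g serves all graphs. *)
have [f [g [cf og hA]]] := solves (t + 12).
have [C hC] := little_o_bound og.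
have [k hk] := reduction_time_poly N k1 k2.
(* The advantage is 49/100 because 1/2 + 49/100 = 99/100: the reduction loses no success
   probability. *)
exists (fun n => growth (k * (7 + 2 * C)) (f n) n), (fun n => k%:R * (1 + `|g n|))%R, (49 / 100)%R.
split; [exact: computable_growth|exact: little_o_affine|by lra|].
move=> [//|n0] p e _ p_gt0 _ _; set n := n0.+1; set m := n + n * p.
pose bits := [seq e u v | u <- enum {: vertex n p}, v <- enum {: vertex n p}].
pose K := instance_circuit t m (bad_pairs n p bits).
pose Phi := clique_vector e R t.
have [TA [leTA haltA promise]] := hA n m K (leq_addr _ _) (instance_wf e t p_gt0)
  (circuit_size_instance e t p_gt0) (clique_vector_neq0 (R := R) (e := e) (t := t) p_gt0).
have hpre := h1 (encode_graph e); rewrite pre_encode_graph in hpre.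
rewrite -/n -/m -/bits -/K in hpre.
pose S0 := 4 * (2 * n + 2 * p + 2 * (n * p) ^ 2 + 3) + 1.
have szw : sz (encode_graph e) <= S0.
  by have /andP [_] := sz_bits (encode_graph e); rewrite size_encode_graph.
have leT1 : (0 + sz (encode_graph e) + 2) ^ k1 <= (S0 + 2) ^ k1.
  by apply: leq_exp_base; rewrite leq_add2r.
have {}hpre := computes_weak leT1 hpre.
have sinst : size (encode_instance n m K) <= S0 + (S0 + 2) ^ k1.
  have := computes_size hpre; rewrite -/(sz (encode_graph e)) -/(sz (encode_instance n m K, (n, m))).
  rewrite sz_pair; have /andP [h _] := sz_bits (encode_instance n m K).
  by move: h szw; gen_sz; lia.
pose post out := decision ((n, m), out).
pose T3 := (10 ^ n + (2 * n + 2 * (n + n * p) + 4 * (S0 + (S0 + 2) ^ k1 + TA) + 6) + 2) ^ k2.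
have hpost out : size out <= size (encode_instance n m K) + TA ->
    computes cpost (enc ((n, m), out)) (enc (post out)) T3.
  move=> hs; apply: computes_weak (h2 ((n, m), out)); apply: leq_exp_base.
  rewrite leq_add2r leq_add2l !sz_pair !sz_nat.
  have /andP [_] := sz_bits out; move: hs sinst; rewrite /m; gen_sz; lia.
have [t0 [T [leT leTT hT]]] := driver_run N4 fitN hpre haltA hpost.
have haltB : halts_within (driver A cpre cpost N) (encode_graph e) T.
  by move=> r; have [] := hT r (size_tuple r).
have leTR : T <= reduction_time N k1 k2 n p TA.
  apply: leq_trans leTT _; rewrite /reduction_time -/S0 -/T3 leq_mul2l; apply/orP; right.
  by rewrite !leq_add2r; have /andP [+ _] := sz_bits (encode_graph e); move: szw; gen_sz; lia.
have pr (b : bool) : (lambda <= OPT n Phi)%R ->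
    (forall S : fock R m, forall out, outputs_slater n out S ->
       (OPT n Phi - 8^-1 <= overlap S Phi)%R -> post out = [:: b]) ->
    (2^-1 + 49 / 100 <= prob R (driver A cpre cpost N) (encode_graph e) T (fun out => out = [:: b]))%R.
  move=> hopt hb; apply: (@le_trans _ _ (99 / 100)%R); first by lra.
  apply: le_trans (promise hopt) _; apply: (prob_driver _ leT) => r sr [S [hS near]].
  by have [_ ->] := hT r sr; exact: hb hS near.
exists T; split=> //.
- apply: le_trans (time_bound k (ltn0Sn n0) p_gt0 (hC n) leTA).
  by rewrite ler_nat; exact: leq_trans leTR (hk _ _ _).
- move=> h0; apply: pr => [|S out hS near].
    exact: le_trans (ltW lambda1) (OPT_no_clique R t p_gt0 h0).
  have [M [pv [w [hM eS hp ho [hpo dec]]]]] := decision_correct hS.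
  rewrite /post dec; congr [:: _]; apply/negbTE; rewrite -leNgt.
  rewrite eS in near; have := no_clique_decision p_gt0 h0 hM hp ho hpo near.
  by move/le_trans; apply; lra.
- move=> h1'; apply: pr => [|S out hS near].
    exact: le_trans w_lambda (OPT_one_clique R t p_gt0 h1').
  have [M [pv [w [hM eS hp ho [hpo dec]]]]] := decision_correct hS.
  rewrite /post dec; congr [:: _].
  rewrite eS in near; exact: (one_clique_decision p_gt0 w8 h1' hM hp ho hpo near).
Qed.

End Reduction.

(** The second bound amounts to lambda <= k^2 (1 - lambda). As k^2 >= k, it is enough that k >=
    |lambda| / (1 - lambda), where the modulus covers negative lambda; the summand 8 in the choice
    of t secures the first bound. *)
Lemma large_weight (R : realType) (lambda : R) : (lambda < 1)%R -> exists t,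
  (8 <= weight R t)%R /\ (lambda <= weight R t ^+ 2 / (weight R t ^+ 2 + 1))%R.
Proof.
move=> l1; have d0 : (0 < 1 - lambda)%R by rewrite subr_gt0.
pose q := (Num.truncn (`|lambda| / (1 - lambda))).+1; exists (q + 8).
have wq : (q%:R + 8 <= weight R (q + 8))%R.
  rewrite /weight -(natrD _ q 8) ler_nat.
  have := ltn_expl (q + 8).+1 (ltnSn 1); lia.
have hq : (`|lambda| / (1 - lambda) < q%:R)%R by exact: truncnS_gt.
have q0 : (0 <= q%:R :> R)%R by rewrite ler0n.
split; first by lra.
set w := weight _ _ in wq *.
have w1 : (1 <= w)%R by lra.
have hw : (lambda <= w * (1 - lambda))%R.
  apply: le_trans (ler_norm _) _; rewrite -ler_pdivrMr //; lra.
have w2 : (w <= w ^+ 2)%R by rewrite expr2 ler_peMl //; lra.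
have w20 : (0 < w ^+ 2 + 1)%R by lra.
rewrite ler_pdivlMr //.
have : (w * (1 - lambda) <= w ^+ 2 * (1 - lambda))%R by rewrite ler_pM2r.
by rewrite mulrBr mulr1 mulrDr mulr1 [(lambda * _)%R]mulrC; lra.
Qed.

Local Open Scope ring_scope.

Theorem theorem3 (R : realType) (lambda : R) (hlambda : lambda < 1)
    (hclique : multicolored_clique_assumption R) :
  exists eps : R, 0 < eps /\ forall A : prog, ~ solves_slater_task lambda eps A.
Proof.
have [t [w8 wl]] := large_weight hlambda.
exists 8^-1; split; first by rewrite invr_gt0.
by move=> A /(reduction w8 wl hlambda) [B]; exact: hclique.
Qed.
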